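(* Let $\Omega\subset\mathbb{R}^d$ be a compact set, let $\mathrm{P},\mathrm{Q}\in\mathcal{P}(\Omega)$, and let $\mathrm{P}_n$ (resp. $\mathrm{Q}_m$) be the empirical measure of an i.i.d. sample $\mathbf{X}_1,\dots,\mathbf{X}_n$ with law $\mathrm{P}$ (resp. $\mathbf{Y}_1,\dots,\mathbf{Y}_m$ with law $\mathrm{Q}$). Suppose $m=m(n)\to\infty$ and $\frac{m}{n+m}\to\lambda\in(0,1)$. (a) If $\mathrm{P}=\mathrm{Q}$, then $$D_\epsilon(\mathrm{P}_n,\mathrm{Q}_m)=\frac{\epsilon}{2}\,\mathbb{M}(\mathrm{P}_n-\mathrm{Q}_m,\mathrm{P}_n-\mathrm{Q}_m)+o_{\mathbb{P}}\left(\frac{n+m}{n\,m}\right)$$ and $D_\epsilon(\mathrm{P}_n,\mathrm{P})=\frac{\epsilon}{2}\,\mathbb{M}(\mathrm{P}_n-\mathrm{P},\mathrm{P}_n-\mathrm{P})+o_{\mathbb{P}}\left(\frac1n\right)$. (b) If $\mathrm{P}\neq\mathrm{Q}$, then $$D_\epsilon(\mathrm{P}_n,\mathrm{Q}_m)-D_\epsilon(\mathrm{P},\mathrm{Q})=\int\psi_{\mathrm{P},\mathrm{Q}}\,d(\mathrm{P}_n-\mathrm{P})+\int\psi_{\mathrm{Q},\mathrm{P}}\,d(\mathrm{Q}_m-\mathrm{Q})+o_{\mathbb{P}}\left(\sqrt{\tfrac{n+m}{n\,m}}\right)$$ and $D_\epsilon(\mathrm{P}_n,\mathrm{Q})-D_\epsilon(\mathrm{P},\mathrm{Q})=\int\psi_{\mathrm{P},\mathrm{Q}}\,d(\mathrm{P}_n-\mathrm{P})+o_{\mathbb{P}}(n^{-1/2})$,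 where $\psi_{\mathrm{P},\mathrm{Q}}=f_{\mathrm{P},\mathrm{Q}}-\frac12(f_{\mathrm{P},\mathrm{P}}+g_{\mathrm{P},\mathrm{P}})$ and $\psi_{\mathrm{Q},\mathrm{P}}=f_{\mathrm{Q},\mathrm{P}}-\frac12(f_{\mathrm{Q},\mathrm{Q}}+g_{\mathrm{Q},\mathrm{Q}})$.
   Context: Fix $\epsilon>0$ and set $s=\lceil d/2\rceil+1$. $\mathcal{P}(\Omega)$ is the set of Borel probability measures on $\Omega$. $\mathcal{C}^s(\Omega)$ is the space of functions on $\Omega$ with uniformly bounded partial derivatives up to order $s$, with norm $\sum_{|\beta|\le s}\|D^\beta f\|_\infty$, and $(\mathcal{C}^s(\Omega))'$ its dual. For $\mu,\nu\in\mathcal{P}(\Omega)$, $S_\epsilon(\mu,\nu)=\min_\pi\int\frac12\|\mathbf{x}-\mathbf{y}\|^2d\pi+\epsilon H(\pi\mid\mu\otimes\nu)$ over couplings $\pi$ of $\mu,\nu$ ($H$ = relative entropy), and the Sinkhorn divergence is $D_\epsilon(\mu,\nu)=S_\epsilon(\mu,\nu)-\frac12(S_\epsilon(\mu,\mu)+S_\epsilon(\nu,\nu))$. $(f_{\mu,\nu},g_{\mu,\nu})$ denotes a maximizer of the dual problem $\sup_{f\in L_1(\mu),g\in L_1(\nu)}\int f\,d\mu+\int g\,d\nu-\epsilon\iint e^{(f(\mathbf{x})+g(\mathbf{y})-\frac12\|\mathbf{x}-\mathbf{y}\|^2)/\epsilon}d\mu(\mathbf{x})d\nu(\mathbf{y})+\epsilon$,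 unique up to $(f+c,g-c)$, $c\in\mathbb{R}$ (normalized by $\int g_{\mu,\nu}d\nu=0$), and extended to all of $\Omega$ by $f_{\mu,\nu}=-\epsilon\log\int e^{(g_{\mu,\nu}(\mathbf{y})-\frac12\|\cdot-\mathbf{y}\|^2)/\epsilon}d\nu(\mathbf{y})$ and $g_{\mu,\nu}=-\epsilon\log\int e^{(f_{\mu,\nu}(\mathbf{x})-\frac12\|\mathbf{x}-\cdot\|^2)/\epsilon}d\mu(\mathbf{x})$. $\xi_{\mathrm{P},\mathrm{P}}(\mathbf{x},\mathbf{y})=e^{(f_{\mathrm{P},\mathrm{P}}(\mathbf{x})+g_{\mathrm{P},\mathrm{P}}(\mathbf{y})-\frac12\|\mathbf{x}-\mathbf{y}\|^2)/\epsilon}$, a symmetric function. In part (a), $\mathcal{A}_{\mathrm{P}}f=\int\xi_{\mathrm{P},\mathrm{P}}(\mathbf{x},\cdot)f(\mathbf{x})d\mathrm{P}(\mathbf{x})$; for $\nu\in(\mathcal{C}^s(\Omega))'$, $\mathbf{i}_{\xi_{\mathrm{P},\mathrm{P}}}(\nu)$ is the function $\mathbf{y}\mapsto\nu(\xi_{\mathrm{P},\mathrm{P}}(\cdot,\mathbf{y}))$; $\mathcal{S}$ is the closure in $(\mathcal{C}^s(\Omega))'$ of the set of finite signed Borel measures on $\Omega$ with total mass $0$; and $\mathbb{M}:\mathcal{S}\times\mathcal{S}\to\mathbb{R}$ is $\mathbb{M}(\nu,\mu)=\nu\big((1-\mathcal{A}_{\mathrm{P}}^2)^{-1}\mathbf{i}_{\xi_{\mathrm{P},\mathrm{P}}}(\mu)\big)$,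 where $(1-\mathcal{A}_{\mathrm{P}}^2)^{-1}$ is the inverse on $\{f\in\mathcal{C}^s(\Omega):\int f\,d\mathrm{P}=0\}$. $w_n=o_{\mathbb{P}}(a_n)$ means $w_n/a_n\to0$ in probability. *)

(* Defs.v *)
From HB Require Import structures.
From mathcomp Require Import all_boot all_order all_algebra.
From mathcomp Require Import finmap.
From mathcomp Require Import all_classical all_reals all_analysis.

Set Implicit Arguments.
Unset Strict Implicit.
Unset Printing Implicit Defensive.

Import Order.TTheory GRing.Theory Num.Theory.
Import numFieldNormedType.Exports.

Local Open Scope classical_set_scope.
Local Open Scope ring_scope.

(* The Borel sigma-algebra of R^d, d-dimensional vectors being 'rV[R]_d. *)
HB.instance Definition _ (R : realType) (d : nat) :=
  @isMeasurable.Build default_measure_display 'rV[R]_d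
    <<s [set U : set 'rV[R]_d | open U] >>
    (@sigma_algebra0 _ setT _) (@sigma_algebraC _ _)
    (@sigma_algebra_bigcup _ setT _).

Section entropic_transport.
Context (R : realType) (d : nat).
Local Notation T := 'rV[R]_d.

(* The topology of 'rV[R]_d comes from the sup norm, hence the explicit
   Euclidean norm. *)
Definition half_sqdist (x y : T) : R :=
  2^-1 * \sum_(i < d) (x ord0 i - y ord0 i) ^+ 2.

(* Defined for probabilities only: the integral never is of the form oo - oo,
   because t ln t is bounded below. *)
Definition relative_entropy d' (U : measurableType d')
    (pi m : probability U R) : \bar R :=
  if `[< pi `<< m >] then
    (\int[pi]_z (ln (fine
       (Radon_Nikodym (charge_of_finite_measure pi) m z)))%:E)%E
  else +oo%E.

Definition coupling (mu nu : probability T R) : set (probability (T * T)%type R) :=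
  [set pi | forall A : set T, measurable A ->
     pi (A `*` setT) = mu A /\ pi (setT `*` A) = nu A].

Definition entropic_cost (eps : R) (mu nu : probability T R)
    (pi : probability (T * T)%type R) : \bar R :=
  (\int[pi]_z (half_sqdist z.1 z.2)%:E
   + eps%:E * relative_entropy pi (mu \x nu)%E)%E.

Definition S_eps (eps : R) (mu nu : probability T R) : R :=
  fine (ereal_inf (entropic_cost eps mu nu @` coupling mu nu)).

Definition D_eps (eps : R) (mu nu : probability T R) : R :=
  S_eps eps mu nu - 2^-1 * (S_eps eps mu mu + S_eps eps nu nu).

Definition dual_objective (eps : R) (mu nu : probability T R)
    (f g : T -> R) : \bar R :=
  (\int[mu]_x (f x)%:E + \int[nu]_y (g y)%:E
   - eps%:E * \int[(mu \x nu)%E]_z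
       (expR ((f z.1 + g z.2 - half_sqdist z.1 z.2) / eps))%:E
   + eps%:E)%E.

Definition L1 (mu : probability T R) (f : T -> R) : Prop :=
  mu.-integrable setT (EFin \o f).

Definition dual_maximizer (eps : R) (mu nu : probability T R)
    (fg : (T -> R) * (T -> R)) : Prop :=
  [/\ L1 mu fg.1, L1 nu fg.2 &
      forall f g, L1 mu f -> L1 nu g ->
        (dual_objective eps mu nu f g <= dual_objective eps mu nu fg.1 fg.2)%E].

(* The extension formulas are imposed on the whole of R^d. *)
Definition is_potentials (eps : R) (mu nu : probability T R)
    (fg : (T -> R) * (T -> R)) : Prop :=
  [/\ dual_maximizer eps mu nu fg,
      \int[nu]_y fg.2 y = 0,
      forall x, fg.1 x =
        - eps * ln (\int[nu]_y expR ((fg.2 y - half_sqdist x y) / eps)) &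
      forall y, fg.2 y =
        - eps * ln (\int[mu]_x expR ((fg.1 x - half_sqdist x y) / eps))].

Definition potentials (eps : R) (mu nu : probability T R) :
    (T -> R) * (T -> R) :=
  xget (cst 0, cst 0) [set fg | is_potentials eps mu nu fg].

Definition f_pot eps mu nu : T -> R := (potentials eps mu nu).1.
Definition g_pot eps mu nu : T -> R := (potentials eps mu nu).2.

Definition psi eps mu nu (x : T) : R :=
  f_pot eps mu nu x - 2^-1 * (f_pot eps mu mu x + g_pot eps mu mu x).

Definition xi eps (P : probability T R) (x y : T) : R :=
  expR ((f_pot eps P P x + g_pot eps P P y - half_sqdist x y) / eps).

End entropic_transport.

Section smooth_functions.
Context (R : realType) (d : nat).
Local Notation T := 'rV[R]_d.

Definition partial (i : 'I_d) (f : T -> R) : T -> R :=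
  fun x => derive f x (delta_mx ord0 i).

Fixpoint is_Ck (k : nat) (f : T -> R) : Prop :=
  if k is k'.+1 then
    [/\ continuous f,
        forall i x, derivable f x (delta_mx ord0 i) &
        forall i, is_Ck k' (partial i f)]
  else continuous f.

Definition multi_partial n (beta : {ffun 'I_d -> 'I_n}) (f : T -> R) : T -> R :=
  foldr (fun i g => iter (beta i) (partial i) g) f (enum 'I_d).

Definition Ck_sup (s : nat) (Omega : set T) (F : T -> R) : R :=
  \sum_(beta : {ffun 'I_d -> 'I_s.+1} | (\sum_i beta i <= s)%N)
    sup [set `|multi_partial beta F x| | x in Omega].

(* For a compact Omega that need not be the closure of its interior, C^s(Omega)
   is the set of restrictions to Omega of C^s functions. A function on Omega is
   represented by any function on R^d with the same values on Omega. *)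
Definition Cs_extension (s : nat) (Omega : set T) (f : T -> R) : set (T -> R) :=
  [set F | is_Ck s F /\ forall x, Omega x -> F x = f x].

Definition Cs (s : nat) (Omega : set T) (f : T -> R) : Prop :=
  Cs_extension s Omega f !=set0.

(* When Omega is the closure of its interior, the derivatives on Omega do not
   depend on the extension and this is \sum_(|beta| <= s) |D^beta f|_oo; in
   general it is the quotient norm. *)
Definition Cs_norm (s : nat) (Omega : set T) (f : T -> R) : R :=
  inf (Ck_sup s Omega @` Cs_extension s Omega f).

Definition Cs_dual (s : nat) (Omega : set T) (nu : (T -> R) -> R) : Prop :=
  (forall (a : R) f g, Cs s Omega f -> Cs s Omega g ->
     nu (fun x => a * f x + g x) = a * nu f + nu g) /\
  (exists C : R, forall f, Cs s Omega f -> `|nu f| <= C * Cs_norm s Omega f).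

(* The signed measure mu - nu on Omega, as a functional. *)
Definition meas_diff (Omega : set T) (mu nu : {measure set T -> \bar R})
    (f : T -> R) : R :=
  \int[mu]_(x in Omega) f x - \int[nu]_(x in Omega) f x.

(* By the Jordan decomposition, the finite signed measures on Omega are the
   differences of finite positive measures on Omega. *)
Definition null_mass_measure (Omega : set T) (L : (T -> R) -> R) : Prop :=
  exists k1 k2 : {finite_measure set T -> \bar R},
    [/\ k1 (~` Omega) = 0%E, k2 (~` Omega) = 0%E, k1 Omega = k2 Omega &
        L = meas_diff Omega k1 k2].

Definition S_space (s : nat) (Omega : set T) (nu : (T -> R) -> R) : Prop :=
  Cs_dual s Omega nu /\
  forall e : R, 0 < e -> exists2 L, null_mass_measure Omega L &
    forall f, Cs s Omega f -> `|nu f - L f| <= e * Cs_norm s Omega f.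

End smooth_functions.

Section quadratic_form.
Context (R : realType) (d : nat).
Local Notation T := 'rV[R]_d.
Variables (eps : R) (Omega : set T) (P : probability T R).

(* uphalf d is the ceiling of d / 2 *)
Definition smoothness : nat := (uphalf d).+1.

Definition A_op (f : T -> R) : T -> R :=
  fun y => \int[P]_(x in Omega) (xi eps P x y * f x).

Definition i_xi (nu : (T -> R) -> R) : T -> R :=
  fun y => nu (fun x => xi eps P x y).

Definition inv_one_sub_A2 (h : T -> R) : T -> R :=
  xget (cst 0) [set f | [/\ Cs smoothness Omega f,
    \int[P]_(x in Omega) f x = 0 &
    forall x, Omega x -> f x - A_op (A_op f) x = h x]].

(* The value 0 outside of S x S is a dummy one. *)
Definition M_form (nu mu : (T -> R) -> R) : R :=
  if `[< S_space smoothness Omega nu /\ S_space smoothness Omega mu >] then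
    nu (inv_one_sub_A2 (i_xi mu))
  else 0.

End quadratic_form.

Section sampling.
Context (R : realType) (dW : measure_display) (W : measurableType dW).
Variable Pr : probability W R.

Definition mutually_independent dT (T : measurableType dT)
    (X : nat -> {RV Pr >-> T}) : Prop :=
  forall (J : {fset nat}) (A : nat -> set T), (forall i, measurable (A i)) ->
    Pr (\bigcap_(i in [set` J]) (X i @^-1` A i)) =
    (\prod_(i <- J) Pr (X i @^-1` A i))%E.

Definition iid dT (T : measurableType dT) (X : nat -> {RV Pr >-> T})
    (P : probability T R) : Prop :=
  mutually_independent X /\
  forall i (A : set T), measurable A -> distribution Pr (X i) A = P A.

(* For 0 < n this is A |-> (\sum_(i < n) \d_(X i w) A) / n; the point mass at 0
   is the dummy value for n = 0. *)
Definition empirical d (X : nat -> {RV Pr >-> 'rV[R]_d}) (n : nat) (w : W) :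
    probability 'rV[R]_d R :=
  mnormalize (msum (fun i => \d_(X i w)) n) (\d_(0 : 'rV[R]_d)).

(* w n = o_P(a n). The outer probability makes sense of the definition without
   a measurability hypothesis; on measurable sets it is Pr. *)
Definition o_in_prob (w : nat -> W -> R) (a : nat -> R) : Prop :=
  forall delta : R, 0 < delta ->
    (mu_ext Pr [set x | delta < `|w n x / a n|]) @[n --> \oo] --> 0%E.

End sampling.

(* Main.v *)
(* Idea.  The map sending one potential to the other contracts oscillations, so
   that the potentials exist, are unique up to a constant and depend Lipschitz
   continuously on the residuals of the Schroedinger system; as the dual
   functional is concave, a pair with residuals of order r is optimal up to
   O(r^2).  For (b) the population potentials are tested against the empirical
   measures: their residuals are the deviations of the kernel, and the value of
   the dual functional is linear in the measures.  For (a) one Newton step is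
   added to the potentials, which makes the residuals quadratic and the error
   cubic.

   No empirical process theory is needed to control the deviations uniformly:
   up to weights the kernel is exp(<x, y> / eps), the sum over j of
   eps^-j / j! times the sum of m_t(x) m_t(y) over the monomials m_t of degree j.
   Hence all errors are bounded by powers of the single random variable
   Z = sum_j theta^j sum_t |(P_n - P)(w m_t)|, and E Z = O(n^-1/2) by a
   variance computation.

   On C^s the form M makes sense because the extended potentials turn the kernel
   into a quotient of Laplace transforms in y, which is smooth. *)
From HB Require Import structures.
From mathcomp Require Import all_boot all_order all_algebra.
From mathcomp Require Import finmap.
From mathcomp Require Import all_classical all_reals all_analysis.
From mathcomp Require Import measurable_realfun.
From mathcomp Require Import ring lra.
Require Import Defs.

Set Implicit Arguments.
Unset Strict Implicit.
Unset Printing Implicit Defensive.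

Import Order.TTheory GRing.Theory Num.Theory.
Import numFieldNormedType.Exports.

Local Open Scope classical_set_scope.
Local Open Scope ring_scope.

(** A deviation [mu - P] is not small in total variation, so a sup norm bound on a function that
    itself depends on the sample gains nothing when a deviation is applied to it. This is the
    obstacle when the two laws coincide: the Newton corrections depend on both samples and have to
    be paired with the deviations up to errors of order [N ^ 3]. The way out is that, by the
    resolvent equation, the corrections are again integrals of the kernel, so that the monomial
    expansion separates their randomness from the variable. Products of two test functions then
    occur, whence a squared weight among the tests. The scale [theta] reconciles two demands. There
    are [d ^ j] words of degree [j], each of size at most [B ^ j], and [theta (d B) <= 1/2] makes
    their weighted sums geometric; the loss [theta ^ (- 2 j)] in a pairing is paid by the factorial
    of the exponential series. The expansions are deterministic in the pair [(mu, nu)], which only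
    has to be carried by [Omega]; probability enters through a single application of Markov's
    inequality. *)

(** * Integration of bounded measurable functions *)

(* Locked, like the other definitions below that only serve through their
   lemmas: unification would otherwise unfold integrals. *)
HB.lock Definition Ex {dT} {T : measurableType dT} {R : realType}
  (mu : probability T R) (f : T -> R) : R := \int[mu]_x f x.

Lemma ExE {dT} {T : measurableType dT} {R : realType}
  (mu : probability T R) (f : T -> R) : Ex mu f = \int[mu]_x f x.
Proof. by rewrite Ex.unlock. Qed.

(** Membership does not refer to a measure: the same function is integrated against the populations
    and against every empirical measure without further integrability conditions. *)
Record bmeas {dT} {T : measurableType dT} {R : realType} (f : T -> R) : Prop :=
  Bmeas { bmeas_meas : measurable_fun setT f ;
          bmeas_ex : exists B, forall x, `|f x| <= B }.

Section bounded_measurable.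
Context {dT} {T : measurableType dT} {R : realType}.
Implicit Types f g : T -> R.

Lemma bmeas_bound f : bmeas f -> exists2 B, 0 <= B & forall x, `|f x| <= B.
Proof.
by case=> _ [B hB]; exists `|B| => // x; rewrite (le_trans (hB x))// ler_norm.
Qed.

Lemma bmeas_cst (r : R) : bmeas (fun _ : T => r).
Proof. by split; [exact: measurable_cst|exists `|r|]. Qed.

Lemma bmeasD f g : bmeas f -> bmeas g -> bmeas (fun x => f x + g x).
Proof.
move=> [mf [B hB]] [mg [C hC]]; split; first exact: measurable_funD.
by exists (B + C) => x; rewrite (le_trans (ler_normD _ _))// lerD.
Qed.

Lemma bmeasM f g : bmeas f -> bmeas g -> bmeas (fun x => f x * g x).
Proof.
move=> [mf [B hB]] [mg [C hC]]; split; first exact: measurable_funM.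
by exists (B * C) => x; rewrite normrM ler_pM.
Qed.

Lemma bmeasN f : bmeas f -> bmeas (fun x => - f x).
Proof.
move=> [mf [B hB]]; split; first exact: measurable_funN.
by exists B => x; rewrite normrN.
Qed.

Lemma bmeasB f g : bmeas f -> bmeas g -> bmeas (fun x => f x - g x).
Proof. by move=> bf bg; apply: bmeasD => //; exact: bmeasN. Qed.

Lemma bmeas_norm f : bmeas f -> bmeas (fun x => `|f x|).
Proof.
move=> [mf [B hB]]; split; first exact: measurableT_comp.
by exists B => x; rewrite normr_id.
Qed.

Lemma bmeasX f n : bmeas f -> bmeas (fun x => f x ^+ n).
Proof.
move=> [mf [B hB]]; split; first exact: measurable_funX.
by exists (B ^+ n) => x; rewrite normrX lerXn2r ?nnegrE// (le_trans _ (hB x)).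
Qed.

Lemma bmeas_exp f : bmeas f -> bmeas (fun x => expR (f x)).
Proof.
move=> [mf [B hB]]; split; first exact: measurableT_comp.
exists (expR B) => x; rewrite ger0_norm ?expR_ge0// ler_expR.
by rewrite (le_trans _ (hB x))// ler_norm.
Qed.

Lemma bmeas_ln f e : 0 < e -> (forall x, e <= f x) -> bmeas f ->
  bmeas (fun x => ln (f x)).
Proof.
move=> e0 ef [mf [B hB]]; split.
  by apply: measurableT_comp => //; exact: measurable_ln.
exists (`|ln e| + `|ln B|) => x.
have fx0 : 0 < f x := lt_le_trans e0 (ef x).
have fB : f x <= B by rewrite (le_trans _ (hB x))// ler_norm.
have l1 : ln e <= ln (f x) by rewrite ler_ln ?posrE.
have l2 : ln (f x) <= ln B by rewrite ler_ln ?posrE// (lt_le_trans fx0).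
rewrite ler_norml; apply/andP; split.
  rewrite lerNl; apply: (le_trans (_ : _ <= - ln e)); first by rewrite lerN2.
  by rewrite -normrN (le_trans (ler_norm _))// lerDl.
by rewrite (le_trans l2)// (le_trans (ler_norm _))// lerDr.
Qed.

Lemma bmeas_sum (I : Type) (s : seq I) (P : pred I) (F : I -> T -> R) :
  (forall i, P i -> bmeas (F i)) -> bmeas (fun x => \sum_(i <- s | P i) F i x).
Proof.
move=> bF; elim: s => [|i s IH].
  rewrite (_ : (fun x => _) = (fun=> 0)); first exact: bmeas_cst.
  by apply/funext => x; rewrite big_nil.
case/boolP : (P i) => Pi; last first.
  by under eq_fun do rewrite big_cons (negbTE Pi).
under eq_fun do rewrite big_cons Pi.
by apply: bmeasD => //; exact: bF.
Qed.

Lemma bmeas_prod (I : Type) (s : seq I) (P : pred I) (F : I -> T -> R) :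
  (forall i, P i -> bmeas (F i)) -> bmeas (fun x => \prod_(i <- s | P i) F i x).
Proof.
move=> bF; elim: s => [|i s IH].
  rewrite (_ : (fun x => _) = (fun=> 1)); first exact: bmeas_cst.
  by apply/funext => x; rewrite big_nil.
case/boolP : (P i) => Pi; last first.
  by under eq_fun do rewrite big_cons (negbTE Pi).
under eq_fun do rewrite big_cons Pi.
by apply: bmeasM => //; exact: bF.
Qed.

Lemma bmeas_cvg (h : nat -> T -> R) f (B : R) : (forall n, measurable_fun setT (h n)) ->
  (forall n x, `|h n x| <= B) -> (forall x, h ^~ x @ \oo --> f x) -> bmeas f.
Proof.
move=> mh hB hf; split.
  by apply: (measurable_fun_cvg mh) => x _; exact: hf.
exists B => x; have c : `|h n x| @[n --> \oo] --> `|f x| by apply: cvg_norm; exact: hf.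
by rewrite -(cvg_lim _ c)//; apply: limr_le; [exact: (cvgP _ c)|near=> n; exact: hB].
Unshelve. all: by end_near. Qed.

End bounded_measurable.

Lemma bmeas_comp {d1 d2} {T1 : measurableType d1} {T2 : measurableType d2}
    {R : realType} (f : T2 -> R) (g : T1 -> T2) :
  measurable_fun setT g -> bmeas f -> bmeas (fun x => f (g x)).
Proof.
by move=> mg [mf [B hB]]; split; [exact: measurableT_comp|exists B].
Qed.

Section kernels.
Context {d1 d2} {T1 : measurableType d1} {T2 : measurableType d2} {R : realType}.
Implicit Type K : T1 -> T2 -> R.

Definition bmeas2 K := bmeas (fun z : T1 * T2 => K z.1 z.2).

Lemma bmeas_fst (f : T1 -> R) : bmeas f -> bmeas (fun z : T1 * T2 => f z.1).
Proof. by apply: bmeas_comp; exact: measurable_fst. Qed.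

Lemma bmeas_snd (f : T2 -> R) : bmeas f -> bmeas (fun z : T1 * T2 => f z.2).
Proof. by apply: bmeas_comp; exact: measurable_snd. Qed.

Lemma bmeas_section1 K x : bmeas2 K -> bmeas (K x).
Proof.
apply: (@bmeas_comp _ _ _ _ _ (fun z => K z.1 z.2) (fun y => (x, y))).
exact: measurable_fun_pair.
Qed.

Lemma bmeas_section2 K y : bmeas2 K -> bmeas (K ^~ y).
Proof.
apply: (@bmeas_comp _ _ _ _ _ (fun z => K z.1 z.2) (fun x => (x, y))).
exact: measurable_fun_pair.
Qed.

Lemma bmeas2_bound K : bmeas2 K -> exists2 B, 0 <= B & forall x y, `|K x y| <= B.
Proof. by move=> /bmeas_bound[B B0 h]; exists B => // x y; exact: (h (x, y)). Qed.

End kernels.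

Lemma bmeas2_swap {d1 d2} {T1 : measurableType d1} {T2 : measurableType d2}
  {R : realType} (K : T1 -> T2 -> R) : bmeas2 K -> bmeas2 (fun y x => K x y).
Proof.
move=> bK.
apply: (@bmeas_comp _ _ _ _ _ _ (fun z : T2 * T1 => (z.2, z.1)) _ bK).
by apply: measurable_fun_pair; [exact: measurable_snd|exact: measurable_fst].
Qed.

Section expectation.
Context {dT} {T : measurableType dT} {R : realType}.
Implicit Types (mu : probability T R) (f g : T -> R).

Lemma bmeas_integrable mu f : bmeas f -> mu.-integrable setT (EFin \o f).
Proof.
move=> bf; apply: measurable_bounded_integrable => //.
- by rewrite (le_lt_trans (probability_le1 _ _))// ltry.
- exact: bmeas_meas.
- have [B B0 hB] := bmeas_bound bf; exists B; split; first exact: num_real.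
  by move=> M BM x _ /=; rewrite (le_trans (hB x))// ltW.
Qed.

Lemma Ex_cst mu r : Ex mu (fun=> r) = r.
Proof.
rewrite !ExE Rintegral_cst// -[RHS]mulr1; congr (_ * _).
exact: (congr1 fine (probability_setT mu)).
Qed.

Lemma ExD mu f g : bmeas f -> bmeas g ->
  Ex mu (fun x => f x + g x) = Ex mu f + Ex mu g.
Proof. by move=> bf bg; rewrite !ExE RintegralD//; exact: bmeas_integrable. Qed.

Lemma ExB mu f g : bmeas f -> bmeas g ->
  Ex mu (fun x => f x - g x) = Ex mu f - Ex mu g.
Proof. by move=> bf bg; rewrite !ExE RintegralB//; exact: bmeas_integrable. Qed.

Lemma ExZl mu r f : bmeas f -> Ex mu (fun x => r * f x) = r * Ex mu f.
Proof. by move=> bf; rewrite !ExE RintegralZl//; exact: bmeas_integrable. Qed.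

Lemma ExZr mu r f : bmeas f -> Ex mu (fun x => f x * r) = Ex mu f * r.
Proof. by move=> bf; rewrite !ExE RintegralZr//; exact: bmeas_integrable. Qed.

Lemma ExN mu f : bmeas f -> Ex mu (fun x => - f x) = - Ex mu f.
Proof.
move=> bf; rewrite -mulN1r -ExZl//; congr Ex.
by apply/funext => x; rewrite mulN1r.
Qed.

Lemma eq_Ex mu f g : f =1 g -> Ex mu f = Ex mu g.
Proof. by move=> fg; congr Ex; apply/funext. Qed.

Lemma le_Ex mu f g : bmeas f -> bmeas g -> (forall x, f x <= g x) ->
  Ex mu f <= Ex mu g.
Proof. by move=> bf bg fg; rewrite !ExE; apply: le_Rintegral => //; exact: bmeas_integrable. Qed.

Lemma Ex_ge mu f r : bmeas f -> (forall x, r <= f x) -> r <= Ex mu f.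
Proof. by move=> bf rf; rewrite -(Ex_cst mu r) le_Ex//; exact: bmeas_cst. Qed.

Lemma Ex_le mu f r : bmeas f -> (forall x, f x <= r) -> Ex mu f <= r.
Proof. by move=> bf rf; rewrite -(Ex_cst mu r) le_Ex//; exact: bmeas_cst. Qed.

Lemma Ex_norm_le mu f r : bmeas f -> (forall x, `|f x| <= r) -> `|Ex mu f| <= r.
Proof.
move=> bf rf; rewrite ler_norml; apply/andP; split.
  by apply: Ex_ge => // x; have := rf x; rewrite ler_norml => /andP[].
by apply: Ex_le => // x; have := rf x; rewrite ler_norml => /andP[].
Qed.

Lemma Ex_sum mu (I : Type) (s : seq I) (F : I -> T -> R) :
  (forall i, bmeas (F i)) ->
  Ex mu (fun x => \sum_(i <- s) F i x) = \sum_(i <- s) Ex mu (F i).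
Proof.
move=> bF; elim: s => [|i s IH].
  by rewrite big_nil -[RHS](Ex_cst mu 0); apply: eq_Ex => x; rewrite big_nil.
rewrite big_cons -IH -ExD//; last exact: bmeas_sum.
by apply: eq_Ex => x; rewrite big_cons.
Qed.

Lemma EFin_Ex mu f : bmeas f -> (Ex mu f)%:E = (\int[mu]_x (f x)%:E)%E.
Proof.
by move=> bf; rewrite ExE fineK//; apply: integrable_fin_num => //; exact: bmeas_integrable.
Qed.

End expectation.

Section fubini.
Context {d1 d2} {T1 : measurableType d1} {T2 : measurableType d2} {R : realType}.
Implicit Types (mu : probability T1 R) (nu : probability T2 R) (K : T1 -> T2 -> R).

Lemma bmeas_Ex1 nu K : bmeas2 K -> bmeas (fun x => Ex nu (K x)).
Proof.
move=> bK; have [B B0 hB] := bmeas2_bound bK; split; last first.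
  by exists B => x; apply: Ex_norm_le => //; exact: bmeas_section1.
rewrite (_ : (fun x => _) = (fun x => fine (\int[nu]_y (K x y)%:E)%E)); last first.
  by apply/funext => x; rewrite ExE.
apply: (measurableT_comp (f := fine)) => //.
(* Measurability of the partial integral is extracted from Fubini's theorem, which wants a measure
   on [T1] as well. A Dirac mass serves, and the empty space is treated apart. *)
have [x0|noT] := pselect (exists x : T1, True); last first.
  move=> _ Y mY; rewrite [X in measurable X](_ : _ = set0)//.
  by rewrite -subset0 => x; exfalso; apply: noT; exists x.
case: x0 => x0 _.
apply: (@measurable_fubini_F _ _ _ _ _ \d_x0 nu (fun z => (K z.1 z.2)%:E)).
exact: (bmeas_integrable (\d_x0 \x nu)%E bK).
Qed.

Lemma Ex_prod1 mu nu K : bmeas2 K ->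
  Ex (mu \x nu)%E (fun z => K z.1 z.2) = Ex mu (fun x => Ex nu (K x)).
Proof.
move=> bK; rewrite ExE [RHS]ExE; congr fine.
rewrite -(@integral12_prod_meas1 _ _ _ _ _ mu nu (fun z => (K z.1 z.2)%:E)); last first.
  exact: (bmeas_integrable (mu \x nu)%E bK).
by apply: eq_integral => x _; rewrite EFin_Ex//; exact: bmeas_section1.
Qed.

Lemma Ex_fubini mu nu K : bmeas2 K ->
  Ex mu (fun x => Ex nu (K x)) = Ex nu (fun y => Ex mu (K ^~ y)).
Proof.
move=> bK; rewrite -Ex_prod1// ExE [RHS]ExE; congr fine.
rewrite -(@integral21_prod_meas1 _ _ _ _ _ mu nu (fun z => (K z.1 z.2)%:E)); last first.
  exact: (bmeas_integrable (mu \x nu)%E bK).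
by apply: eq_integral => y _; rewrite EFin_Ex//; exact: bmeas_section2.
Qed.

End fubini.

Lemma bmeas_Ex2 {d1 d2} {T1 : measurableType d1} {T2 : measurableType d2}
    {R : realType} (mu : probability T1 R) (K : T1 -> T2 -> R) :
  bmeas2 K -> bmeas (fun y => Ex mu (K ^~ y)).
Proof. by move=> /bmeas2_swap; exact: (bmeas_Ex1 mu). Qed.

Lemma Ex_pushforward {d1 d2} {T1 : measurableType d1} {T2 : measurableType d2} {R : realType}
    (mu : probability T1 R) (nu : probability T2 R) (k : T1 -> T2) (h : T2 -> R) :
  measurable_fun setT k -> (forall A, measurable A -> mu (k @^-1` A) = nu A) -> bmeas h ->
  Ex mu (fun x => h (k x)) = Ex nu h.
Proof.
move=> mk kE bh; rewrite !ExE; congr fine.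
have mh : measurable_fun setT (EFin \o h) by apply/measurable_EFinP; exact: bmeas_meas.
have ih : mu.-integrable (k @^-1` setT) ((EFin \o h) \o k).
  by apply: (bmeas_integrable mu); exact: bmeas_comp mk bh.
have := integral_pushforward mk mh ih measurableT.
by rewrite preimage_setT => <-; apply: eq_measure_integral => A mA _; exact: kE.
Qed.

(** * Oscillation and contractions *)

Ltac bm := repeat first
  [ assumption
  | match goal with H : forall _, bmeas _ |- _ => solve [apply: H] end
  | match goal with H : forall _, bmeas2 _ |- _ => solve [apply: H] end
  | solve [apply: bmeas_cst]
  | apply: bmeas_exp | apply: bmeasB | apply: bmeasD | apply: bmeasM
  | apply: bmeasN | apply: bmeasX | apply: bmeas_norm
  | solve [apply: bmeas_fst; bm] | solve [apply: bmeas_snd; bm]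
  | solve [apply: bmeas_section1; assumption]
  | solve [apply: bmeas_section2; assumption] ].

(** A seminorm that vanishes exactly on the constants, the ambiguity of the potentials. *)
HB.lock Definition osc {T : Type} {R : realType} (f : T -> R) : R :=
  sup [set f z.1 - f z.2 | z in [set: T * T]].

Section oscillation.
Context {dT} {T : measurableType dT} {R : realType} (x0 : T).
Implicit Types f g : T -> R.

Lemma osc_ge f x y : bmeas f -> f x - f y <= osc f.
Proof.
move=> /bmeas_bound[B B0 hB]; rewrite osc.unlock; apply: ub_le_sup; last by exists (x, y).
exists (B + B) => _ [[a b] _ <-] /=.
by rewrite (le_trans (ler_norm _))// (le_trans (ler_normB _ _))// lerD.
Qed.

Lemma osc_le f D : (forall x y, f x - f y <= D) -> osc f <= D.
Proof.
move=> fD; rewrite osc.unlock; apply: ge_sup; first by exists (f x0 - f x0), (x0, x0).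
by move=> _ [[a b] _ <-]; exact: fD.
Qed.

Lemma osc_ge0 f : bmeas f -> 0 <= osc f.
Proof. by move=> bf; rewrite -(subrr (f x0)) osc_ge. Qed.

Lemma osc_range f : bmeas f -> exists m, forall x, m <= f x <= m + osc f.
Proof.
move=> bf; have [B B0 hB] := bmeas_bound bf.
have hi : has_inf [set f x | x in setT].
  split; first by exists (f x0), x0.
  by exists (- B) => _ [x _ <-]; have := hB x; rewrite ler_norml => /andP[].
exists (inf [set f x | x in setT]) => x; apply/andP; split.
  by apply: ge_inf; [exact: hi.2|exists x].
rewrite -lerBlDr; apply: lb_le_inf; first exact: hi.1.
by move=> _ [y _ <-]; rewrite lerBlDl -lerBlDr osc_ge.
Qed.

Lemma osc_norm f B : (forall x, `|f x| <= B) -> osc f <= B + B.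
Proof.
move=> fB; apply: osc_le => x y.
by rewrite (le_trans (ler_norm _))// (le_trans (ler_normB _ _))// lerD.
Qed.

End oscillation.

Lemma le0_geometric {R : realType} (y K q : R) : 0 <= q < 1 ->
  (forall n, y <= K * q ^+ n) -> y <= 0.
Proof.
move=> /andP[q0 q1] h.
have c : K * q ^+ n @[n --> \oo] --> K * 0.
  by apply: cvgMr; apply: cvg_expr; rewrite ger0_norm.
rewrite -(mulr0 K) -(cvg_lim _ c)//.
by apply: limr_ge; [exact: (cvgP _ c)|exact: nearW].
Qed.

Section contraction.
Context {dT} {T : measurableType dT} {R : realType} (x0 : T).
Variables (Psi : (T -> R) -> T -> R) (q : R).
Hypothesis q01 : 0 <= q < 1.
Hypothesis bPsi : forall f, bmeas f -> bmeas (Psi f).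
Hypothesis cPsi : forall f g, bmeas f -> bmeas g ->
  osc (fun x => Psi f x - Psi g x) <= q * osc (fun x => f x - g x).

(** Picard iteration, recentred at [x0] in each step: the hypothesis controls functions up to
    constants only, and for functions vanishing at [x0] the oscillation dominates the sup norm. *)
Let F n := iter n (fun f x => Psi f x - Psi f x0) (fun=> 0).

Let bF n : bmeas (F n).
Proof. by elim: n => [|n IH]; rewrite /F /=; bm; exact: bPsi. Qed.

Let F0 n : F n x0 = 0.
Proof. by case: n => //= n; rewrite /F /= subrr. Qed.

Let C := osc (F 1).

Let oscF n : osc (fun x => F n.+1 x - F n x) <= C * q ^+ n.
Proof.
elim: n => [|n IH].
  rewrite expr0 mulr1 /C (_ : (fun x => _) = F 1)//.
  by apply/funext => x; rewrite /F /= subr0.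
rewrite exprS mulrCA; apply: le_trans (ler_wpM2l _ IH); last by case/andP: q01.
apply: le_trans (cPsi (bF n.+1) (bF n)).
apply: (osc_le x0) => x y.
have b : bmeas (fun x => Psi (F n.+1) x - Psi (F n) x) by bm; exact: bPsi.
by apply: le_trans (osc_ge x y b); rewrite /F /=; lra.
Qed.

Let FS n x : `|F n.+1 x - F n x| <= C * q ^+ n.
Proof.
have b : bmeas (fun x => F n.+1 x - F n x) by bm.
have h1 := le_trans (osc_ge x x0 b) (oscF n).
have h2 := le_trans (osc_ge x0 x b) (oscF n).
by move: h1 h2; rewrite !F0 subrr subr0 sub0r => h1 h2; rewrite ler_norml; lra.
Qed.

Let FE n x : F n x = series (fun k => F k.+1 x - F k x) n.
Proof. by rewrite /series /= telescope_sumr// /F /= subr0. Qed.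

Let C0 : 0 <= C. Proof. exact: osc_ge0. Qed.

Let q1 : 0 < 1 - q. Proof. by case/andP: q01; lra. Qed.

Let Fdist n k x : `|F (n + k) x - F n x| <= C / (1 - q) * q ^+ n.
Proof.
have -> : C / (1 - q) * q ^+ n = C * q ^+ n * (1 - q)^-1 by ring.
suff h : `|F (n + k) x - F n x| <= C * q ^+ n * ((1 - q ^+ k) / (1 - q)).
  apply: (le_trans h); apply: ler_wpM2l.
    by rewrite mulr_ge0// exprn_ge0//; case/andP: q01.
  apply: ler_piMl; first by rewrite invr_ge0 ltW.
  by rewrite gerBl exprn_ge0//; case/andP: q01.
elim: k => [|k IH]; first by rewrite addn0 subrr normr0 expr0 subrr mul0r mulr0.
rewrite addnS -[X in `|X|](subrKA (F (n + k) x)).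
apply: (le_trans (ler_normD _ _)).
apply: (le_trans (lerD (FS _ _) IH)); rewrite exprD exprS.
rewrite le_eqVlt; apply/orP; left; apply/eqP; field; exact: lt0r_neq0.
Qed.

Let Fcvg x : cvgn (fun n => F n x).
Proof.
rewrite (_ : (fun n => F n x) = series (fun k => F k.+1 x - F k x)); last first.
  by apply/funext => n; rewrite FE.
apply: normed_cvg.
apply: (@series_le_cvg _ (fun k => `|F k.+1 x - F k x|) (geometric C q)).
- by move=> n; exact: normr_ge0.
- by move=> n; rewrite /geometric /= mulr_ge0// exprn_ge0//; case/andP: q01.
- by move=> n; rewrite /geometric /=; exact: FS.
- by apply: is_cvg_geometric_series; case/andP: q01 => ? ?; rewrite ger0_norm.
Qed.

Let G x := limn (fun n => F n x).

Let Gdist n x : `|G x - F n x| <= C / (1 - q) * q ^+ n.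
Proof.
have c : `|F k x - F n x| @[k --> \oo] --> `|G x - F n x|.
  by apply: cvg_norm; apply: cvgB; [exact: Fcvg|exact: cvg_cst].
rewrite -(cvg_lim _ c)//; apply: limr_le; first exact: (cvgP _ c).
by exists n => // k /= nk; rewrite -(subnKC nk).
Qed.

Let bG : bmeas G.
Proof.
apply: (@bmeas_cvg _ _ _ F G (C / (1 - q))).
- by move=> n; exact: bmeas_meas.
- by move=> n x; have := Fdist 0 n x; rewrite add0n /F /= subr0 expr0 mulr1.
- by move=> x; exact: Fcvg.
Qed.

(** The contraction lives on functions modulo constants, so the limit is fixed up to the constant
    [Psi f x0]. Each application removes that constant by an argument of its own, on total masses or
    on means. *)
Lemma osc_contraction_fixpoint :
  exists2 f, bmeas f & forall x, Psi f x = f x + Psi f x0.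
Proof.
exists G => // x; apply/eqP; rewrite -subr_eq eq_sym -subr_eq0 -normr_le0.
set K := C / (1 - q).
apply: (@le0_geometric _ _ (K * q + (K + K)) q q01) => n.
rewrite -(subrKA (F n.+1 x)) (le_trans (ler_normD _ _))// mulrDl lerD//.
  by rewrite -mulrA -exprS.
rewrite distrC.
have b : bmeas (fun x => Psi G x - Psi (F n) x) by bm; exact: bPsi.
have h : osc (fun x => Psi G x - Psi (F n) x) <= (K + K) * q ^+ n.
  apply: (le_trans (cPsi bG (bF n))); rewrite mulrDl.
  have o := osc_norm x0 (Gdist n).
  have o0 : 0 <= osc (fun x => G x - F n x) by apply: (osc_ge0 x0); bm; exact: bF.
  apply: le_trans o; rewrite ler_piMl//; first by case/andP: q01 => _ /ltW.
have := le_trans (osc_ge x x0 b) h; have := le_trans (osc_ge x0 x b) h.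
by rewrite /F /= ler_norml => h1 h2; apply/andP; split; lra.
Qed.

End contraction.

(** * Entropic potentials *)

(* [z / w] is at most [z / (k z + 1 - k)], and [k e^u + 1 - k >= e^(k u)] by
   convexity, so the ratio gains a factor [1 - k] on the logarithmic scale. *)
Lemma ln_ratio_contraction {R : realType} (k D A1 A2 B1 B2 s : R) :
  0 < k <= 1 -> 0 < s -> 0 < A2 -> 0 < B2 -> A2 <= A1 -> A1 <= expR D * A2 ->
  s * (A1 - A2) <= B1 - B2 -> k * B2 <= s * A2 ->
  ln A1 - ln A2 - (ln B1 - ln B2) <= (1 - k) * D.
Proof.
move=> /andP[k0 k1] s0 A20 B20 A21 A1D sAB kBA.
have A10 : 0 < A1 := lt_le_trans A20 A21.
have B10 : 0 < B1.
  by rewrite (lt_le_trans B20)// -subr_ge0 (le_trans _ sAB)// mulr_ge0 ?subr_ge0// ltW.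
have -> : ln A1 - ln A2 - (ln B1 - ln B2) = ln (A1 / A2) - ln (B1 / B2).
  by rewrite !ln_div ?posrE.
set z := A1 / A2; set w := B1 / B2.
have z1 : 1 <= z by rewrite /z ler_pdivlMr// mul1r.
have z0 : 0 < z by rewrite (lt_le_trans _ z1).
have wz : k * z + (1 - k) <= w.
  rewrite /w ler_pdivlMr//.
  have : k * B2 * (z - 1) <= s * A2 * (z - 1) by rewrite ler_wpM2r// subr_ge0.
  have -> : s * A2 * (z - 1) = s * (A1 - A2) by rewrite /z; field; exact: lt0r_neq0.
  by move=> h; move: sAB h; lra.
have w0 : 0 < w by rewrite /w divr_gt0.
set u := ln z.
have zE : z = expR u by rewrite /u lnK ?posrE.
have uD : u <= D by rewrite -ler_expR -zE /z ler_pdivrMr.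
have kw : expR (k * u) <= w.
  apply: le_trans wz; rewrite zE.
  have -> : expR u = expR (k * u) * expR ((1 - k) * u).
    by rewrite -expRD; congr expR; ring.
  have h1 := expR_ge1Dx ((1 - k) * u).
  have h2 : expR (k * u) * (1 - k * u) <= 1.
    by rewrite -[X in _ <= X](expRxMexpNx_1 (k * u)) ler_wpM2l ?expR_ge0// expR_ge1Dx.
  have e0 : 0 < expR (k * u) := expR_gt0 _.
  have h3 : expR (k * u) * (1 + (1 - k) * u) <= expR (k * u) * expR ((1 - k) * u).
    by rewrite ler_wpM2l// ltW.
  have h4 := ler_wpM2l (ltW k0) h3.
  have h5 : (1 - k) * (expR (k * u) * (1 - k * u)) <= 1 - k.
    by rewrite ler_piMr// subr_ge0.
  apply: le_trans (lerD h4 h5); rewrite le_eqVlt; apply/orP; left; apply/eqP.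
  ring.
have : k * u <= ln w by rewrite -ler_expR lnK ?posrE.
have : (1 - k) * u <= (1 - k) * D by rewrite ler_wpM2l ?subr_ge0.
lra.
Qed.

HB.lock Definition gibbs_mass {dT} {T : measurableType dT} {R : realType}
  (eps : R) (c : T -> T -> R) (nu : probability T R) (g : T -> R) (x : T) : R :=
  Ex nu (fun y => expR ((g y - c x y) / eps)).

(** The soft c-transform; one application is half a step of Sinkhorn's algorithm. *)
HB.lock Definition sink {dT} {T : measurableType dT} {R : realType}
  (eps : R) (c : T -> T -> R) (nu : probability T R) (g : T -> R) (x : T) : R :=
  - eps * ln (gibbs_mass eps c nu g x).

(** For a cost in [[0, L]], exchanging the points in the kernel costs a factor [exp(- L / eps)]. The
    contraction of [sink] needs two exchanges, whence the 2. *)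
HB.lock Definition doeblin {R : realType} (eps L : R) : R :=
  expR (- (2 * L / eps)).

Section sinkhorn.
Context {dT} {T : measurableType dT} {R : realType} (x0 : T).
Variables (eps L : R) (c : T -> T -> R).
Hypotheses (eps0 : 0 < eps) (bc : bmeas2 c) (cC : forall x y, c x y = c y x).
Hypothesis cL : forall x y, 0 <= c x y <= L.
Implicit Types (mu nu : probability T R) (f g h : T -> R).

Local Notation partition := (gibbs_mass eps c).
Local Notation sink := (sink eps c).
Local Notation doeblin := (doeblin eps L).

Lemma partitionE nu g x :
  partition nu g x = Ex nu (fun y => expR ((g y - c x y) / eps)).
Proof. by rewrite gibbs_mass.unlock. Qed.

Lemma sinkE nu g x : sink nu g x = - eps * ln (partition nu g x).
Proof. by rewrite sink.unlock. Qed.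

Lemma partition_ge nu g : bmeas g ->
  exists2 e, 0 < e & forall x, e <= partition nu g x.
Proof.
move=> bg; have [B B0 hB] := bmeas_bound bg.
exists (expR ((- B - L) / eps)); first exact: expR_gt0.
move=> x; rewrite partitionE; apply: Ex_ge; first by bm.
move=> y; rewrite ler_expR ler_pM2r ?invr_gt0//.
have := hB y; rewrite ler_norml => /andP[h _].
by have /andP[_ h2] := cL x y; lra.
Qed.

Lemma partition_gt0 nu g x : bmeas g -> 0 < partition nu g x.
Proof. by move=> /(partition_ge nu)[e e0 h]; exact: lt_le_trans e0 (h x). Qed.

Lemma bmeas_partition nu g : bmeas g -> bmeas (partition nu g).
Proof.
move=> bg; rewrite (_ : partition nu g = (fun x => Ex nu (fun y => expR ((g y - c x y) / eps)))); last first.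
  by apply/funext => x; rewrite partitionE.
apply: (bmeas_Ex1 nu (K := fun x y => expR ((g y - c x y) / eps))).
by rewrite /bmeas2; bm.
Qed.

Lemma bmeas_sink nu g : bmeas g -> bmeas (sink nu g).
Proof.
move=> bg; have [e e0 he] := partition_ge nu bg.
rewrite (_ : sink nu g = (fun x => - eps * ln (partition nu g x))); last first.
  by apply/funext => x; rewrite sinkE.
apply: bmeasM; first exact: bmeas_cst.
by apply: (bmeas_ln e0) => //; exact: bmeas_partition.
Qed.

Lemma sink_marginal nu g x : bmeas g ->
  Ex nu (fun y => expR ((sink nu g x + g y - c x y) / eps)) = 1.
Proof.
move=> bg; have p0 := partition_gt0 nu x bg.
rewrite (@eq_Ex _ _ _ _ _
  (fun y => (partition nu g x)^-1 * expR ((g y - c x y) / eps))); last first.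
  move=> y; rewrite -addrA mulrDl expRD; congr (_ * _).
  have -> : sink nu g x / eps = - ln (partition nu g x).
    by rewrite sinkE; field; exact: lt0r_neq0.
  by rewrite expRN lnK.
rewrite ExZl; last by bm.
by rewrite -partitionE mulVf// lt0r_neq0.
Qed.

Lemma sinkD nu g (r : R) x : bmeas g -> sink nu (fun y => g y + r) x = sink nu g x - r.
Proof.
move=> bg; have p0 := partition_gt0 nu x bg.
rewrite !sinkE (_ : partition _ _ x = expR (r / eps) * partition nu g x).
  rewrite lnM ?posrE ?expR_gt0// expRK mulrDr; field; exact: lt0r_neq0.
rewrite !partitionE -ExZl; last by bm.
by apply: eq_Ex => y; rewrite -expRD; congr expR; field; exact: lt0r_neq0.
Qed.

Lemma le_sink nu g h x : bmeas g -> bmeas h -> (forall y, g y <= h y) ->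
  sink nu h x <= sink nu g x.
Proof.
move=> bg bh gh; rewrite !sinkE [X in X <= _]mulNr mulNr lerN2 ler_pM2l; last by [].
rewrite ler_ln ?posrE; [|exact: partition_gt0..].
rewrite !partitionE; apply: le_Ex; [by bm|by bm|] => y.
by rewrite ler_expR ler_pM2r ?invr_gt0// lerB.
Qed.

Lemma sink_lip nu g h (r : R) x : bmeas g -> bmeas h -> (forall y, `|g y - h y| <= r) ->
  `|sink nu g x - sink nu h x| <= r.
Proof.
move=> bg bh gh.
have h1 : sink nu h x - r <= sink nu g x.
  rewrite -sinkD //; apply: le_sink; [by []|by bm|] => y.
  by have := gh y; rewrite ler_norml => /andP[_]; lra.
have h2 : sink nu g x - r <= sink nu h x.
  rewrite -sinkD //; apply: le_sink; [by []|by bm|] => y.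
  by have := gh y; rewrite ler_norml => /andP[+ _]; lra.
rewrite ler_norml; move: h1 h2; generalize (sink nu g x) (sink nu h x).
by intros; apply/andP; split; lra.
Qed.

Lemma doeblinE : doeblin = expR (- (2 * L / eps)).
Proof. by rewrite doeblin.unlock. Qed.

Lemma doeblin_gt0 : 0 < doeblin. Proof. by rewrite doeblinE expR_gt0. Qed.

Lemma L_ge0 : 0 <= L. Proof. by have /andP[] := cL x0 x0; exact: le_trans. Qed.

Lemma doeblin_le1 : doeblin <= 1.
Proof. by rewrite doeblinE -expR0 ler_expR oppr_le0 !mulr_ge0 ?L_ge0// invr_ge0 ltW. Qed.

(** Shift [g] so that [h <= g - m <= h + D], with [D] the oscillation of [g - h]. The masses at two
    points then satisfy the hypotheses of [ln_ratio_contraction], since moving the point in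
    [exp(- c / eps)] costs at most the factor [exp(- L / eps)]. The shift by [m] drops out of the
    difference of the logarithmic ratios. *)
Lemma sink_osc nu g h : bmeas g -> bmeas h ->
  osc (fun x => sink nu g x - sink nu h x) <= (1 - doeblin) * osc (fun x => g x - h x).
Proof.
move=> bg bh; apply: (osc_le x0) => x' x.
have bgh : bmeas (fun x => g x - h x) by bm.
set D := osc _; have [m hm] := osc_range x0 bgh.
have p0 k z : bmeas k -> 0 < partition nu k z by exact: partition_gt0.
have pm z : partition nu (fun y => g y - m) z = expR (- m / eps) * partition nu g z.
  rewrite !partitionE -ExZl; last by bm.
  by apply: eq_Ex => y; rewrite -expRD; congr expR; field; exact: lt0r_neq0.
have bgm : bmeas (fun y => g y - m) by bm.
have gh y : h y <= g y - m by have /andP[+ _] := hm y; lra.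
have gD y : g y - m <= h y + D by have /andP[_] := hm y; rewrite -/D; lra.
have key := @ln_ratio_contraction R doeblin (D / eps)
  (partition nu (fun y => g y - m) x) (partition nu h x)
  (partition nu (fun y => g y - m) x') (partition nu h x') (expR (- (L / eps))).
have {}key : ln (partition nu (fun y => g y - m) x) - ln (partition nu h x) -
  (ln (partition nu (fun y => g y - m) x') - ln (partition nu h x')) <=
  (1 - doeblin) * (D / eps).
  have ec z y : expR (- (L / eps)) * expR (- c z y / eps) <= expR (- c x' y / eps).
    rewrite -expRD ler_expR -mulNr -mulrDl ler_pM2r ?invr_gt0//.
    by rewrite -opprD lerN2 (le_trans (andP (cL x' y)).2)// lerDl; case/andP: (cL z y).
  apply: key; rewrite ?doeblin_gt0 ?doeblin_le1 ?expR_gt0 ?p0//.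
  - rewrite !partitionE; apply: le_Ex; [by bm|by bm|] => y.
    by rewrite ler_expR ler_pM2r ?invr_gt0// lerB.
  - rewrite !partitionE -ExZl; last by bm.
    apply: le_Ex; [by bm|by bm|] => y.
    by rewrite -expRD ler_expR -mulrDl ler_pM2r ?invr_gt0//; have := gD y; lra.
  - rewrite !partitionE -!ExB; [|by bm..]; rewrite -ExZl; last by bm.
    apply: le_Ex; [by bm|by bm|] => y.
    have E z k : expR ((k y - c z y) / eps) = expR (k y / eps) * expR (- c z y / eps).
      by rewrite -expRD mulrDl.
    rewrite !(E _ (fun y => g y - m)) !(E _ h) -!mulrBl mulrCA ler_wpM2l//.
    by rewrite subr_ge0 ler_expR ler_pM2r ?invr_gt0.
  - rewrite !partitionE doeblinE -!ExZl; [|by bm..].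
    apply: le_Ex; [by bm|by bm|] => y; rewrite -!expRD ler_expR.
    have -> : - (L / eps) + (h y - c x y) / eps = (- L + h y - c x y) / eps by ring.
    have -> : - (2 * L / eps) + (h y - c x' y) / eps = (- (2 * L) + h y - c x' y) / eps by ring.
    rewrite ler_pM2r ?invr_gt0//.
    have /andP[? ?] := cL x' y; have /andP[? ?] := cL x y; lra.
have := ler_wpM2l (ltW eps0) key.
have -> : eps * ((1 - doeblin) * (D / eps)) = (1 - doeblin) * D.
  by field; exact: lt0r_neq0.
rewrite !pm !lnM ?posrE ?expR_gt0 ?p0 // !expRK !sinkE.
generalize (ln (partition nu g x)) (ln (partition nu g x')) (- m / eps).
generalize (ln (partition nu h x)) (ln (partition nu h x')) (1 - doeblin).
by move: D {hm gD key} => D; intros; lra.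
Qed.

Definition schroedinger mu nu f g :=
  [/\ bmeas f, bmeas g, forall x, f x = sink nu g x & forall y, g y = sink mu f y].

Lemma schroedinger_sym mu nu f g : schroedinger mu nu f g -> schroedinger nu mu g f.
Proof. by case. Qed.

Lemma schroedingerD mu nu f g (r : R) : schroedinger mu nu f g ->
  schroedinger mu nu (fun x => f x - r) (fun y => g y + r).
Proof.
move=> [bf bg fE gE]; split; [by bm|by bm| |].
  by move=> x; rewrite sinkD// -fE.
by move=> y; rewrite sinkD// opprK -gE.
Qed.

Lemma doeblin_contr : 0 <= 1 - doeblin < 1.
Proof. by rewrite subr_ge0 doeblin_le1 gtrBl doeblin_gt0. Qed.

(** The contraction gives a fixed point of the double transform up to a constant [k]. Integrating
    the resulting plan over the second variable first gives total mass 1, over the first variable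
    first it gives [exp(- k / eps)]; Fubini forces [k = 0]. *)
Lemma schroedinger_exists mu nu : exists f g, schroedinger mu nu f g.
Proof.
have /andP[q0 q1] := doeblin_contr.
have [||g bg gE] := @osc_contraction_fixpoint _ _ _ x0
  (fun g => sink mu (sink nu g)) _ doeblin_contr.
- by move=> f bf; do 2!apply: bmeas_sink.
- move=> f g bf bg; apply: (le_trans (sink_osc _ _ _)); [exact: bmeas_sink..|].
  apply: ler_wpM2l => //; apply: (le_trans (sink_osc _ _ _)) => //.
  by apply: ler_piMl; [apply: (osc_ge0 x0); bm|exact: ltW].
set k := sink mu (sink nu g) x0 in gE.
suff k0 : k = 0.
  exists (sink nu g), g; split => //; first exact: bmeas_sink.
  by move=> y; rewrite gE k0 addr0.
have bf := bmeas_sink nu bg; set f := sink nu g in gE bf *.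
have h1 : Ex mu (fun x => Ex nu (fun y => expR ((f x + g y - c x y) / eps))) = 1.
  by rewrite -[RHS](Ex_cst mu 1); apply: eq_Ex => x; exact: sink_marginal.
have b2 : bmeas2 (fun x y => expR ((f x + g y - c x y) / eps)).
  by rewrite /bmeas2; bm.
have h2 y : Ex mu (fun x => expR ((f x + g y - c x y) / eps)) = expR (- k / eps).
  have := sink_marginal mu y bf; rewrite gE.
  rewrite (@eq_Ex _ _ _ _ _
    (fun x => expR (k / eps) * expR ((f x + g y - c x y) / eps))); last first.
    by move=> x; rewrite -expRD cC; congr expR; ring.
  rewrite ExZl; last by bm.
  move/(congr1 (fun z => expR (- k / eps) * z)); rewrite mulr1 => <-.
  by rewrite mulrA -expRD mulNr addNr expR0 mul1r.
move: h1; rewrite Ex_fubini//.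
rewrite (@eq_Ex _ _ _ _ _ (fun=> expR (- k / eps)))// Ex_cst -expR0 => /expR_inj.
by move/eqP; rewrite mulf_eq0 invr_eq0 (negbTE (lt0r_neq0 eps0)) orbF oppr_eq0 => /eqP.
Qed.

Lemma schroedinger_marginal1 mu nu f g x : schroedinger mu nu f g ->
  Ex nu (fun y => expR ((f x + g y - c x y) / eps)) = 1.
Proof. by move=> [bf bg fE gE]; rewrite fE; exact: sink_marginal. Qed.

Lemma schroedinger_marginal2 mu nu f g y : schroedinger mu nu f g ->
  Ex mu (fun x => expR ((f x + g y - c x y) / eps)) = 1.
Proof.
move=> [bf bg fE gE]; rewrite gE -[RHS](sink_marginal mu y bf).
by apply: eq_Ex => x; rewrite cC [f x + _]addrC.
Qed.

(* If [(f, g)] solves the Schroedinger system up to an error [r], the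
   contraction keeps [f, g] within [O(r)] of the exact solution. *)
Lemma schroedinger_stable mu nu f g f1 g1 (r : R) : 0 <= r ->
  schroedinger mu nu f g -> bmeas f1 -> bmeas g1 ->
  (forall x, `|sink nu g1 x - f1 x| <= r) ->
  (forall y, `|sink mu f1 y - g1 y| <= r) ->
  exists s, (forall x, `|f x - s - f1 x| <= (4 / doeblin + 1) * r) /\
            (forall y, `|g y + s - g1 y| <= 4 / doeblin * r).
Proof.
move=> r0 [bf bg fE gE] bf1 bg1 hf hg.
have k0 := doeblin_gt0; have k1 := doeblin_le1.
have bv : bmeas (fun y => g y - g1 y) by bm.
have bu : bmeas (fun y => f y - f1 y) by bm.
have bs1 := bmeas_sink nu bg1; have bs2 := bmeas_sink mu bf1.
have bs := bmeas_sink nu bg; have bs' := bmeas_sink mu bf.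
have ou : osc (fun x => f x - f1 x) <=
    (1 - doeblin) * osc (fun y => g y - g1 y) + 2 * r.
  apply: (osc_le x0) => x y; rewrite !fE.
  have b1 : bmeas (fun x => sink nu g x - sink nu g1 x) by bm.
  have h1 := le_trans (osc_ge x y b1) (sink_osc nu bg bg1).
  have := hf x; have := hf y; rewrite !ler_norml => /andP[? ?] /andP[? ?].
  by move: h1; lra.
have ov : osc (fun x => g x - g1 x) <=
    (1 - doeblin) * osc (fun y => f y - f1 y) + 2 * r.
  apply: (osc_le x0) => x y; rewrite !gE.
  have b1 : bmeas (fun x => sink mu f x - sink mu f1 x) by bm.
  have h1 := le_trans (osc_ge x y b1) (sink_osc mu bf bf1).
  have := hg x; have := hg y; rewrite !ler_norml => /andP[? ?] /andP[? ?].
  by move: h1; lra.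
have v0 := osc_ge0 x0 bv; have u0 := osc_ge0 x0 bu.
pose V := osc (fun y => g y - g1 y); pose U := osc (fun x => f x - f1 x).
rewrite -/V -/U in ou ov; rewrite -/V in v0; rewrite -/U in u0.
(* Inserting one inequality into the other gives [V <= (1 - doeblin) V + 4 r], the origin of the
   4. *)
have hV : V <= 4 / doeblin * r.
  rewrite mulrAC ler_pdivlMr//.
  have h1 : (1 - doeblin) * U <= U by rewrite ler_piMl// gerBl ltW.
  have : V * doeblin = V - (1 - doeblin) * V by ring.
  lra.
(* With this shift [g] and [g1] agree at [x0], so that the oscillation bound becomes a sup norm
   bound. *)
exists (g1 x0 - g x0).
have gs y : `|g y + (g1 x0 - g x0) - g1 y| <= 4 / doeblin * r.
  have h1 := le_trans (osc_ge y x0 bv) hV; have h2 := le_trans (osc_ge x0 y bv) hV.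
  by rewrite ler_norml; move: h1 h2; generalize (4 / doeblin * r) => *; lra.
split => // x; rewrite fE -sinkD// mulrDl mul1r.
rewrite -(subrKA (sink nu g1 x)) (le_trans (ler_normD _ _))// lerD//.
by apply: sink_lip => //; bm.
Qed.

(** Stability with residual 0. *)
Lemma schroedinger_unique mu nu f g f1 g1 :
  schroedinger mu nu f g -> schroedinger mu nu f1 g1 ->
  exists s, (forall x, f1 x = f x - s) /\ (forall y, g1 y = g y + s).
Proof.
move=> fg [bf1 bg1 f1E g1E].
have [||s [hf hg]] := schroedinger_stable (lexx 0) fg bf1 bg1.
- by move=> x; rewrite f1E subrr normr0.
- by move=> x; rewrite g1E subrr normr0.
by exists s; split => z; apply/esym/eqP; rewrite -subr_eq0 -normr_le0 -[X in _ <= X](mulr0 (4 / doeblin)) ?hg//; have := hf z; rewrite !mulr0.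
Qed.

End sinkhorn.

(** * The dual functional *)

Lemma ln_near1 {R : realType} (z r : R) : r <= 1 / 2 -> `|1 - z| <= r -> `|ln z| <= 2 * r.
Proof.
move=> r2; rewrite ler_norml => /andP[h1 h2].
have z0 : 0 < z by lra.
have l1 : ln z <= z - 1 by have := @le_ln1Dx _ (z - 1); rewrite addrCA subrr addr0; apply; lra.
have l2 : - ln z <= z^-1 - 1.
  rewrite -lnV ?posrE//; have := @le_ln1Dx _ (z^-1 - 1); rewrite addrCA subrr addr0; apply.
  by rewrite ltrBrDl subrr invr_gt0.
have l3 : z^-1 - 1 <= 2 * r.
  have -> : z^-1 - 1 = (1 - z) / z by field; exact: lt0r_neq0.
  by rewrite ler_pdivrMr//; nra.
rewrite ler_norml; lra.
Qed.

HB.lock Definition gibbs {T : Type} {R : realType} (eps : R) (c : T -> T -> R)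
  (f g : T -> R) (x y : T) : R := expR ((f x + g y - c x y) / eps).

Section dual_functional.
Context {dT} {T : measurableType dT} {R : realType} (x0 : T).
Variables (eps L : R) (c : T -> T -> R).
Hypotheses (eps0 : 0 < eps) (bc : bmeas2 c) (cC : forall x y, c x y = c y x).
Hypothesis cL : forall x y, 0 <= c x y <= L.
Implicit Types (mu nu : probability T R) (f g : T -> R).

Local Notation gibbs := (gibbs eps c).

Lemma gibbsE f g x y : gibbs f g x y = expR ((f x + g y - c x y) / eps).
Proof. by rewrite gibbs.unlock. Qed.

Definition dual mu nu f g : R := Ex mu f + Ex nu g
  - eps * Ex mu (fun x => Ex nu (gibbs f g x)) + eps.

Lemma bmeas2_gibbs f g : bmeas f -> bmeas g -> bmeas2 (gibbs f g).
Proof.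
move=> bf bg; rewrite /bmeas2 (_ : (fun _ => _) =
    (fun z => expR ((f z.1 + g z.2 - c z.1 z.2) / eps))); first by bm.
by apply/funext => z; rewrite gibbsE.
Qed.

Lemma gibbsC f g x y : gibbs f g x y = gibbs g f y x.
Proof. by rewrite !gibbsE cC [f x + _]addrC. Qed.

(** The right-hand side is the derivative of [dual] at [(f, g)] in the direction of [(f', g')]. The
    inequality is [exp t' >= exp t (1 + t' - t)], integrated. *)
Lemma dual_concave mu nu f g f' g' :
  bmeas f -> bmeas g -> bmeas f' -> bmeas g' ->
  dual mu nu f' g' - dual mu nu f g <=
  Ex mu (fun x => (f' x - f x) * (1 - Ex nu (gibbs f g x))) +
  Ex nu (fun y => (g' y - g y) * (1 - Ex mu (fun x => gibbs f g x y))).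
Proof.
move=> bf bg bf' bg'.
have bK := bmeas2_gibbs bf bg; have bK' := bmeas2_gibbs bf' bg'.
have b1 := bmeas_Ex1 nu bK; have b2 := bmeas_Ex2 mu bK.
have b1' := bmeas_Ex1 nu bK'.
have bS x : bmeas (gibbs f g x) by exact: bmeas_section1.
have bS' x : bmeas (gibbs f' g' x) by exact: bmeas_section1.
have bS2 y : bmeas (fun x => gibbs f g x y) by exact: (@bmeas_section2 _ _ _ _ _ (gibbs f g)).
have bKg : bmeas2 (fun x y => (g' y - g y) * gibbs f g x y).
  by apply: bmeasM => //; bm.
have b3 := bmeas_Ex1 nu bKg.
have key : Ex mu (fun x => Ex nu (gibbs f g x)) + eps^-1 *
    (Ex mu (fun x => (f' x - f x) * Ex nu (gibbs f g x)) +
     Ex nu (fun y => (g' y - g y) * Ex mu (fun x => gibbs f g x y))) <=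
    Ex mu (fun x => Ex nu (gibbs f' g' x)).
  have -> : Ex nu (fun y => (g' y - g y) * Ex mu (fun x => gibbs f g x y)) =
      Ex mu (fun x => Ex nu (fun y => (g' y - g y) * gibbs f g x y)).
    rewrite Ex_fubini//; apply: eq_Ex => y.
    by rewrite ExZl//; exact: bS2.
  set A := Ex mu (fun x => (f' x - f x) * _).
  set B := Ex mu (fun x => Ex nu (fun y => _ * _)).
  have -> : Ex mu (fun x => Ex nu (gibbs f g x)) + eps^-1 * (A + B) =
    Ex mu (fun x => Ex nu (gibbs f g x) + eps^-1 * ((f' x - f x) * Ex nu (gibbs f g x) +
      Ex nu (fun y => (g' y - g y) * gibbs f g x y))).
    rewrite ExD; [|by bm|by bm]; rewrite ExZl; last by bm.
    by rewrite ExD; [|by bm|by bm].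
  apply: le_Ex; [by bm|by bm|] => x.
  have bgx : bmeas (fun y => (g' y - g y) * gibbs f g x y) by apply: bmeasM => //; bm.
  have -> : Ex nu (gibbs f g x) + eps^-1 * ((f' x - f x) * Ex nu (gibbs f g x) +
      Ex nu (fun y => (g' y - g y) * gibbs f g x y)) =
    Ex nu (fun y => gibbs f g x y + eps^-1 * ((f' x - f x) * gibbs f g x y +
      (g' y - g y) * gibbs f g x y)).
    rewrite ExD; [|by bm|by bm]; rewrite ExZl; last by bm.
    by rewrite ExD; [|by bm|by bm]; rewrite ExZl; last by bm.
  apply: le_Ex; [by bm|by bm|] => y.
  set t := (f x + g y - c x y) / eps; set t' := (f' x + g' y - c x y) / eps.
  have -> : gibbs f' g' x y = gibbs f g x y * expR (t' - t).
    by rewrite !gibbsE -expRD -/t -/t'; congr expR; ring.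
  have -> : gibbs f g x y + eps^-1 * ((f' x - f x) * gibbs f g x y + (g' y - g y) * gibbs f g x y) =
     gibbs f g x y * (1 + (t' - t)) by rewrite /t /t'; ring.
  by rewrite ler_wpM2l ?expR_ge1Dx// gibbsE expR_ge0.
have e1 : Ex mu (fun x => (f' x - f x) * (1 - Ex nu (gibbs f g x))) =
    Ex mu f' - Ex mu f - Ex mu (fun x => (f' x - f x) * Ex nu (gibbs f g x)).
  rewrite -!ExB; [|by bm..]; by apply: eq_Ex => x; ring.
have e2 : Ex nu (fun y => (g' y - g y) * (1 - Ex mu (fun x => gibbs f g x y))) =
    Ex nu g' - Ex nu g - Ex nu (fun y => (g' y - g y) * Ex mu (fun x => gibbs f g x y)).
  rewrite -!ExB; [|by bm..]; by apply: eq_Ex => x; ring.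
have := ler_wpM2l (ltW eps0) key.
rewrite mulrDr mulrA divff ?mul1r; last exact: lt0r_neq0.
by rewrite e1 e2 /dual; lra.
Qed.

Lemma schroedinger_gibbs1 mu nu f g x : schroedinger eps c mu nu f g ->
  Ex nu (gibbs f g x) = 1.
Proof.
move=> sfg; rewrite -[RHS](schroedinger_marginal1 eps0 bc cL x sfg).
by apply: eq_Ex => y; rewrite gibbsE.
Qed.

Lemma schroedinger_gibbs2 mu nu f g y : schroedinger eps c mu nu f g ->
  Ex mu (fun x => gibbs f g x y) = 1.
Proof.
move=> sfg; rewrite -[RHS](schroedinger_marginal2 eps0 bc cC cL y sfg).
by apply: eq_Ex => x; rewrite gibbsE.
Qed.

Lemma schroedinger_dual mu nu f g : schroedinger eps c mu nu f g ->
  dual mu nu f g = Ex mu f + Ex nu g.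
Proof.
move=> sfg; rewrite /dual.
rewrite (eq_Ex mu (g := fun=> 1) (fun x => schroedinger_gibbs1 x sfg)) Ex_cst.
by ring.
Qed.

(** At the exact solution the derivative of [dual] vanishes, which gives the lower bound by
    concavity. For the upper bound concavity is used at [(f1, g1)], where the derivative is of size
    [r], and the exact solution is at distance [O(r)] by [schroedinger_stable]; taking logarithms
    turns the marginal residual [r] into the residual [2 eps r] of the fixed point equations. *)
Lemma dual_gap mu nu f g f1 g1 (r : R) : 0 <= r <= 1 / 2 ->
  schroedinger eps c mu nu f g -> bmeas f1 -> bmeas g1 ->
  (forall x, `|1 - Ex nu (gibbs f1 g1 x)| <= r) ->
  (forall y, `|1 - Ex mu (fun x => gibbs f1 g1 x y)| <= r) ->
  0 <= Ex mu f + Ex nu g - dual mu nu f1 g1 <=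
  (8 / doeblin eps L + 1) * (2 * eps) * r ^+ 2.
Proof.
move=> /andP[r0 r2] sfg bf1 bg1 h1 h2; have [bf bg _ _] := sfg.
have aux nu' f' g' : bmeas f' -> bmeas g' ->
    (forall x, `|1 - Ex nu' (gibbs f' g' x)| <= r) ->
    forall x, `|sink eps c nu' g' x - f' x| <= 2 * eps * r.
  move=> bf' bg' h x.
  have E : Ex nu' (gibbs f' g' x) = expR (f' x / eps) * gibbs_mass eps c nu' g' x.
    rewrite partitionE -ExZl; last by bm.
    by apply: eq_Ex => y; rewrite gibbsE -expRD; congr expR; ring.
  have p0 := partition_gt0 eps0 bc cL nu' x bg'.
  have := ln_near1 r2 (h x); rewrite E lnM ?posrE ?expR_gt0// expRK sinkE.
  have -> : - eps * ln (gibbs_mass eps c nu' g' x) - f' x =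
    - eps * (f' x / eps + ln (gibbs_mass eps c nu' g' x)).
    by field; exact: lt0r_neq0.
  by rewrite normrM normrN (gtr0_norm eps0) -mulrA [2 * (_ * _)]mulrCA ler_pM2l.
apply/andP; split.
  have := dual_concave mu nu bf bg bf1 bg1.
  have -> : Ex mu (fun x => (f1 x - f x) * (1 - Ex nu (gibbs f g x))) = 0.
    rewrite -[RHS](Ex_cst mu 0); apply: eq_Ex => x.
    by rewrite (schroedinger_gibbs1 x sfg) subrr mulr0.
  have -> : Ex nu (fun y => (g1 y - g y) * (1 - Ex mu (fun x => gibbs f g x y))) = 0.
    rewrite -[RHS](Ex_cst nu 0); apply: eq_Ex => y.
    by rewrite (schroedinger_gibbs2 y sfg) subrr mulr0.
  by rewrite -(schroedinger_dual sfg); lra.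
have er0 : 0 <= 2 * eps * r by rewrite !mulr_ge0// ltW.
have h2' y : `|1 - Ex mu (gibbs g1 f1 y)| <= r.
  by rewrite (eq_Ex _ (fun x => gibbsC g1 f1 y x)).
have [s [hu hv]] := schroedinger_stable x0 eps0 bc cL er0 sfg bf1 bg1
  (aux nu f1 g1 bf1 bg1 h1) (aux mu g1 f1 bg1 bf1 h2').
have sfg' := schroedingerD eps0 bc cL s sfg.
have e : Ex mu f + Ex nu g = dual mu nu (fun x => f x - s) (fun y => g y + s).
  by rewrite (schroedinger_dual sfg') ExB ?ExD ?Ex_cst//; [ring|bm|bm].
have [bf' bg' _ _] := sfg'.
rewrite e; apply: (le_trans (dual_concave mu nu bf1 bg1 bf' bg')).
have bK := bmeas2_gibbs bf1 bg1.
have b1 := bmeas_Ex1 nu bK; have b2 := bmeas_Ex2 mu bK.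
set k := doeblin eps L in hu hv *.
have -> : (8 / k + 1) * (2 * eps) * r ^+ 2 =
  (4 / k + 1) * (2 * eps * r) * r + 4 / k * (2 * eps * r) * r by ring.
apply: lerD; apply: (le_trans (ler_norm _)); apply: Ex_norm_le; [by bm| |by bm|].
  by move=> x; rewrite normrM ler_pM.
by move=> x; rewrite normrM ler_pM.
Qed.

End dual_functional.

(** The third field makes iterated expressions [L (fun y => L' (K ^~ y))] meaningful, so that two
    functionals can be paired through a kernel. *)
Record blf {dT} {T : measurableType dT} {R : realType} (L : (T -> R) -> R) : Prop := Blf {
  blf_lin : forall a f g, bmeas f -> bmeas g -> L (fun x => a * f x + g x) = a * L f + L g ;
  blf_bound : exists2 C : R, 0 <= C & forall f (B : R), bmeas f -> (forall x, `|f x| <= B) -> `|L f| <= C * B ;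
  blf_meas : forall K : T -> T -> R, bmeas2 K -> bmeas (fun y => L (K ^~ y)) }.

Section blf.
Context {dT} {T : measurableType dT} {R : realType}.
Implicit Types (mu nu : probability T R) (f g : T -> R) (L : (T -> R) -> R).

Lemma blf_eq L f g : f =1 g -> L f = L g. Proof. by move=> /funext ->. Qed.

Lemma blf0 L : blf L -> L (fun=> 0) = 0.
Proof.
move=> bL; have b0 : bmeas (fun _ : T => 0 : R) by bm.
have -> : L (fun=> 0) = L (fun x => -1 * (fun=> 0) x + (fun=> 0) x).
  by apply: blf_eq => x; rewrite mulr0 addr0.
by rewrite (blf_lin bL (-1) b0 b0) mulN1r addNr.
Qed.

Lemma blfD L f g : blf L -> bmeas f -> bmeas g -> L (fun x => f x + g x) = L f + L g.
Proof.
move=> bL bf bg; rewrite -[L f]mul1r -blf_lin//.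
by apply: blf_eq => x; rewrite mul1r.
Qed.

Lemma blfZ L a f : blf L -> bmeas f -> L (fun x => a * f x) = a * L f.
Proof.
move=> bL bf; have b0 : bmeas (fun _ : T => 0 : R) by bm.
rewrite -[RHS]addr0 -(blf0 bL) -blf_lin//.
by apply: blf_eq => x; rewrite addr0.
Qed.

Lemma blf_sum L (I : Type) (s : seq I) (F : I -> T -> R) : blf L ->
  (forall i, bmeas (F i)) -> L (fun x => \sum_(i <- s) F i x) = \sum_(i <- s) L (F i).
Proof.
move=> bL bF; elim: s => [|i s IH].
  by rewrite big_nil -[RHS](blf0 bL); apply: blf_eq => x; rewrite big_nil.
rewrite big_cons -IH -blfD//; last exact: bmeas_sum.
by apply: blf_eq => x; rewrite big_cons.
Qed.

Lemma blf_Ex mu : blf (Ex mu).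
Proof.
split=> [a f g bf bg| |K bK]; last exact: bmeas_Ex2.
  by rewrite ExD ?ExZl//; bm.
by exists 1 => // f B bf fB; rewrite mul1r; exact: Ex_norm_le.
Qed.

Lemma blf_sub (L1 L2 : (T -> R) -> R) : blf L1 -> blf L2 -> blf (fun f => L1 f - L2 f).
Proof.
move=> b1 b2; split=> [a f g bf bg| |K bK].
- by rewrite !blf_lin//; ring.
- have [C1 C10 h1] := blf_bound b1; have [C2 C20 h2] := blf_bound b2.
  exists (C1 + C2); first exact: addr_ge0.
  move=> f B bf fB; rewrite mulrDl (le_trans (ler_normB _ _))// lerD//.
    exact: h1.
  exact: h2.
- by have ? := blf_meas b1 bK; have ? := blf_meas b2 bK; bm.
Qed.

Lemma blf_weight L g : blf L -> bmeas g -> blf (fun f => L (fun x => g x * f x)).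
Proof.
move=> bL bg; split=> [a f h bf bh| |K bK].
- rewrite -blf_lin; [|by []|by bm|by bm].
  by apply: blf_eq => x; ring.
- have [C C0 hC] := blf_bound bL; have [B B0 hB] := bmeas_bound bg.
  exists (C * B); first exact: mulr_ge0.
  move=> f M bf fM; rewrite -mulrA; apply: hC; first by bm.
  by move=> x; rewrite normrM ler_pM.
- by apply: (blf_meas bL (K := fun x y => g x * K x y)); rewrite /bmeas2; bm.
Qed.

Lemma blf_eval x : blf (fun f => f x).
Proof.
split=> [//| |K bK]; last exact: bmeas_section1.
by exists 1 => // f B _ fB; rewrite mul1r.
Qed.

End blf.

(* The Taylor remainder of exp is maximal at the right end of [-Z, Z]. *)
Lemma expR_taylor_unif {R : realType} (Z eta : R) : 0 < eta ->
  exists J0, forall z J, (J0 <= J)%N -> `|z| <= Z ->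
    `|expR z - \sum_(j < J) z ^+ j / j`!%:R| <= eta.
Proof.
move=> eta0.
have cZ := @is_cvg_series_exp_coeff R Z.
have /cvgrPdist_le /(_ _ eta0)[J0 _ hJ] : series (exp_coeff Z) @ \oo --> expR Z by exact: cZ.
exists J0 => z J JJ zZ.
have cz := @is_cvg_series_exp_coeff R z.
have Z0 : 0 <= Z := le_trans (normr_ge0 _) zZ.
have sE (w : R) k : \sum_(j < k) w ^+ j / j`!%:R = series (exp_coeff w) k.
  by rewrite /series /= big_mkord.
apply: le_trans (hJ J JJ); apply: le_trans (ler_norm _).
rewrite sE.
have c1 : `|series (exp_coeff z) k - series (exp_coeff z) J| @[k --> \oo] -->
    `|expR z - series (exp_coeff z) J|.
  by apply: cvg_norm; apply: cvgB; [exact: cz|exact: cvg_cst].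
have c2 : series (exp_coeff Z) k - series (exp_coeff Z) J @[k --> \oo] -->
    expR Z - series (exp_coeff Z) J.
  by apply: cvgB; [exact: cZ|exact: cvg_cst].
apply: (ler_cvg_to c1 c2); exists J => // k /= Jk.
rewrite !sub_series_geq//.
apply: (le_trans (ler_norm_sum _ _ _)); apply: ler_sum => i _.
rewrite /exp_coeff /= normrM normrX ler_pM//; first by rewrite lerXn2r ?nnegrE.
by rewrite ger0_norm// invr_ge0.
Qed.

(** * Moments and the kernel exp<x,y> *)

Lemma sum_half_le {R : realType} J : \sum_(i < J) (1 / 2 : R) ^+ i <= 2.
Proof.
suff -> : \sum_(i < J) (1 / 2 : R) ^+ i = 2 - 2 * (1 / 2) ^+ J.
  by rewrite gerBl mulr_ge0// exprn_ge0// divr_ge0.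
elim: J => [|J IH]; first by rewrite big_ord0 expr0; ring.
by rewrite big_ord_recr /= IH exprS; field.
Qed.

Section monomials.
Context {dT} {T : measurableType dT} {R : realType} (d : nat).
Variables (X : 'I_d -> T -> R) (B theta eps : R).
Hypotheses (bX : forall i, bmeas (X i)) (XB : forall i x, `|X i x| <= B).
Hypotheses (B0 : 0 <= B) (th0 : 0 < theta) (eps0 : 0 < eps).
Hypotheses (thB : theta * B <= 1) (thdB : theta * (d%:R * B) <= 1 / 2).
Implicit Types (L : (T -> R) -> R) (F G : T -> R).

(** Monomials are indexed by words instead of exponents: powers of [inner] then expand with all
    coefficients equal to 1, at the price of repetitions. *)
Definition monom j (t : {ffun 'I_j -> 'I_d}) (x : T) : R := \prod_(i < j) X (t i) x.

Lemma bmeas_monom j (t : {ffun 'I_j -> 'I_d}) : bmeas (monom t).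
Proof. by apply: bmeas_prod => i _. Qed.

Lemma monom_bound j (t : {ffun 'I_j -> 'I_d}) x : `|monom t x| <= B ^+ j.
Proof.
rewrite normr_prod -[X in _ ^+ X]card_ord -prodr_const.
by apply: ler_prod => i _; rewrite normr_ge0 XB.
Qed.

Lemma monom_cat j k (t : {ffun 'I_j -> 'I_d}) (t' : {ffun 'I_k -> 'I_d}) :
  exists t'' : {ffun 'I_(j + k) -> 'I_d}, forall x, monom t x * monom t' x = monom t'' x.
Proof.
exists [ffun i : 'I_(j + k) => match fintype.split i with inl a => t a | inr b => t' b end] => x.
rewrite /monom big_split_ord /=; congr (_ * _); apply: eq_bigr => i _; rewrite ffunE.
  by rewrite (unsplitK (inl _ i)).
by rewrite (unsplitK (inr _ i)).
Qed.

Definition inner x y : R := \sum_(i < d) X i x * X i y.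

Lemma innerC x y : inner x y = inner y x.
Proof. by apply: eq_bigr => i _; rewrite mulrC. Qed.

Lemma bmeas2_inner : bmeas2 inner.
Proof. by apply: bmeas_sum => i _; bm. Qed.

Lemma innerX j x y : inner x y ^+ j = \sum_(t : {ffun 'I_j -> 'I_d}) monom t x * monom t y.
Proof.
rewrite -[X in _ ^+ X]card_ord -prodr_const.
rewrite (eq_bigl xpredT)// /inner (bigA_distr_bigA (fun _ i => X i x * X i y)).
by apply: eq_bigr => t _; rewrite big_split.
Qed.

Definition expi x y : R := expR (inner x y / eps).

Lemma expiC x y : expi x y = expi y x. Proof. by rewrite /expi innerC. Qed.

Lemma bmeas2_expi : bmeas2 expi.
Proof. by have b := bmeas2_inner; rewrite /bmeas2 /expi; bm. Qed.

(* Stated with partial sums, so that [L] never has to be exchanged with a series. *)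
Definition moments F L (N : R) := forall J,
  \sum_(j < J) theta ^+ j * (\sum_(t : {ffun 'I_j -> 'I_d}) `|L (fun x => F x * monom t x)|) <= N.

Lemma moments_term F L (N : R) j (t : {ffun 'I_j -> 'I_d}) : moments F L N ->
  theta ^+ j * `|L (fun x => F x * monom t x)| <= N.
Proof.
move=> /(_ j.+1); rewrite big_ord_recr /=; apply: le_trans.
apply: (le_trans (y := theta ^+ j * (\sum_(t : {ffun 'I_j -> 'I_d}) `|L (fun x => F x * monom t x)|))).
  rewrite ler_wpM2l ?exprn_ge0 ?(ltW th0)// (bigD1 t)//= lerDl.
  by apply: sumr_ge0.
rewrite lerDr; apply: sumr_ge0 => i _; rewrite mulr_ge0 ?exprn_ge0 ?(ltW th0)//.
by apply: sumr_ge0.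
Qed.

(** There are [d ^ j] words of length [j], each giving at most [C M B ^ j]; by the choice of [theta]
    the degrees sum like powers of 1/2. *)
Lemma moments_bounded F L (M C : R) : 0 <= C -> 0 <= M -> bmeas F -> (forall x, `|F x| <= M) ->
  (forall f (b : R), bmeas f -> (forall x, `|f x| <= b) -> `|L f| <= C * b) ->
  moments F L (2 * (C * M)).
Proof.
move=> C0 M0 bF FM hL J.
have h j : theta ^+ j * (\sum_(t : {ffun 'I_j -> 'I_d}) `|L (fun x => F x * monom t x)|)
    <= C * M * (1 / 2) ^+ j.
  apply: (le_trans (y := theta ^+ j * (\sum_(t : {ffun 'I_j -> 'I_d}) C * (M * B ^+ j)))).
    rewrite ler_wpM2l ?exprn_ge0 ?(ltW th0)//; apply: ler_sum => t _.
    apply: hL; first by have := bmeas_monom t; bm.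
    by move=> x; rewrite normrM ler_pM// monom_bound.
  rewrite sumr_const card_ffun !card_ord. rewrite -[_ *+ (_ ^ _)]mulr_natr natrX.
  have -> : theta ^+ j * (C * (M * B ^+ j) * d%:R ^+ j) =
    C * M * (theta * (d%:R * B)) ^+ j by rewrite !exprMn; ring.
  rewrite ler_wpM2l ?mulr_ge0// lerXn2r ?nnegrE ?mulr_ge0 ?divr_ge0 ?ler0n//.
  exact: ltW.
apply: (le_trans (ler_sum _ (fun (j : 'I_J) _ => h j))).
by rewrite -mulr_sumr [2 * _]mulrC ler_wpM2l ?mulr_ge0// sum_half_le.
Qed.

Lemma moments_ge0 F L N : moments F L N -> 0 <= N.
Proof. by move=> /(_ 0); rewrite big_ord0. Qed.

(** The product of two monomials is a monomial, so the squared weight controls products of two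
    weighted monomials; the factor [theta ^ j] of the fixed one is lost. *)
Lemma moments_mul F L (N : R) j k (t : {ffun 'I_j -> 'I_d}) (t' : {ffun 'I_k -> 'I_d}) :
  moments (fun x => F x * F x) L N ->
  theta ^+ k * `|L (fun x => (F x * monom t x) * (F x * monom t' x))| <= N / theta ^+ j.
Proof.
move=> mN; rewrite ler_pdivlMr ?exprn_gt0// mulrC mulrA -exprD.
have [t'' ht] := monom_cat t t'.
rewrite (_ : (fun x => _) = (fun x => F x * F x * monom t'' x)); last first.
  by apply/funext => x; rewrite -ht; ring.
exact: moments_term.
Qed.

(** The ratio of the Taylor coefficient [eps ^ (- j) / j!] to [theta ^ (2 j)] is a term of the
    exponential series at [1 / (theta ^ 2 eps)], so that this constant dominates it in every
    degree. *)
Definition bb_const : R := expR ((theta ^+ 2 * eps)^-1).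

Lemma bb_const_ge0 : 0 <= bb_const. Proof. exact: expR_ge0. Qed.

Lemma bb_const_coef j : eps^-1 ^+ j / j`!%:R <= bb_const * (theta ^+ j * theta ^+ j).
Proof.
rewrite -ler_pdivrMr ?mulr_gt0 ?exprn_gt0//.
have -> : eps^-1 ^+ j / j`!%:R / (theta ^+ j * theta ^+ j) = (theta ^+ 2 * eps)^-1 ^+ j / j`!%:R.
  rewrite -exprD addnn -mul2n exprM; move: (theta ^+ 2) => a.
  by rewrite invfM exprMn [a^-1 ^+ j]exprVn; ring.
rewrite /bb_const; set z := _^-1.
have z0 : 0 < z by rewrite invr_gt0 mulr_gt0 ?exprn_gt0.
case: j => [|j]; first by rewrite expr0 fact0 divr1 -expR0 ler_expR ltW.
apply: le_trans (expR_ge1Dxn j (ltW z0)).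
by rewrite lerDr.
Qed.

(* [exp <x, y>] is the sum over the monomials of [theta]-weighted products, so a
   bilinear pairing with it is at most (summed moments) * (largest moment). *)
Lemma kernel_bound L L' F G (N s : R) : blf L -> blf L' -> bmeas F -> bmeas G ->
  moments F L' N ->
  (forall j (t : {ffun 'I_j -> 'I_d}), theta ^+ j * `|L (fun y => G y * monom t y)| <= s) ->
  `|L (fun y => L' (fun x => F x * G y * expi x y))| <= bb_const * N * s.
Proof.
move=> bL bL' bF bG mN hs.
have N0 := moments_ge0 mN.
have s0 : 0 <= s.
  have t0 : {ffun 'I_0 -> 'I_d} by apply: ffun0; exact: card_ord.
  by apply: le_trans (hs 0 t0); rewrite mulr_ge0 ?exprn_ge0// ltW.
have bm' j (t : {ffun 'I_j -> 'I_d}) := bmeas_monom t.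
have bE := bmeas2_expi.
have [C C0 hC] := blf_bound bL; have [C' C'0 hC'] := blf_bound bL'.
have [MF MF0 hMF] := bmeas_bound bF; have [MG MG0 hMG] := bmeas_bound bG.
have bin : bmeas2 (fun x y => inner x y / eps).
  by have := bmeas2_inner => ?; rewrite /bmeas2; bm.
have [Z Z0 hZ] := bmeas2_bound bin.
apply/ler_addgt0Pr => e e0.
(* A uniform error [e / D] on the kernel costs at most [e] after both functionals; the summand 1
   keeps [D] positive. *)
set D := C * (C' * (MF * MG)) + 1.
have D0 : 0 < D by rewrite ltr_wpDl// !mulr_ge0.
have eD0 : 0 < e / D by rewrite divr_gt0.
have [J hJ] := expR_taylor_unif Z eD0.
pose EJ x y := \sum_(j < J) (inner x y / eps) ^+ j / j`!%:R.
have bEJ : bmeas2 EJ.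
  by apply: bmeas_sum => j _; apply: bmeasM; [apply: bmeasX|exact: bmeas_cst].
have dE x y : `|expi x y - EJ x y| <= e / D by exact: hJ.
have bK1 : bmeas2 (fun x y => F x * G y * EJ x y) by rewrite /bmeas2; bm.
have bK2 : bmeas2 (fun x y => F x * G y * (expi x y - EJ x y)) by rewrite /bmeas2; bm.
have b1 := blf_meas bL' bK1; have b2 := blf_meas bL' bK2.
have -> : L (fun y => L' (fun x => F x * G y * expi x y)) =
    L (fun y => L' (fun x => F x * G y * EJ x y)) +
    L (fun y => L' (fun x => F x * G y * (expi x y - EJ x y))).
  rewrite -blfD//; apply: blf_eq => y; rewrite -blfD//.
  - by apply: blf_eq => x; ring.
  - exact: (bmeas_section2 y bK1).
  - exact: (bmeas_section2 y bK2).
rewrite (le_trans (ler_normD _ _))// lerD//; last first.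
  have : `|L (fun y => L' (fun x => F x * G y * (expi x y - EJ x y)))| <=
      C * (C' * (MF * MG * (e / D))).
    apply: hC => // y; apply: hC'; first exact: (bmeas_section2 y bK2).
    by move=> x; rewrite normrM ler_pM// normrM ler_pM.
  move=> /le_trans; apply.
  have -> : C * (C' * (MF * MG * (e / D))) = (D - 1) * e / D.
    by rewrite /D; ring.
  by rewrite ler_pdivrMr// mulrC ler_pM2l// gerBl.
pose w j : R := eps^-1 ^+ j / j`!%:R.
have w0 j : 0 <= w j by rewrite /w mulr_ge0 ?exprn_ge0 ?invr_ge0 ?(ltW eps0)// ler0n.
have bFt j (t : {ffun 'I_j -> 'I_d}) : bmeas (fun x => F x * monom t x) by bm.
have bGt j (t : {ffun 'I_j -> 'I_d}) : bmeas (fun x => G x * monom t x) by bm.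
have -> : L (fun y => L' (fun x => F x * G y * EJ x y)) =
    \sum_(j < J) \sum_(t : {ffun 'I_j -> 'I_d})
      w j * L' (fun x => F x * monom t x) * L (fun y => G y * monom t y).
  transitivity (L (fun y => \sum_(j < J) \sum_(t : {ffun 'I_j -> 'I_d})
      w j * L' (fun x => F x * monom t x) * (G y * monom t y))).
    apply: blf_eq => y.
    transitivity (L' (fun x => \sum_(j < J) \sum_(t : {ffun 'I_j -> 'I_d})
      w j * (G y * monom t y) * (F x * monom t x))).
      apply: blf_eq => x; rewrite mulr_sumr; apply: eq_bigr => j _.
      rewrite exprMn innerX mulr_suml mulr_suml mulr_sumr; apply: eq_bigr => t _.
      by rewrite /w; ring.
    rewrite blf_sum//; last by move=> j; apply: bmeas_sum => t _; bm.
    apply: eq_bigr => j _; rewrite blf_sum//; last by move=> t; bm.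
    by apply: eq_bigr => t _; rewrite blfZ//; ring.
  rewrite blf_sum//; last by move=> j; apply: bmeas_sum => t _; bm.
  apply: eq_bigr => j _; rewrite blf_sum//; last by move=> t; bm.
  by apply: eq_bigr => t _; rewrite blfZ.
apply: (le_trans (ler_norm_sum _ _ _)).
apply: (le_trans (y := \sum_(j < J) bb_const * s * (theta ^+ j *
    (\sum_(t : {ffun 'I_j -> 'I_d}) `|L' (fun x => F x * monom t x)|)))); last first.
  by rewrite -mulr_sumr [X in _ <= X]mulrAC ler_wpM2l// mulr_ge0 ?bb_const_ge0.
apply: ler_sum => j _; rewrite mulr_sumr mulr_sumr.
apply: (le_trans (ler_norm_sum _ _ _)); apply: ler_sum => t _.
rewrite 2!normrM (ger0_norm (w0 j)).
have h1 : w j <= bb_const * (theta ^+ j * theta ^+ j) := bb_const_coef j.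
have t0 : 0 <= theta ^+ j by rewrite exprn_ge0// ltW.
apply: (le_trans (y := bb_const * (theta ^+ j * theta ^+ j) *
    `|L' (fun x => F x * monom t x)| * `|L (fun y => G y * monom t y)|)).
  by rewrite ler_wpM2r// ler_wpM2r.
have -> : bb_const * (theta ^+ j * theta ^+ j) *
    `|L' (fun x => F x * monom t x)| * `|L (fun y => G y * monom t y)| =
  bb_const * (theta ^+ j * `|L' (fun x => F x * monom t x)|) *
   (theta ^+ j * `|L (fun y => G y * monom t y)|) by ring.
by rewrite [X in _ <= X]mulrAC; apply: ler_wpM2l => //; rewrite !mulr_ge0 ?bb_const_ge0.
Qed.

End monomials.

(** * First and second order expansions *)

(** From degree 3 on, each term of the series at [t] is at most [|t| ^ 3] times the term of the same
    degree at 1. *)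
Lemma expR_taylor3 {R : realType} (t : R) : `|t| <= 1 ->
  `|expR t - (1 + t + t ^+ 2 / 2)| <= expR 1 * `|t| ^+ 3.
Proof.
move=> t1; apply/ler_addgt0Pr => e e0.
have e20 : 0 < e / 2 by rewrite divr_gt0.
have [J hJ] := @expR_taylor_unif R 1 _ e20.
have h1 := hJ t (3 + J)%N (leq_addl _ _) t1.
have h2 : `|expR 1 - \sum_(j < 3 + J) 1 ^+ j / j`!%:R| <= e / 2.
  by apply: hJ; [exact: leq_addl|rewrite normr1].
have S3 : \sum_(j < 3) t ^+ j / j`!%:R = 1 + t + t ^+ 2 / 2.
  by rewrite !big_ord_recr big_ord0 /= expr0 expr1 add0r !divr1.
move: h1 h2; rewrite !big_split_ord /= S3.
set r := \sum_(i < J) t ^+ (3 + i) / _; set s := \sum_(i < J) 1 ^+ (3 + i) / _.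
set s3 := \sum_(j < 3) _ => h1 h2.
have rs : `|r| <= `|t| ^+ 3 * s.
  rewrite mulr_sumr; apply: (le_trans (ler_norm_sum _ _ _)); apply: ler_sum => i _.
  rewrite expr1n mul1r normrM exprD normrM !normrX (ger0_norm (x := _^-1)) ?invr_ge0//.
  by rewrite -mulrA ler_wpM2l ?exprn_ge0// ler_piMl ?invr_ge0// exprn_ile1.
have s30 : 0 <= s3.
  by apply: sumr_ge0 => i _; rewrite expr1n mul1r invr_ge0.
have s0 : s <= expR 1 + e / 2 by move: h2; rewrite ler_norml => /andP[? _]; lra.
have t30 : 0 <= `|t| ^+ 3 by rewrite exprn_ge0.
have t31 : `|t| ^+ 3 <= 1 by rewrite exprn_ile1.
have h3 : `|t| ^+ 3 * s <= expR 1 * `|t| ^+ 3 + e / 2.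
  apply: (le_trans (ler_wpM2l t30 s0)); rewrite mulrDr mulrC lerD2l.
  by rewrite ler_piMl// ltW.
have -> : expR t - (1 + t + t ^+ 2 / 2) = (expR t - (1 + t + t ^+ 2 / 2 + r)) + r by ring.
apply: (le_trans (ler_normD _ _)); apply: (le_trans (lerD h1 (le_trans rs h3))).
by rewrite addrCA -splitr.
Qed.

Lemma expR_taylor2 {R : realType} (t : R) : `|t| <= 1 ->
  `|expR t - (1 + t)| <= (expR 1 + 1) * `|t| ^+ 2.
Proof.
move=> t1; have h := expR_taylor3 t1.
have -> : expR t - (1 + t) = (expR t - (1 + t + t ^+ 2 / 2)) + t ^+ 2 / 2 by ring.
apply: (le_trans (ler_normD _ _)); rewrite mulrDl mul1r; apply: lerD.
  apply: (le_trans h); rewrite ler_wpM2l ?expR_ge0// exprSr ler_piMr// exprn_ge0//.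
by rewrite normrM normrX (ger0_norm (x := 2^-1))// ler_piMr ?exprn_ge0//; lra.
Qed.

(** Expanding the squared distance puts the two half squared norms into the weights and leaves
    [exp(<x, y> / eps)] as the only interaction. *)
HB.lock Definition weight {T : Type} {R : realType} {d : nat}
  (X : 'I_d -> T -> R) (eps : R) (f : T -> R) (x : T) : R :=
  expR ((f x - 2^-1 * \sum_(i < d) X i x ^+ 2) / eps).

Section expansions.
Context {dT} {T : measurableType dT} {R : realType} (d : nat) (x0 : T).
Variables (X : 'I_d -> T -> R) (B theta eps L : R) (c : T -> T -> R).
Hypotheses (bX : forall i, bmeas (X i)) (XB : forall i x, `|X i x| <= B).
Hypotheses (B0 : 0 <= B) (th0 : 0 < theta) (eps0 : 0 < eps).
Hypotheses (thdB : theta * (d%:R * B) <= 1 / 2).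
Hypothesis cE : forall x y, c x y = 2^-1 * \sum_(i < d) (X i x - X i y) ^+ 2.
Hypothesis cL : forall x y, 0 <= c x y <= L.
Implicit Types (mu nu P Q : probability T R) (f g : T -> R).

Local Notation monom := (monom X).
Local Notation moments := (moments X theta).
Local Notation expi := (expi X eps).
Local Notation K0 := (bb_const theta eps).
Local Notation weight := (weight X eps).
Local Notation gibbs := (gibbs eps c).
Local Notation schroedinger := (schroedinger eps c).

Lemma weightE f x : weight f x = expR ((f x - 2^-1 * \sum_(i < d) X i x ^+ 2) / eps).
Proof. by rewrite weight.unlock. Qed.

Let bc : bmeas2 c.
Proof.
rewrite /bmeas2 (_ : (fun z => c z.1 z.2) =
    (fun z => 2^-1 * \sum_(i < d) (X i z.1 - X i z.2) ^+ 2)); last first.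
  by apply/funext => z; rewrite cE.
by apply: bmeasM; [exact: bmeas_cst|apply: bmeas_sum => i _; bm].
Qed.

Let cC x y : c x y = c y x.
Proof. by rewrite !cE; congr (_ * _); apply: eq_bigr => i _; rewrite -sqrrN opprB. Qed.

Lemma bmeas_weight f : bmeas f -> bmeas (weight f).
Proof.
move=> bf; rewrite (_ : weight f = (fun x =>
  expR ((f x - 2^-1 * \sum_(i < d) X i x ^+ 2) / eps))); last first.
  by apply/funext => x; rewrite weightE.
have bS : bmeas (fun x => \sum_(i < d) X i x ^+ 2) by apply: bmeas_sum => i _; bm.
by bm.
Qed.

Lemma gibbs_weight f g x y : gibbs f g x y = weight f x * weight g y * expi x y.
Proof.
rewrite gibbsE !weightE /expi -!expRD; congr expR.
rewrite -!mulrDl cE; congr (_ / _).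
have -> : \sum_(i < d) (X i x - X i y) ^+ 2 =
    \sum_(i < d) X i x ^+ 2 + \sum_(i < d) X i y ^+ 2 - 2 * inner X x y.
  rewrite /inner mulr_sumr -sumrN -!big_split /=; apply: eq_bigr => i _; ring.
by field.
Qed.

Let kb L1 L2 F G (N s : R) := @kernel_bound _ _ _ _ X theta eps bX th0 eps0 L1 L2 F G N s.

Lemma blf_diff mu P : blf (fun h => Ex mu h - Ex P h).
Proof. by apply: blf_sub; exact: blf_Ex. Qed.

Lemma moments_Ex_weight P h F (H M : R) : bmeas h -> bmeas F ->
  (forall x, `|h x| <= H) -> (forall x, `|F x| <= M) ->
  moments F (fun k => Ex P (fun x => h x * k x)) (2 * (H * M)).
Proof.
move=> bh bF hH FM.
have H0 : 0 <= H := le_trans (normr_ge0 _) (hH x0).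
have M0 : 0 <= M := le_trans (normr_ge0 _) (FM x0).
apply: (moments_bounded bX XB B0 th0 thdB) => // f b bf fb.
by apply: Ex_norm_le; [bm|move=> x; rewrite normrM ler_pM].
Qed.

(** Point evaluation is treated as a functional, so that [kernel_bound] also yields pointwise bounds
    on residuals. *)
Lemma moments_eval F x (M : R) : bmeas F -> (forall x, `|F x| <= M) ->
  moments F (fun k => k x) (2 * M).
Proof.
move=> bF FM; have M0 : 0 <= M := le_trans (normr_ge0 _) (FM x0).
rewrite -[M]mul1r; apply: (moments_bounded bX XB B0 th0 thdB) => //.
by move=> f b _ fb; rewrite mul1r.
Qed.

Lemma eval_term F x (M : R) j (t : {ffun 'I_j -> 'I_d}) : bmeas F ->
  (forall x, `|F x| <= M) -> theta ^+ j * `|F x * monom t x| <= 2 * M.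
Proof.
move=> bF FM.
exact: (@moments_term _ _ _ _ X _ th0 F (fun k => k x) _ j t (moments_eval x bF FM)).
Qed.

(** The population pair competes for [(mu, nu)] with residuals of order [N], so by [dual_gap] it
    loses [O(N ^ 2)]. Its dual value is linear in the measures except for the total mass of the
    Gibbs kernel, which deviates from 1 by [O(N ^ 2)] only. *)
Lemma first_order P Q f g : schroedinger P Q f g ->
  exists K r0, [/\ 0 <= K, 0 < r0 & forall mu nu f1 g1 (N : R), 0 <= N <= r0 ->
    schroedinger mu nu f1 g1 ->
    moments (weight f) (fun h => Ex mu h - Ex P h) N ->
    moments (weight g) (fun h => Ex nu h - Ex Q h) N ->
    `|Ex mu f1 + Ex nu g1 - (Ex mu f + Ex nu g)| <= K * N ^+ 2].
Proof.
move=> sfg; have [bf bg _ _] := sfg.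
have bwf := bmeas_weight bf; have bwg := bmeas_weight bg.
have [M1 M10 hM1] := bmeas_bound bwf; have [M2 M20 hM2] := bmeas_bound bwg.
have bK := bmeas2_gibbs eps bc bf bg.
have K00 : 0 <= K0 := bb_const_ge0 _ _.
pose M := M1 + M2; have M0 : 0 <= M by rewrite addr_ge0.
pose D := K0 * (2 * M).
have D0 : 0 <= D by rewrite !mulr_ge0.
(* [D N] will bound the residuals; the radius keeps it below the 1/2 demanded by [dual_gap]. *)
exists (eps * K0 + (8 / doeblin eps L + 1) * (2 * eps) * D ^+ 2), (1 / (2 * (D + 1))).
have k0 := doeblin_gt0 eps L.
split.
- by rewrite addr_ge0 ?mulr_ge0 ?addr_ge0 ?divr_ge0 ?exprn_ge0// ltW.
- by rewrite divr_gt0// mulr_gt0// ltr_wpDl.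
move=> mu nu f1 g1 N /andP[N0 Nr] s1 mf mg.
have bB := blf_diff nu Q; have bA := blf_diff mu P.
have rN x : `|1 - Ex nu (gibbs f g x)| <= D * N.
  rewrite -(schroedinger_gibbs1 eps0 bc cL x sfg) distrC.
  have -> : D * N = K0 * N * (2 * M) by rewrite /D; ring.
  have := @kb (fun k => k x) (fun h => Ex nu h - Ex Q h) (weight g) (weight f) N (2 * M).
  move=> /(_ (blf_eval x) bB bwg bwf mg) h.
  apply: le_trans (h _); last first.
    move=> j t; apply: eval_term => // y.
    by rewrite (le_trans (hM1 y))// /M lerDl.
  rewrite le_eqVlt; apply/orP; left; apply/eqP; congr `|_| => /=.
  suff -> : gibbs f g x = (fun y => weight g y * weight f x * expi y x) by [].
  by apply/funext => y; rewrite gibbs_weight expiC; ring.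
have rN' y : `|1 - Ex mu (fun x => gibbs f g x y)| <= D * N.
  rewrite -(schroedinger_gibbs2 eps0 bc cC cL y sfg) distrC.
  have -> : D * N = K0 * N * (2 * M) by rewrite /D; ring.
  have := @kb (fun k => k y) (fun h => Ex mu h - Ex P h) (weight f) (weight g) N (2 * M).
  move=> /(_ (blf_eval y) bA bwf bwg mf) h.
  apply: le_trans (h _); last first.
    move=> j t; apply: eval_term => // x.
    by rewrite (le_trans (hM2 x))// /M lerDr.
  rewrite le_eqVlt; apply/orP; left; apply/eqP; congr `|_| => /=.
  suff -> : gibbs f g ^~ y = (fun x => weight f x * weight g y * expi x y) by [].
  by apply/funext => x; rewrite gibbs_weight.
have r12 : 0 <= D * N <= 1 / 2.
  rewrite mulr_ge0//=.
  apply: (le_trans (ler_wpM2l D0 Nr)); rewrite mulrA mulr1 ler_pdivrMr; last first.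
    by rewrite mulr_gt0// ltr_wpDl.
  by lra.
have gap := dual_gap x0 eps0 bc cC cL r12 s1 bf bg rN rN'.
(* The marginal equations of [P] and [Q] cancel everything but the pairing of the kernel with the
   product of [mu - P] and [nu - Q]. *)
have V : `|Ex mu (fun x => Ex nu (gibbs f g x)) - 1| <= K0 * N * N.
  have b1 := bmeas_Ex1 nu bK; have b2 := bmeas_Ex1 Q bK.
  have b3 := bmeas_Ex2 mu bK.
  have E1 : Ex P (fun x => Ex nu (gibbs f g x)) = 1.
    rewrite Ex_fubini// -[RHS](Ex_cst nu 1); apply: eq_Ex => y.
    exact: (schroedinger_gibbs2 eps0 bc cC cL y sfg).
  have E2 mu' : Ex mu' (fun x => Ex Q (gibbs f g x)) = 1.
    rewrite -[RHS](Ex_cst mu' 1); apply: eq_Ex => x.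
    exact: (schroedinger_gibbs1 eps0 bc cL x sfg).
  have := @kb (fun h => Ex mu h - Ex P h) (fun h => Ex nu h - Ex Q h) (weight g) (weight f) N N.
  move=> /(_ bA bB bwg bwf mg) h; apply: le_trans (h _); last first.
    by move=> j t; exact: (@moments_term _ _ _ _ X _ th0 _ (fun h => Ex mu h - Ex P h) _ j t mf).
  rewrite le_eqVlt; apply/orP; left; apply/eqP; congr `|_| => /=.
  have E k : (fun y => Ex k (fun x => weight g x * weight f y * expi x y)) =
      (fun x => Ex k (gibbs f g x)).
    by apply/funext => x; congr Ex; apply/funext => y; rewrite gibbs_weight expiC; ring.
  rewrite !ExB; [|by rewrite E..]; rewrite !E E1 !E2; ring.
move: gap; rewrite /dual => gap.
have [g1' g2'] := andP gap.
have := ler_wpM2l (ltW eps0) V.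
have -> : (eps * K0 + (8 / doeblin eps L + 1) * (2 * eps) * D ^+ 2) * N ^+ 2 =
  eps * (K0 * N * N) + (8 / doeblin eps L + 1) * (2 * eps) * (D * N) ^+ 2 by ring.
have -> : eps * `|Ex mu (fun x => Ex nu (gibbs f g x)) - 1| =
   `|eps * Ex mu (fun x => Ex nu (gibbs f g x)) - eps|.
  generalize (Ex mu (fun x => Ex nu (gibbs f g x))) => z.
  have -> : eps * z - eps = eps * (z - 1) by ring.
  by rewrite normrM (gtr0_norm eps0).
rewrite !ler_norml; move: g1' g2'.
generalize (eps * Ex mu (fun x => Ex nu (gibbs f g x)))
  ((8 / doeblin eps L + 1) * (2 * eps) * (D * N) ^+ 2) (Ex mu f1) (Ex nu g1) (Ex mu f) (Ex nu g).
by move=> a c' a1 a2 a3 a4 h1 h2 /andP[h3 h4]; apply/andP; split; lra.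
Qed.

(** * Linearisation of the Schroedinger system at equal measures *)

Section second_order.
Variables (P : probability T R) (f g : T -> R).
Hypothesis sfg : schroedinger P P f g.

Local Notation xi := (gibbs f g).
Local Notation phi := (weight (fun x => (f x + g x) / 2)).

Let bf : bmeas f. Proof. by case: sfg. Qed.
Let bg : bmeas g. Proof. by case: sfg. Qed.

Let bxi : bmeas2 xi. Proof. exact: bmeas2_gibbs. Qed.

Let bxi1 x : bmeas (xi x). Proof. exact: bmeas_section1. Qed.

Let bxi2 y : bmeas (fun x => xi x y). Proof. exact: (bmeas_section2 y bxi). Qed.

Let bphi : bmeas phi. Proof. by apply: bmeas_weight; bm. Qed.

Lemma schroedinger_diag_shift : exists s, forall x, g x = f x - s.
Proof.
have [s [h _]] := schroedinger_unique x0 eps0 bc cL sfg (schroedinger_sym sfg).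
by exists s.
Qed.

(** For equal marginals [f] and [g] differ by a constant, so the two weights can be replaced by a
    common one; the symmetry of [xi] becomes visible. *)
Lemma xi_weight x y : xi x y = phi x * phi y * expi x y.
Proof.
have [s hs] := schroedinger_diag_shift.
rewrite gibbs_weight; congr (_ * _); rewrite !weightE -!expRD; congr expR.
by rewrite !hs; field; exact: lt0r_neq0.
Qed.

Lemma xi_sym x y : xi x y = xi y x.
Proof. by rewrite !xi_weight expiC [phi x * _]mulrC. Qed.

Let xi_ge0 x y : 0 <= xi x y. Proof. by rewrite gibbsE expR_ge0. Qed.

Let xi_int1 x : Ex P (xi x) = 1. Proof. exact: (schroedinger_gibbs1 eps0 bc cL x sfg). Qed.

Let xi_int2 y : Ex P (fun x => xi x y) = 1. Proof. exact: (schroedinger_gibbs2 eps0 bc cC cL y sfg). Qed.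

(** The operator [A_P] of the quadratic form, on bounded functions: a symmetric Markov operator that
    leaves [P] invariant. *)
Definition avg h y : R := Ex P (fun x => xi x y * h x).

Lemma bmeas_avg h : bmeas h -> bmeas (avg h).
Proof.
move=> bh; apply: (bmeas_Ex2 P (K := fun x y => xi x y * h x)).
by rewrite /bmeas2; apply: bmeasM => //; bm.
Qed.

Let bxih h y : bmeas h -> bmeas (fun x => xi x y * h x).
Proof. by move=> bh; apply: bmeasM. Qed.

Lemma avg_norm h (H : R) : bmeas h -> (forall x, `|h x| <= H) -> forall y, `|avg h y| <= H.
Proof.
move=> bh hH y.
have -> : H = Ex P (fun x => xi x y * H) by rewrite ExZr// xi_int2 mul1r.
have b1 := bxih y bh; have b2 : bmeas (fun x => xi x y * H) by apply: bmeasM => //; bm.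
rewrite ler_norml -ExN//; apply/andP; split; apply: le_Ex => //.
- by bm.
- move=> x; rewrite -mulrN ler_wpM2l//.
  by have := hH x; rewrite ler_norml => /andP[].
- by move=> x; rewrite ler_wpM2l// (le_trans (ler_norm _)).
Qed.

Lemma avgZ a h y : bmeas h -> avg (fun x => a * h x) y = a * avg h y.
Proof.
by move=> bh; rewrite /avg -ExZl; [apply: eq_Ex => x; rewrite mulrCA|exact: bxih].
Qed.

Lemma avgB h k y : bmeas h -> bmeas k -> avg (fun x => h x - k x) y = avg h y - avg k y.
Proof.
move=> bh bk; rewrite /avg -ExB; [|exact: bxih..].
by apply: eq_Ex => x; rewrite mulrBr.
Qed.

Lemma avg_cst a y : avg (fun=> a) y = a.
Proof. by rewrite /avg ExZr// xi_int2 mul1r. Qed.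

Lemma avg_sym h k : bmeas h -> bmeas k ->
  Ex P (fun y => avg h y * k y) = Ex P (fun x => h x * avg k x).
Proof.
move=> bh bk.
have b2 : bmeas2 (fun y x => xi x y * h x * k y).
  rewrite /bmeas2; apply: bmeasM; last by bm.
  by apply: bmeasM; [exact: (bmeas2_swap bxi)|bm].
transitivity (Ex P (fun y => Ex P (fun x => xi x y * h x * k y))).
  by apply: eq_Ex => y; rewrite ExZr//; exact: bxih.
rewrite Ex_fubini//; apply: eq_Ex => x; rewrite -ExZl; last exact: bxih.
by apply: eq_Ex => y; rewrite (xi_sym y x); ring.
Qed.

Lemma Ex_avg h : bmeas h -> Ex P (avg h) = Ex P h.
Proof.
move=> bh; have b1 : bmeas (fun _ : T => 1 : R) by bm.
have := avg_sym bh b1; under eq_Ex do rewrite mulr1.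
by move=> ->; apply: eq_Ex => x; rewrite avg_cst mulr1.
Qed.

Lemma xi_lower : exists2 k : R, 0 < k <= 1 & forall x y, k <= xi x y.
Proof.
have [M1 M10 hM1] := bmeas_bound bf; have [M2 M20 hM2] := bmeas_bound bg.
pose k := expR ((- M1 - M2 - L) / eps).
have hk x y : k <= xi x y.
  rewrite gibbsE ler_expR ler_pM2r ?invr_gt0//.
  have := hM1 x; have := hM2 y; have := cL x y; rewrite !ler_norml.
  by move=> /andP[_ ?] /andP[? _] /andP[? _]; lra.
exists k => //; rewrite expR_gt0/= -(xi_int1 x0).
by apply: Ex_ge => // y.
Qed.

(** Doeblin's argument: [xi - k] is still nonnegative and has mass [1 - k], while the part taken
    away contributes a constant. *)
Lemma avg_osc : exists2 k : R, 0 < k <= 1 &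
  forall h, bmeas h -> osc (avg h) <= (1 - k) * osc h.
Proof.
have [k k01 hk] := xi_lower; exists k => // h bh.
have [m hm] := osc_range x0 bh.
have split y : avg h y = k * Ex P h + Ex P (fun x => (xi x y - k) * h x).
  rewrite -ExZl// -ExD; [|by bm|by apply: bmeasM => //; bm].
  by apply: eq_Ex => x; ring.
have int y a : Ex P (fun x => (xi x y - k) * a) = (1 - k) * a.
  by rewrite ExZr; [rewrite ExB//; [rewrite xi_int2 Ex_cst|bm]|bm].
have lo y : (1 - k) * m <= Ex P (fun x => (xi x y - k) * h x).
  rewrite -(int y); apply: le_Ex; [by apply: bmeasM; bm|by apply: bmeasM; bm|] => x.
  by rewrite ler_wpM2l ?subr_ge0//; case/andP: (hm x).
have hi y : Ex P (fun x => (xi x y - k) * h x) <= (1 - k) * (m + osc h).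
  rewrite -(int y); apply: le_Ex; [by apply: bmeasM; bm|by apply: bmeasM; bm|] => x.
  by rewrite ler_wpM2l ?subr_ge0//; case/andP: (hm x).
apply: (osc_le x0) => x y; rewrite !split; have := lo y; have := hi x.
lra.
Qed.

(** With [A] for [avg], [w] is the image of [h] under the inverse of [1 - A ^ 2] on functions of
    mean zero. *)
Definition resolvent_eq h w :=
  [/\ bmeas w, Ex P w = 0 & forall y, w y - avg (avg w) y = h y].

(** The equation and the contraction give [osc w <= 2 H + (1 - k) osc w], and a function of mean
    zero is bounded by its oscillation. *)
Lemma resolvent_bound : exists2 C : R, 0 <= C & forall h w (H : R), bmeas h ->
  (forall x, `|h x| <= H) -> resolvent_eq h w -> forall x, `|w x| <= C * H.
Proof.
have [k /andP[k0 k1] hk] := avg_osc.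
exists (2 / k); first by rewrite divr_ge0// ltW.
move=> h w H bh hH [bw w0 hw] x.
have ba := bmeas_avg bw; have baa := bmeas_avg ba.
have o0 := osc_ge0 x0 bw.
have o1 : osc w <= 2 * H + (1 - k) * osc w.
  apply: (osc_le x0) => y z.
  have h1 : osc (avg (avg w)) <= (1 - k) * osc w.
    apply: (le_trans (hk _ ba)); apply: (le_trans (ler_wpM2l _ (hk _ bw))).
      by rewrite subr_ge0.
    by rewrite ler_wpM2l ?subr_ge0// ler_piMl// gerBl ltW.
  have h2 := le_trans (osc_ge y z baa) h1.
  have := hw y; have := hw z; have := hH y; have := hH z.
  by rewrite !ler_norml => /andP[? ?] /andP[? ?]; lra.
have o2 : osc w <= 2 / k * H by rewrite mulrAC ler_pdivlMr//; lra.
apply: le_trans o2.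
have bx : bmeas (fun _ : T => w x) by bm.
have e1 : w x = Ex P (fun y => w x - w y) by rewrite ExB// Ex_cst w0 subr0.
have e2 : - w x = Ex P (fun y => w y - w x) by rewrite ExB// Ex_cst w0 sub0r.
rewrite ler_norml lerNl {1}e2 {2}e1.
by apply/andP; split; (apply: Ex_le; [by bm|move=> y; exact: osc_ge]).
Qed.

(** The map [w |-> h + A (A w)] has a fixed point up to a constant. The constant is 0 because [A]
    preserves the mean and [h] has mean zero; subtracting the mean of [w] does not affect the
    equation. *)
Lemma resolvent_exists h : bmeas h -> Ex P h = 0 -> exists w, resolvent_eq h w.
Proof.
move=> bh h0; have [k /andP[k0 k1] hk] := avg_osc.
have q01 : 0 <= 1 - k < 1 by rewrite subr_ge0 k1 gtrBl.
have [||w bw wE] := @osc_contraction_fixpoint _ _ _ x0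
  (fun w y => h y + avg (avg w) y) _ q01.
- by move=> w bw; apply: bmeasD => //; do 2!apply: bmeas_avg.
- move=> v w bv bw.
  have bvw : bmeas (fun x => v x - w x) by bm.
  have bavw := bmeas_avg bvw.
  rewrite (_ : (fun x => _) = avg (avg (fun x => v x - w x))).
    apply: (le_trans (hk _ bavw)); rewrite ler_wpM2l//; first by case/andP: q01.
    apply: (le_trans (hk _ bvw)); rewrite ler_piMl//; first exact: (osc_ge0 x0).
    by rewrite gerBl ltW.
  apply/funext => x; rewrite (_ : avg (fun x => v x - w x) = (fun y => avg v y - avg w y)).
    by rewrite avgB; [ring|exact: bmeas_avg..].
  by apply/funext => y; rewrite avgB.
have {wE}[r wE] : exists r, forall y, h y + avg (avg w) y = w y + r by exists (h x0 + avg (avg w) x0).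
have baw := bmeas_avg bw; have baaw := bmeas_avg baw.
have r0 : r = 0.
  have : Ex P (fun y => h y + avg (avg w) y) = Ex P (fun y => w y + r).
    exact: eq_Ex.
  rewrite !ExD//; last by bm.
  rewrite Ex_cst h0 !Ex_avg// add0r.
  by move=> h1; apply: (addrI (Ex P w)); rewrite -h1 addr0.
pose e := Ex P w.
exists (fun x => w x - e); split.
- by bm.
- by rewrite ExB//; [rewrite Ex_cst subrr|bm].
- move=> y; rewrite (_ : avg (fun x => w x - e) = (fun y => avg w y - e)).
    rewrite avgB//; last by bm.
    by rewrite avg_cst; have := wE y; rewrite r0 addr0; lra.
  by apply/funext => z; rewrite avgB ?avg_cst//; bm.
Qed.

Definition dif mu h : R := Ex mu h - Ex P h.
(** The function [i_xi (mu - P)]; it is also the residual of the population pair in a marginal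
    equation of [mu]. *)
Definition pot mu y : R := dif mu (fun x => xi x y).

Lemma blf_dif mu : blf (dif mu). Proof. exact: blf_diff. Qed.

Lemma potE mu y : pot mu y = Ex mu (fun x => xi x y) - 1.
Proof. by rewrite /pot /dif xi_int2. Qed.

Lemma bmeas_pot mu : bmeas (pot mu).
Proof. exact: (blf_meas (blf_dif mu) bxi). Qed.

Lemma Ex_pot mu : Ex P (pot mu) = 0.
Proof.
have b := bmeas_Ex2 mu bxi.
rewrite (eq_Ex _ (potE mu)) ExB//; last by bm.
by rewrite Ex_cst -Ex_fubini// (eq_Ex mu (g := fun=> 1)) ?Ex_cst ?subrr.
Qed.

Lemma dif_avg mu h : bmeas h -> dif mu (avg h) = Ex P (fun x => h x * pot mu x).
Proof.
move=> bh; have b := bmeas_Ex2 mu bxi.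
have bK : bmeas2 (fun x y => xi x y * h x) by rewrite /bmeas2; apply: bmeasM => //; bm.
rewrite /dif Ex_avg// -Ex_fubini// -ExB//; last exact: (bmeas_Ex1 mu bK).
apply: eq_Ex => x; rewrite ExZr// potE.
by rewrite (eq_Ex mu (fun y => xi_sym x y)); ring.
Qed.

Lemma dif_pot mu nu : dif mu (pot nu) = dif nu (pot mu).
Proof.
have b := bmeas_Ex2 mu bxi; have b' := bmeas_Ex2 nu bxi.
have E k l : Ex k (pot l) = Ex k (fun y => Ex l (fun x => xi x y)) - 1.
  by rewrite (eq_Ex _ (potE l)) ExB ?Ex_cst//; [exact: bmeas_Ex2|bm].
rewrite /dif !Ex_pot !E !subr0; congr (_ - _).
rewrite -Ex_fubini//; apply: eq_Ex => x; apply: eq_Ex => y; exact: xi_sym.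
Qed.

(** The squared weight is there for the products of a kernel integral with a weighted monomial in
    [mult_moment]. *)
Definition tests mu N := moments phi (dif mu) N /\ moments (fun x => phi x * phi x) (dif mu) N.

Section bounds.
Variable M : R.
Hypothesis hM : forall x, `|phi x| <= M.

Let M0 : 0 <= M. Proof. exact: le_trans (normr_ge0 _) (hM x0). Qed.

Let kbx L1 L2 (N s : R) : blf L1 -> blf L2 -> moments phi L2 N ->
  (forall j (t : {ffun 'I_j -> 'I_d}), theta ^+ j * `|L1 (fun y => phi y * monom t y)| <= s) ->
  `|L1 (fun y => L2 (fun x => xi x y))| <= K0 * N * s.
Proof.
move=> b1 b2 m2 hs; have := kb b1 b2 bphi bphi m2 hs.
suff -> : (fun y => L2 (fun x => xi x y)) =
  (fun y => L2 (fun x => phi x * phi y * expi x y)) by [].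
by apply/funext => y; apply: blf_eq => x; exact: xi_weight.
Qed.

(** Both summands are integrals of [xi], against [mu - P] and against [P] with density [h], and
    [kernel_bound] applies to each. *)
Lemma pair_bound L1 mu (N H s : R) h : blf L1 -> moments phi (dif mu) N -> bmeas h ->
  (forall x, `|h x| <= H) ->
  (forall j (t : {ffun 'I_j -> 'I_d}), theta ^+ j * `|L1 (fun y => phi y * monom t y)| <= s) ->
  `|L1 (fun y => pot mu y + avg h y)| <= K0 * (N + 2 * (H * M)) * s.
Proof.
move=> b1 mN bh hH hs.
rewrite blfD//; [|exact: bmeas_pot|exact: bmeas_avg].
rewrite mulrDr mulrDl; apply: (le_trans (ler_normD _ _)); apply: lerD.
  by apply: kbx => //; exact: blf_dif.
have := kbx b1 (blf_weight (blf_Ex P) bh) (moments_Ex_weight P bh bphi hH hM) hs.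
suff -> : (fun y => Ex P (fun x => h x * xi x y)) = avg h by [].
by apply/funext => y; apply: eq_Ex => x; rewrite mulrC.
Qed.

Lemma pot_bound mu (N : R) : moments phi (dif mu) N ->
  forall x, `|pot mu x| <= K0 * (2 * M) * N.
Proof.
move=> mN x; have -> : K0 * (2 * M) * N = K0 * N * (2 * M) by ring.
apply: (kbx (blf_eval x)) => //; first exact: blf_dif.
by move=> j t; exact: eval_term.
Qed.

(** Expanding the kernel inside [L2] leaves [dif mu] on products of two weighted monomials. What
    [moments_mul] loses there is returned by the factor [theta ^+ j]. *)
Lemma mult_moment L2 mu (N' N : R) j (t : {ffun 'I_j -> 'I_d}) : blf L2 ->
  moments phi L2 N' -> moments (fun x => phi x * phi x) (dif mu) N ->
  theta ^+ j * `|dif mu (fun y => L2 (fun x => xi x y) * (phi y * monom t y))| <= K0 * N' * N.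
Proof.
move=> b2 m2 mN.
have bt := bmeas_monom bX t.
have bw : bmeas (fun y => phi y * monom t y) by apply: bmeasM.
have tj : 0 < theta ^+ j by rewrite exprn_gt0.
have -> : K0 * N' * N = theta ^+ j * (K0 * N' * (N / theta ^+ j)).
  by field; exact: lt0r_neq0.
rewrite ler_pM2l//.
have := kbx (blf_weight (blf_dif mu) bw) b2 m2.
move=> /(_ (N / theta ^+ j)) h.
rewrite (_ : (fun y => L2 (fun x => xi x y) * (phi y * monom t y)) =
  (fun y => phi y * monom t y * L2 (fun x => xi x y))); last first.
  by apply/funext => y; rewrite mulrC.
apply: h => k t'.
exact: (@moments_mul _ _ _ _ X theta th0 phi (dif mu) N j k t t' mN).
Qed.

(** The Newton step. The linearised system [u + A v = - eps pot nu], [v + A u = - eps pot mu] is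
    solved by [u = du wa wb] and [v = du wb wa], where [wa] and [wb] are the resolvents of [pot mu]
    and [pot nu]. *)
Definition du wa wb x : R := - eps * (wb x - avg wa x).

Variable C : R.
Hypothesis hC : forall h w (H : R), bmeas h ->
  (forall x, `|h x| <= H) -> resolvent_eq h w -> forall x, `|w x| <= C * H.

(** [c1 N] bounds the kernel potentials and [C c1 N] their resolvents; [cc N] is the factor in
    [pair_bound] for a density of size [2 C c1 N]. *)
Let c1 := K0 * (2 * M).
Let cc := K0 * (1 + 2 * (2 * (C * c1) * M)).

(** By the resolvent equation [u = - eps (pot nu + A (A wb - wa))] is again a kernel integral, and
    likewise [v]. Through [pair_bound], a deviation applied to such a function gains a further power
    of [N], which its sup norm would not give. *)
Lemma side_bounds mu nu (N : R) wa wb : tests mu N -> tests nu N ->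
  resolvent_eq (pot mu) wa -> resolvent_eq (pot nu) wb ->
  let u := du wa wb in let v := du wb wa in
  [/\ forall x, `|u x| <= eps * (2 * (C * c1)) * N,
      forall x, `|dif nu (fun y => xi x y * v y)| <= eps * cc * c1 * N ^+ 2,
      `|dif mu (fun y => pot nu y * u y)| <= eps * cc * K0 * N ^+ 3 &
      forall x, Ex nu (fun y => xi x y * ((u x + v y) / eps)) =
        - pot nu x + (u x * pot nu x + dif nu (fun y => xi x y * v y)) / eps].
Proof.
move=> [ma ma2] [mb mb2] ra rb u v.
have [bwa wa0 wae] := ra; have [bwb wb0 wbe] := rb.
have N0 : 0 <= N := moments_ge0 ma.
have ba := bmeas_pot mu; have bb := bmeas_pot nu.
have bAa := bmeas_avg bwa; have bAb := bmeas_avg bwb.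
have wab x : `|wa x| <= C * c1 * N.
  by rewrite -mulrA; apply: (hC ba _ ra) => y; exact: pot_bound.
have wbb x : `|wb x| <= C * c1 * N.
  by rewrite -mulrA; apply: (hC bb _ rb) => y; exact: pot_bound.
have hu : u = (fun x => - eps * (pot nu x + avg (fun z => avg wb z - wa z) x)).
  by apply/funext => x; rewrite /u /du avgB// -wbe; ring.
have hv : v = (fun x => - eps * (pot mu x + avg (fun z => avg wa z - wb z) x)).
  by apply/funext => x; rewrite /v /du avgB// -wae; ring.
have bu : bmeas u by rewrite /u /du; bm.
have bv : bmeas v by rewrite /v /du; bm.
have H1 x : `|avg wb x - wa x| <= 2 * (C * c1 * N).
  rewrite mulr2n mulrDl !mul1r (le_trans (ler_normB _ _))// lerD//.
  exact: avg_norm.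
have H2 x : `|avg wa x - wb x| <= 2 * (C * c1 * N).
  rewrite mulr2n mulrDl !mul1r (le_trans (ler_normB _ _))// lerD//.
  exact: avg_norm.
have b1 : bmeas (fun z => avg wb z - wa z) by bm.
have b2 : bmeas (fun z => avg wa z - wb z) by bm.
have bs1 : bmeas (fun x => pot nu x + avg (fun z => avg wb z - wa z) x).
  by apply: bmeasD => //; exact: bmeas_avg.
have bs2 : bmeas (fun x => pot mu x + avg (fun z => avg wa z - wb z) x).
  by apply: bmeasD => //; exact: bmeas_avg.
split.
- move=> x; rewrite /u /du normrM normrN (gtr0_norm eps0).
  have -> : eps * (2 * (C * c1)) * N = eps * (C * c1 * N + C * c1 * N) by ring.
  rewrite ler_pM2l// (le_trans (ler_normB _ _))// lerD//; exact: avg_norm.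
- move=> x; rewrite hv.
  have L1 := blf_weight (blf_dif nu) (bxi1 x).
  have := blfZ (- eps) L1 bs2 => /= ->; rewrite normrM normrN (gtr0_norm eps0).
  have -> : eps * cc * c1 * N ^+ 2 =
    eps * (K0 * (N + 2 * (2 * (C * c1 * N) * M)) * (K0 * (2 * M) * N)).
    by rewrite /cc /c1; ring.
  rewrite ler_pM2l//; apply: (pair_bound L1 ma b2 H2) => j t.
  have := mult_moment t (blf_eval x) (moments_eval x bphi hM) mb2.
  exact.
- rewrite hu.
  have L1 := blf_weight (blf_dif mu) bb.
  have := blfZ (- eps) L1 bs1 => /= ->; rewrite normrM normrN (gtr0_norm eps0).
  have -> : eps * cc * K0 * N ^+ 3 =
    eps * (K0 * (N + 2 * (2 * (C * c1 * N) * M)) * (K0 * N * N)).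
    by rewrite /cc /c1; ring.
  rewrite ler_pM2l//; apply: (pair_bound L1 mb b1 H1) => j t.
  exact: (mult_moment t (blf_dif nu) mb ma2).
- move=> x.
  have bxv : bmeas (fun y => xi x y * v y) by apply: bmeasM.
  have e1 : Ex nu (xi x) = 1 + pot nu x.
    by rewrite potE (eq_Ex nu (fun y => xi_sym x y)); ring.
  have e2 : Ex P (fun y => xi x y * v y) = avg v x.
    by rewrite /avg; apply: eq_Ex => y; rewrite xi_sym.
  have -> : Ex nu (fun y => xi x y * ((u x + v y) / eps)) =
      (u x * Ex nu (xi x) + Ex nu (fun y => xi x y * v y)) / eps.
    rewrite -[u x * _]ExZl// -ExD//; last by apply: bmeasM => //; bm.
    rewrite -ExZr; last by apply: bmeasD => //; apply: bmeasM => //; bm.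
    by apply: eq_Ex => y; ring.
  have -> : Ex nu (fun y => xi x y * v y) = dif nu (fun y => xi x y * v y) + avg v x.
    by rewrite /dif e2; ring.
  (* The Newton equation; it cancels the first-order part of the residual. *)
  have -> : avg v x = - eps * pot nu x - u x.
    have -> : avg v x = - eps * (avg wa x - avg (avg wb) x).
      by rewrite -avgB// -avgZ//; bm.
    by rewrite /u /du -wbe; ring.
  by rewrite e1; field; exact: lt0r_neq0.
Qed.

End bounds.

Ltac nonneg := repeat first
  [ assumption | exact: ler0n | exact: ler01 | exact: expR_ge0
  | apply: mulr_ge0 | apply: addr_ge0 | apply: exprn_ge0
  | (rewrite invr_ge0) | (apply: ltW; assumption) ].

Let ExxiE mu x : Ex mu (xi x) = 1 + pot mu x.
Proof. by rewrite potE (eq_Ex mu (fun y => xi_sym x y)); ring. Qed.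

(* First-order optimality of the dual at [(f + u, g + v)], up to [N ^ 2]. *)
Let residual nu u v x (b r U c1 cR Mx Tt N : R) : bmeas v -> 0 <= N -> 0 <= U -> 0 <= Mx ->
  (forall x y, `|xi x y| <= Mx) -> Tt * N <= 1 ->
  (forall y, `|(u x + v y) / eps| <= Tt * N) ->
  Ex nu (fun y => xi x y * ((u x + v y) / eps)) = - b + (u x * b + r) / eps ->
  Ex nu (xi x) = 1 + b -> `|u x| <= U * N -> `|b| <= c1 * N -> `|r| <= cR * N ^+ 2 ->
  `|1 - Ex nu (fun y => xi x y * expR ((u x + v y) / eps))| <=
    ((U * c1 + cR) / eps + Mx * (expR 1 + 1) * Tt ^+ 2) * N ^+ 2.
Proof.
move=> bv N0 U0 Mx0 hMx T1 ht E1 E0 hu hb hr.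
have bt : bmeas (fun y => (u x + v y) / eps) by bm.
set t := fun y => (u x + v y) / eps in bt.
have bx := bxi1 x.
have b3 : bmeas (fun y => xi x y * (expR (t y) - (1 + t y))) by bm.
have -> : Ex nu (fun y => xi x y * expR ((u x + v y) / eps)) =
    Ex nu (xi x) + Ex nu (fun y => xi x y * t y) + Ex nu (fun y => xi x y * (expR (t y) - (1 + t y))).
  rewrite -ExD//; last by bm.
  rewrite -ExD//; last by bm.
  by apply: eq_Ex => y; rewrite -/(t y); ring.
rewrite E1 E0.
have -> : 1 - (1 + b + (- b + (u x * b + r) / eps) + Ex nu (fun y => xi x y * (expR (t y) - (1 + t y)))) =
  - ((u x * b + r) / eps + Ex nu (fun y => xi x y * (expR (t y) - (1 + t y)))) by ring.
rewrite normrN (le_trans (ler_normD _ _))// [X in _ <= X]mulrDl lerD//.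
  rewrite normrM (ger0_norm (x := eps^-1)) ?invr_ge0 ?(ltW eps0)// mulrAC.
  rewrite ler_pM2r ?invr_gt0// mulrDl (le_trans (ler_normD _ _))// lerD//.
  by rewrite normrM; have -> : U * c1 * N ^+ 2 = (U * N) * (c1 * N) by [ring]; rewrite ler_pM.
apply: Ex_norm_le => // y.
have -> : Mx * (expR 1 + 1) * Tt ^+ 2 * N ^+ 2 = Mx * ((expR 1 + 1) * (Tt * N) ^+ 2) by ring.
rewrite normrM ler_pM//.
apply: (le_trans (expR_taylor2 (le_trans (ht y) T1))).
rewrite ler_wpM2l ?addr_ge0 ?expR_ge0// lerXn2r ?nnegrE//.
exact: le_trans (ht y).
Qed.

Let split_sum mu nu k u v : bmeas2 k -> bmeas u -> bmeas v ->
  eps * Ex mu (fun x => Ex nu (fun y => k x y * ((u x + v y) / eps))) =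
  Ex mu (fun x => u x * Ex nu (k x)) + Ex nu (fun y => v y * Ex mu (fun x => k x y)).
Proof.
move=> bk bu bv.
have b1 x : bmeas (k x) by exact: bmeas_section1.
have b2 y : bmeas (fun x => k x y) by exact: (bmeas_section2 y bk).
have bK : bmeas2 (fun x y => v y * k x y) by rewrite /bmeas2; apply: bmeasM => //; bm.
have b3 := bmeas_Ex1 nu bk; have b4 := bmeas_Ex2 mu bk; have b5 := bmeas_Ex1 nu bK.
have -> : Ex nu (fun y => v y * Ex mu (fun x => k x y)) =
    Ex mu (fun x => Ex nu (fun y => v y * k x y)).
  by rewrite Ex_fubini//; apply: eq_Ex => y; rewrite ExZl.
rewrite -ExD//; last by bm.
rewrite -ExZl; last first.
  by apply: (bmeas_Ex1 nu (K := fun x y => k x y * ((u x + v y) / eps))); rewrite /bmeas2; bm.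
apply: eq_Ex => x; rewrite -ExZl; last by bm.
rewrite -[u x * _]ExZl// -ExD//; [|by bm|by bm].
by apply: eq_Ex => y; field; exact: lt0r_neq0.
Qed.

(** The residuals at [(f + u, g + v)] are [O(N ^ 2)], so by [dual_gap] the dual value there is
    optimal up to [O(N ^ 4)]. In that value the terms linear in [(u, v)] give
    [- mu (u pot nu) - nu (v pot mu)], the quadratic ones give back one half of it by the Newton
    equations, and replacing [mu] and [nu] by [P] in the rest costs [O(N ^ 3)]. *)
Lemma second_order :
  exists K r0, [/\ 0 <= K, 0 < r0 & forall mu nu f1 g1 (N : R) wa wb, 0 <= N <= r0 ->
    schroedinger mu nu f1 g1 -> tests mu N -> tests nu N ->
    resolvent_eq (pot mu) wa -> resolvent_eq (pot nu) wb ->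
    `|Ex mu f1 + Ex nu g1 - (Ex mu f + Ex nu g - eps * dif mu (pot nu)
       - 2^-1 * (Ex P (fun x => pot nu x * du wa wb x) +
                 Ex P (fun y => pot mu y * du wb wa y)))| <= K * N ^+ 3].
Proof.
have [M M0 hM] := bmeas_bound bphi.
have [C C0 hC] := resolvent_bound.
have [Mx Mx0 hMx] := bmeas2_bound bxi.
have K00 : 0 <= K0 := bb_const_ge0 _ _.
pose c1 := K0 * (2 * M); pose cc := K0 * (1 + 2 * (2 * (C * c1) * M)).
have c10 : 0 <= c1 by rewrite /c1; nonneg.
have cc0 : 0 <= cc by rewrite /cc; nonneg.
(* [U N] bounds [u] and [v], [cR N ^ 2] the deviations of [xi v] and [xi u], and [Tt N] the exponent
   [(u + v) / eps]. *)
pose U := eps * (2 * (C * c1)); pose cR := eps * cc * c1; pose Tt := 2 * U / eps.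
have U0 : 0 <= U by rewrite /U; nonneg.
have cR0 : 0 <= cR by rewrite /cR; nonneg.
have Tt0 : 0 <= Tt by rewrite /Tt; nonneg.
pose cr := (U * c1 + cR) / eps + Mx * (expR 1 + 1) * Tt ^+ 2.
have cr0 : 0 <= cr by rewrite /cr; nonneg.
have k0 := doeblin_gt0 eps L.
pose G := (8 / doeblin eps L + 1) * (2 * eps) * cr ^+ 2.
have G0 : 0 <= G by rewrite /G; nonneg.
pose c3 := eps * cc * K0; pose E4 := eps * (Mx * (expR 1 * Tt ^+ 3)).
have E40 : 0 <= E4 by rewrite /E4; nonneg.
have c30 : 0 <= c3 by rewrite /c3; nonneg.
pose E5 := U * (U * c1 + cR) / eps.
have E50 : 0 <= E5 by rewrite /E5; nonneg.
(* The four sources of error: the duality gap, the Taylor remainder, the quadratic residuals paired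
   with [u] and [v], and the passage from [mu], [nu] to [P]. The radius [1 / D] ensures [N <= 1],
   [Tt N <= 1] and [cr N ^ 2 <= 1/2]. *)
exists (G + E4 + E5 + c3); pose D := 1 + Tt + 2 * cr.
have D0 : 0 < D by rewrite /D; move: Tt0 cr0; lra.
exists D^-1; split; [by rewrite !addr_ge0|by rewrite invr_gt0|].
move=> mu nu f1 g1 N wa wb /andP[N0 Nr] s1 tm tn ra rb.
have ND : N * D <= 1 by rewrite -ler_pdivlMr// mul1r.
have N1 : N <= 1.
  by apply: le_trans ND; rewrite ler_peMr// /D -addrA lerDl addr_ge0// mulr_ge0.
have TN : Tt * N <= 1.
  by apply: le_trans ND; rewrite mulrC ler_wpM2l// /D; have := cr0; lra.
have crN : 0 <= cr * N ^+ 2 <= 1 / 2.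
  rewrite mulr_ge0 ?exprn_ge0//= expr2.
  have h1 : N * (2 * cr) <= N * D by rewrite ler_wpM2l// /D; lra.
  have h2 : cr * (N * N) <= cr * N.
    by rewrite ler_wpM2l// ler_piMr.
  by have := le_trans h1 ND; lra.
have sd1 := side_bounds hM hC tm tn ra rb.
have sd2 := side_bounds hM hC tn tm rb ra.
move: sd1 sd2; set u := du wa wb; set v := du wb wa => /=.
rewrite -/c1 -/cc -/U -/cR => -[hu hR1 hc1 hq1] [hv hR2 hc2 hq2].
have [bwa _ _] := ra; have [bwb _ _] := rb.
have bAa := bmeas_avg bwa; have bAb := bmeas_avg bwb.
have bu : bmeas u by rewrite /u /du; bm.
have bv : bmeas v by rewrite /v /du; bm.
have bpa := bmeas_pot mu; have bpb := bmeas_pot nu.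
have pa : forall x, `|pot mu x| <= c1 * N by case: tm => m1 _; exact: (pot_bound hM m1).
have pb : forall x, `|pot nu x| <= c1 * N by case: tn => m1 _; exact: (pot_bound hM m1).
have ht x y : `|(u x + v y) / eps| <= Tt * N.
  rewrite normrM (ger0_norm (x := eps^-1)) ?invr_ge0 ?(ltW eps0)// /Tt mulrAC.
  rewrite ler_pM2r ?invr_gt0// (le_trans (ler_normD _ _))//.
  by have -> : 2 * U * N = U * N + U * N by [ring]; rewrite lerD.
have gE x y : gibbs (fun x => f x + u x) (fun y => g y + v y) x y = xi x y * expR ((u x + v y) / eps).
  by rewrite !gibbsE -expRD; congr expR; ring.
have bfu : bmeas (fun x => f x + u x) by bm.
have bgv : bmeas (fun x => g x + v x) by bm.
have res1 x : `|1 - Ex nu (gibbs (fun x => f x + u x) (fun y => g y + v y) x)| <= cr * N ^+ 2.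
  rewrite (eq_Ex nu (gE x)).
  exact: (residual bv N0 U0 Mx0 hMx TN (ht x) (hq1 x) (ExxiE nu x) (hu x) (pb x) (hR1 x)).
have res2 y : `|1 - Ex mu (fun x => gibbs (fun x => f x + u x) (fun y => g y + v y) x y)| <= cr * N ^+ 2.
  rewrite (eq_Ex mu (fun x => gE x y)).
  have -> : (fun x => xi x y * expR ((u x + v y) / eps)) = (fun x => xi y x * expR ((v y + u x) / eps)).
    by apply/funext => x; rewrite xi_sym [u x + _]addrC.
  have ht' x : `|(v y + u x) / eps| <= Tt * N by rewrite addrC.
  exact: (residual bu N0 U0 Mx0 hMx TN ht' (hq2 y) (ExxiE mu y) (hv y) (pa y) (hR2 y)).
have gap := dual_gap x0 eps0 bc cC cL crN s1 bfu bgv res1 res2.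
pose t x y := (u x + v y) / eps.
have bt : bmeas2 t by rewrite /bmeas2 /t; bm.
pose rm x y := expR (t x y) - (1 + t x y + t x y ^+ 2 / 2).
have brm : bmeas2 rm by rewrite /bmeas2 /rm; bm.
have bxt : bmeas2 (fun x y => xi x y * t x y) by rewrite /bmeas2; bm.
have bxtt : bmeas2 (fun x y => xi x y * t x y * t x y) by rewrite /bmeas2; bm.
have bxr : bmeas2 (fun x y => xi x y * rm x y) by rewrite /bmeas2; bm.
have dec : Ex mu (fun x => Ex nu (gibbs (fun x => f x + u x) (fun y => g y + v y) x)) =
   Ex mu (fun x => Ex nu (xi x)) + Ex mu (fun x => Ex nu (fun y => xi x y * t x y)) +
   2^-1 * Ex mu (fun x => Ex nu (fun y => xi x y * t x y * t x y)) +
   Ex mu (fun x => Ex nu (fun y => xi x y * rm x y)).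
  have b1 := bmeas_Ex1 nu bxi; have b2 := bmeas_Ex1 nu bxt.
  have b3 := bmeas_Ex1 nu bxtt; have b4 := bmeas_Ex1 nu bxr.
  rewrite -[2^-1 * _]ExZl// -[X in X + _ + _]ExD//.
  rewrite -[X in X + _]ExD; [|by bm|by bm]; rewrite -ExD; [|by bm|by bm].
  apply: eq_Ex => x.
  have c1x := bmeas_section1 x bxt; have c2x := bmeas_section1 x bxtt.
  have c3x := bmeas_section1 x bxr; have c4x := bxi1 x.
  rewrite -[2^-1 * _]ExZl// -[X in X + _ + _]ExD//.
  rewrite -[X in X + _]ExD; [|by bm|by bm]; rewrite -ExD; [|by bm|by bm].
  by apply: eq_Ex => y; rewrite gE /rm -/(t x y); ring.
have e1 : Ex mu (fun x => Ex nu (xi x)) = 1 + dif mu (pot nu).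
  rewrite (eq_Ex mu (fun x => ExxiE nu x)) ExD//; last by bm.
  by rewrite Ex_cst /dif Ex_pot subr0.
have e2 := split_sum mu nu bxi bu bv.
have e3 := split_sum mu nu bxt bu bv.
have e2a : Ex mu (fun x => u x * Ex nu (xi x)) = Ex mu u + Ex mu (fun x => u x * pot nu x).
  by rewrite -ExD//; [apply: eq_Ex => x; rewrite ExxiE; ring|bm].
have e2b : Ex nu (fun y => v y * Ex mu (fun x => xi x y)) = Ex nu v + Ex nu (fun x => v x * pot mu x).
  by rewrite -ExD//; [apply: eq_Ex => y; rewrite potE; ring|bm].
pose q1 x := u x * (u x * pot nu x + dif nu (fun y => xi x y * v y)).
pose q2 y := v y * (v y * pot mu y + dif mu (fun x => xi y x * u x)).
have bd1 : bmeas (fun x => dif nu (fun y => xi x y * v y)).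
  apply: (blf_meas (blf_dif nu) (K := fun y x => xi x y * v y)).
  by rewrite /bmeas2; apply: bmeasM; [exact: (bmeas2_swap bxi)|bm].
have bd2 : bmeas (fun y => dif mu (fun x => xi y x * u x)).
  apply: (blf_meas (blf_dif mu) (K := fun x y => xi y x * u x)).
  by rewrite /bmeas2; apply: bmeasM; [exact: (bmeas2_swap bxi)|bm].
have bq1 : bmeas q1 by rewrite /q1; bm.
have bq2 : bmeas q2 by rewrite /q2; bm.
have e3a : Ex mu (fun x => u x * Ex nu (fun y => xi x y * t x y)) =
    - Ex mu (fun x => u x * pot nu x) + Ex mu q1 / eps.
  rewrite -ExN; last by bm.
  rewrite -ExZr// -ExD; [|by bm|by bm].
  by apply: eq_Ex => x; rewrite /t hq1 /q1; ring.
have e3b : Ex nu (fun y => v y * Ex mu (fun x => xi x y * t x y)) =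
    - Ex nu (fun x => v x * pot mu x) + Ex nu q2 / eps.
  rewrite -ExN; last by bm.
  rewrite -ExZr// -ExD; [|by bm|by bm].
  apply: eq_Ex => y; have -> : (fun x => xi x y * t x y) = (fun x => xi y x * ((v y + u x) / eps)).
    by apply/funext => x; rewrite xi_sym /t [u x + _]addrC.
  by rewrite hq2 /q2; ring.
have nq1 : `|Ex mu q1| / eps <= E5 * N ^+ 3.
  have -> : E5 * N ^+ 3 = U * N * ((U * c1 + cR) * N ^+ 2) / eps by rewrite /E5; ring.
  rewrite ler_pM2r ?invr_gt0//; apply: Ex_norm_le => // x.
  rewrite /q1 normrM ler_pM// (le_trans (ler_normD _ _))// [X in _ <= X]mulrDl lerD//.
  have -> : U * c1 * N ^+ 2 = (U * N) * (c1 * N) by ring.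
  by rewrite normrM ler_pM.
have nq2 : `|Ex nu q2| / eps <= E5 * N ^+ 3.
  have -> : E5 * N ^+ 3 = U * N * ((U * c1 + cR) * N ^+ 2) / eps by rewrite /E5; ring.
  rewrite ler_pM2r ?invr_gt0//; apply: Ex_norm_le => // x.
  rewrite /q2 normrM ler_pM// (le_trans (ler_normD _ _))// [X in _ <= X]mulrDl lerD//.
  have -> : U * c1 * N ^+ 2 = (U * N) * (c1 * N) by ring.
  by rewrite normrM ler_pM.
have nr : `|eps * Ex mu (fun x => Ex nu (fun y => xi x y * rm x y))| <= E4 * N ^+ 3.
  rewrite normrM (gtr0_norm eps0).
  have -> : E4 * N ^+ 3 = eps * (Mx * (expR 1 * (Tt * N) ^+ 3)) by rewrite /E4; ring.
  rewrite ler_pM2l//; apply: Ex_norm_le; first exact: (bmeas_Ex1 nu bxr).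
  move=> x; apply: Ex_norm_le; first exact: (bmeas_section1 x bxr).
  move=> y; rewrite normrM ler_pM//.
  apply: (le_trans (expR_taylor3 (le_trans (ht x y) TN))).
  rewrite ler_wpM2l ?expR_ge0// lerXn2r ?nnegrE//; exact: le_trans (ht x y).
have gN : (8 / doeblin eps L + 1) * (2 * eps) * (cr * N ^+ 2) ^+ 2 <= G * N ^+ 3.
  have -> : (8 / doeblin eps L + 1) * (2 * eps) * (cr * N ^+ 2) ^+ 2 = G * N ^+ 3 * N.
    by rewrite /G; ring.
  by rewrite ler_piMr// mulr_ge0// exprn_ge0.
have d1E : dif mu (fun y => pot nu y * u y) =
    Ex mu (fun x => u x * pot nu x) - Ex P (fun x => pot nu x * u x).
  by rewrite /dif; congr (_ - _); apply: eq_Ex => x; rewrite mulrC.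
have d2E : dif nu (fun y => pot mu y * v y) =
    Ex nu (fun x => v x * pot mu x) - Ex P (fun x => pot mu x * v x).
  by rewrite /dif; congr (_ - _); apply: eq_Ex => x; rewrite mulrC.
move: gap hc1 hc2; rewrite -/c3 d1E d2E /dual ExD// ExD// dec e1 => gap hc1 hc2.
have {e2} := e2; have {e3} := e3; rewrite e2a e2b e3a e3b.
move: gap hc1 hc2 gN nr.
have nq1' : `|Ex mu q1 / eps| <= E5 * N ^+ 3.
  by rewrite normrM (ger0_norm (x := eps^-1)) ?invr_ge0 ?(ltW eps0).
have nq2' : `|Ex nu q2 / eps| <= E5 * N ^+ 3.
  by rewrite normrM (ger0_norm (x := eps^-1)) ?invr_ge0 ?(ltW eps0).
move: nq1' nq2'.
move: (Ex mu q1 / eps) (Ex nu q2 / eps) => z1 z2.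
have -> : Ex mu (fun x => Ex nu (fun y => xi x y * ((u x + v y) / eps))) =
  Ex mu (fun x => Ex nu (fun y => xi x y * t x y)) by [].
have -> : Ex mu (fun x => Ex nu (fun y => xi x y * t x y * ((u x + v y) / eps))) =
  Ex mu (fun x => Ex nu (fun y => xi x y * t x y * t x y)) by [].
generalize (Ex mu (fun x => Ex nu (fun y => xi x y * t x y)))
  (Ex mu (fun x => Ex nu (fun y => xi x y * t x y * t x y)))
  (Ex mu (fun x => Ex nu (fun y => xi x y * rm x y)))
  (Ex mu (fun x => u x * pot nu x)) (Ex nu (fun x => v x * pot mu x))
  (Ex P (fun x => pot nu x * u x)) (Ex P (fun x => pot mu x * v x))
  (Ex mu f1) (Ex nu g1) (Ex mu f) (Ex nu g) (Ex mu u) (Ex nu v) (dif mu (pot nu)).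
generalize ((8 / doeblin eps L + 1) * (2 * eps) * (cr * N ^+ 2) ^+ 2).
have -> : (G + E4 + E5 + c3) * N ^+ 3 = G * N ^+ 3 + E4 * N ^+ 3 + E5 * N ^+ 3 + c3 * N ^+ 3 by ring.
have nn : 0 <= N ^+ 3 by rewrite exprn_ge0.
have := mulr_ge0 G0 nn; have := mulr_ge0 E40 nn; have := mulr_ge0 E50 nn; have := mulr_ge0 c30 nn.
generalize (G * N ^+ 3) (E4 * N ^+ 3) (E5 * N ^+ 3) (c3 * N ^+ 3).
move=> w1 w2 w3 w4 p4 p3 p2 p1 gg s2 s3 s4 ub va Pub Pva a1 a2 a3 a4 a5 a6 al.
rewrite !ler_norml.
move=> /andP[h1 h2] /andP[h3 h4] /andP[h5 h6] /andP[h7 h8] /andP[h9 h10] h11 /andP[h12 h13] h14 h15.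
apply/andP; split; lra.
Qed.

(** Each of the three costs is expanded by [second_order]. The values of [f] and [g] cancel because
    these differ by a constant, and the products of [wa] with [pot mu] and of [wb] with [pot nu]
    cancel between the mixed and the diagonal costs. What remains is regrouped by [dE] into
    [mu - nu] applied to [wa - wb]. *)
Lemma divergence_expansion :
  exists K r0, [/\ 0 <= K, 0 < r0 & forall mu nu f1 g1 f2 g2 f3 g3 (N : R) w, 0 <= N <= r0 ->
    schroedinger mu nu f1 g1 -> schroedinger mu mu f2 g2 -> schroedinger nu nu f3 g3 ->
    tests mu N -> tests nu N -> resolvent_eq (fun y => pot mu y - pot nu y) w ->
    `|Ex mu f1 + Ex nu g1 - 2^-1 * ((Ex mu f2 + Ex mu g2) + (Ex nu f3 + Ex nu g3))
      - eps / 2 * (Ex mu w - Ex nu w)| <= K * N ^+ 3].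
Proof.
have [K [r0 [K1 r00 h]]] := second_order.
exists (2 * K), r0; split=> //; first by rewrite mulr_ge0.
move=> mu nu f1 g1 f2 g2 f3 g3 N w N0 s1 s2 s3 tm tn rw.
have bpa := bmeas_pot mu; have bpb := bmeas_pot nu.
have [wa ra] := resolvent_exists bpa (Ex_pot mu).
have [wb rb] := resolvent_exists bpb (Ex_pot nu).
have H1 := h _ _ _ _ _ _ _ N0 s1 tm tn ra rb.
have H2 := h _ _ _ _ _ _ _ N0 s2 tm tm ra ra.
have H3 := h _ _ _ _ _ _ _ N0 s3 tn tn rb rb.
have [bwa wa0 wae] := ra; have [bwb wb0 wbe] := rb; have [bw w0 we] := rw.
have bAa := bmeas_avg bwa; have bAb := bmeas_avg bwb; have bAw := bmeas_avg bw.
have bAAa := bmeas_avg bAa; have bAAb := bmeas_avg bAb.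
(* Uniqueness of the resolvent: the difference solves the equation with right-hand side 0, and
   [resolvent_bound] applies with [H = 0]. *)
have wE : w = (fun x => wa x - wb x).
  have [C C0 hC] := resolvent_bound.
  have bz : bmeas (fun x => w x - (wa x - wb x)) by bm.
  have b0 : bmeas (fun _ : T => 0 : R) by bm.
  have b00 (x : T) : `|0 : R| <= 0 by rewrite normr0.
  have rz : resolvent_eq (fun=> 0) (fun x => w x - (wa x - wb x)).
    split=> //; first by rewrite !ExB//; [rewrite w0 wa0 wb0; ring|bm].
    move=> y; rewrite (_ : avg (fun x => w x - (wa x - wb x)) =
       (fun x => avg w x - (avg wa x - avg wb x))); last first.
      by apply/funext => x; rewrite !avgB//; bm.
    rewrite !avgB//; last by bm.
    by clear b00; have := we y; rewrite -wae -wbe; lra.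
  apply/funext => x; have := hC _ _ _ b0 b00 rz x.
  by rewrite mulr0 normr_le0 subr_eq0 => /eqP.
have du1 w1 w2 k : bmeas w1 -> bmeas w2 -> bmeas k ->
    Ex P (fun x => k x * du w1 w2 x) = - eps * (Ex P (fun x => w2 x * k x) - Ex P (fun x => avg w1 x * k x)).
  move=> b1 b2 bk; have b3 := bmeas_avg b1.
  rewrite -ExB; [|by bm|by bm]; rewrite -ExZl; last by bm.
  by apply: eq_Ex => x; rewrite /du; ring.
have dE k l wl : bmeas wl -> (forall y, wl y - avg (avg wl) y = pot l y) ->
    dif k wl = dif k (pot l) + Ex P (fun x => avg wl x * pot k x).
  move=> bwl wle; have bAl := bmeas_avg bwl; have bl := bmeas_pot l.
  rewrite -dif_avg// -(blfD (blf_dif k))//; last exact: bmeas_avg.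
  by apply: blf_eq => x; rewrite -wle; ring.
have gw : Ex mu w - Ex nu w = dif mu wa - dif mu wb - (dif nu wa - dif nu wb).
  by rewrite /dif wE !ExB//; ring.
have [s hs] := schroedinger_diag_shift.
have gs k : Ex k g = Ex k f - s.
  by rewrite (eq_Ex k hs) ExB ?Ex_cst//; bm.
move: H1 H2 H3; rewrite gw (dE mu mu wa)// (dE mu nu wb)// (dE nu mu wa)// (dE nu nu wb)//.
rewrite !du1// (dif_pot nu mu) !gs -[2 * K * _]mulrA.
generalize (dif mu (pot mu)) (dif mu (pot nu)) (dif nu (pot nu))
  (Ex P (fun x => avg wa x * pot mu x)) (Ex P (fun x => avg wb x * pot mu x))
  (Ex P (fun x => avg wa x * pot nu x)) (Ex P (fun x => avg wb x * pot nu x))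
  (Ex P (fun x => wa x * pot mu x)) (Ex P (fun x => wb x * pot nu x))
  (Ex mu f) (Ex nu f) (K * N ^+ 3) (Ex mu f1 + Ex nu g1) (Ex mu f2 + Ex mu g2) (Ex nu f3 + Ex nu g3).
move=> aa ab bb A1 A2 A3 A4 A5 A6 F1 F2 KN S1 S2 S3.
rewrite !ler_norml => /andP[p1 p2] /andP[p3 p4] /andP[p5 p6].
apply/andP; split; lra.
Qed.

End second_order.
End expansions.

(** * Duality on a compact set *)

(** Needed without integrability, for log-densities and for exponentials of integrable functions;
    positive and negative parts are compared separately. *)
Lemma le_integral_minorant {dU} {U : measurableType dU} {R : realType}
    (p : {measure set U -> \bar R}) (k h : U -> \bar R) :
  measurable_fun setT k -> measurable_fun setT h -> (forall x, k x <= h x)%E ->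
  (\int[p]_x k x <= \int[p]_x h x)%E.
Proof.
move=> mk mh kh; rewrite integralE [leRHS]integralE; apply: leeB.
- apply: ge0_le_integral => //; [exact: measurable_funepos..|].
  by move=> x _; apply: (@funepos_le _ _ setT) => [y _|]; [exact: kh|rewrite inE].
- apply: ge0_le_integral => //; [exact: measurable_funeneg..|].
  by move=> x _; apply: (@funeneg_le _ _ setT) => [y _|]; [exact: kh|rewrite inE].
Qed.

Lemma density_probability {dU} {U : measurableType dU} {R : realType}
    (m : probability U R) (w : U -> R) :
  bmeas w -> (forall x, 0 <= w x) -> Ex m w = 1 ->
  exists p : probability U R, forall A, measurable A ->
    p A = (\int[m]_(x in A) (w x)%:E)%E.
Proof.
move=> bw w0 w1.
pose nu (A : set U) := (\int[m]_(x in A) (w x)%:E)%E.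
have mw : measurable_fun setT (EFin \o w) by apply/measurable_EFinP; exact: bmeas_meas.
have nu0 : nu set0 = 0%E by rewrite /nu integral_set0.
have nu_ge0 A : (0 <= nu A)%E by apply: integral_ge0 => x _; rewrite lee_fin.
have nu_add : semi_sigma_additive nu.
  by apply: semi_sigma_additive_nng_induced => // x; rewrite lee_fin.
pose nuM := isMeasure.Build _ _ _ nu nu0 nu_ge0 nu_add.
pose nuMs : {measure set U -> \bar R} := HB.pack nu nuM.
have nu1 : nuMs setT = 1%E by rewrite /nuMs /= /nu -EFin_Ex// w1.
pose nuP : probability U R := HB.pack nu nuM (Measure_isProbability.Build _ _ _ nuMs nu1).
by exists nuP.
Qed.

(** * The Gibbs variational principle *)

Section gibbs_variational.
Context {dU} {U : measurableType dU} {R : realType} (m : probability U R).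
Implicit Type p : probability U R.

Let RN p : U -> \bar R := Radon_Nikodym (charge_of_finite_measure p) m.
(** A version of the density that is finite and nonnegative everywhere, not only almost
    everywhere. *)
Let rho p : U -> \bar R := Radon_Nikodym_SigmaFinite.f p m.

Let measurable_rho p : p `<< m -> measurable_fun setT (rho p).
Proof. by move=> pm; exact: measurable_int (Radon_Nikodym_SigmaFinite.f_integrable pm). Qed.

Let measurable_ln_fine (h : U -> \bar R) : measurable_fun setT h ->
  measurable_fun setT (fun z => (ln (fine (h z)))%:E).
Proof.
move=> mh; apply/measurable_EFinP; apply: measurableT_comp; first exact: measurable_ln.
by apply: measurableT_comp.
Qed.

Let RN_rho p : p `<< m ->
  (\int[p]_z (ln (fine (RN p z)))%:E = \int[p]_z (ln (fine (rho p z)))%:E)%E.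
Proof.
move=> pm.
have mRN : measurable_fun setT (RN p).
  by apply: measurable_int; exact: Radon_Nikodym_integrable.
apply: ae_eq_integral => //; [exact: measurable_ln_fine|by apply: measurable_ln_fine; exact: measurable_rho|].
apply: (null_dominates_ae_eq measurableT pm).
have := ae_eq_Radon_Nikodym_SigmaFinite pm (@measurableT _ U).
by apply: filterS => z h Dz; rewrite -/(rho p z) in h *; rewrite /RN -h.
Qed.

(* [ln r >= ln w + 1 - w / r] integrates to [0 <= \int (ln r - ln w) d p]. *)
Lemma gibbs_variational p (w : U -> R) k : p `<< m -> bmeas w -> 0 < k ->
  (forall z, k <= w z) -> Ex m w <= 1 ->
  ((Ex p (fun z => ln (w z)))%:E <= \int[p]_z (ln (fine (RN p z)))%:E)%E.
Proof.
move=> pm bw k0 kw w1; rewrite (RN_rho pm).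
have bl : bmeas (fun z => ln (w z)) by exact: (bmeas_ln k0).
have w0 z : 0 < w z := lt_le_trans k0 (kw z).
have mr : measurable_fun setT (rho p) := measurable_rho pm.
have r0 z : (0 <= rho p z)%E by exact: Radon_Nikodym_SigmaFinite.f_ge0.
have rf z : rho p z \is a fin_num by exact: Radon_Nikodym_SigmaFinite.f_fin_num.
pose fr z := fine (rho p z).
have mfr : measurable_fun setT fr by exact: measurableT_comp.
have fr0 z : 0 <= fr z by rewrite fine_ge0.
(* Where the density vanishes, both [w / fr] and [ln fr] take the default value 0. The indicator [s]
   makes the minorant 0 there too; that set is null for [p], so the integral does not change. *)
pose s z : R := ((0 < fr z)%R)%:R.
have ms : measurable_fun setT (fun z => 0 < fr z) by exact: measurable_fun_ltr.
have bs : bmeas s.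
  split; last by exists 1 => z; rewrite /s; case: (_ < _); rewrite ?normr1 ?normr0.
  rewrite (_ : s = (fun z => if 0 < fr z then 1 else 0)); last first.
    by apply/funext => z; rewrite /s; case: (_ < _).
  exact: measurable_fun_ifT.
pose q z := (w z / fr z)%:E.
have q0 z : (0 <= q z)%E by rewrite lee_fin divr_ge0// ltW.
have miv : measurable_fun setT (fun z => (fr z)^-1).
  rewrite (_ : (fun z => _) = (fun z => if 0 < fr z then expR (- ln (fr z)) else 0)).
    apply: measurable_fun_ifT => //; apply: measurableT_comp => //.
    by apply: measurableT_comp => //; apply: measurableT_comp => //; exact: measurable_ln.
  apply/funext => z; have [fz|fz] := ltP 0 (fr z); first by rewrite expRN lnK.
  by rewrite (_ : fr z = 0) ?invr0//; apply/eqP; rewrite eq_le fz fr0.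
have mq : measurable_fun setT q.
  by apply/measurable_EFinP; apply: measurable_funM => //; exact: bmeas_meas.
have iq : (\int[p]_z q z <= 1)%E.
  rewrite -(Radon_Nikodym_SigmaFinite.change_of_variables pm q0 measurableT mq).
  apply: (@le_trans _ _ (\int[m]_z (w z)%:E)%E).
    apply: ge0_le_integral => //.
    - by move=> z _; apply: mule_ge0; [exact: q0|exact: (r0 z)].
    - by apply: emeasurable_funM; [exact: mq|exact: mr].
    - by apply/measurable_EFinP; exact: bmeas_meas.
    - move=> z _.
      have -> : (q z * Radon_Nikodym_SigmaFinite.f p m z = (w z / fr z * fr z)%:E)%E.
        by rewrite EFinM /q /fr fineK//; exact: (rf z).
      rewrite lee_fin.
      have [->|fz] := eqVneq (fr z) 0; first by rewrite mulr0 ltW.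
      by rewrite divfK.
  by rewrite -EFin_Ex// lee_fin.
have intq : p.-integrable setT q.
  apply/integrableP; split => //.
  under eq_integral do rewrite gee0_abs//.
  by rewrite (le_lt_trans iq)// ltry.
have s1 : Ex p (fun z => (ln (w z) + 1) * s z) = Ex p (fun z => ln (w z) + 1).
  rewrite !ExE; congr fine; apply: ae_eq_integral => //.
  - by apply/measurable_EFinP; apply: bmeas_meas; bm.
  - by apply/measurable_EFinP; apply: bmeas_meas; bm.
  have mN : measurable [set z | ~ 0 < fr z].
    rewrite (_ : [set z | _] = ~` [set z | 0 < fr z]) //; apply: measurableC.
    by rewrite -[X in measurable X]setTI; exact: (ms measurableT [set true]).
  exists [set z | ~ 0 < fr z]; split => //.
  - apply: (etrans (Radon_Nikodym_SigmaFinite.f_integral pm mN)).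
    apply: integral0_eq => z /= /negP; rewrite -leNgt => fz.
    have fz0 : fr z = 0 by apply/eqP; rewrite eq_le fz fr0.
    exact: (etrans (esym (fineK (rf z))) (congr1 EFin fz0)).
  - move=> z /=; apply: contra_not => fz _.
    by rewrite /s fz mulr1.
have bls : bmeas (fun z => (ln (w z) + 1) * s z) by bm.
have -> : ((Ex p (fun z => ln (w z)))%:E = (Ex p (fun z => (ln (w z) + 1) * s z))%:E - 1)%E.
  by rewrite s1 ExD//; [rewrite Ex_cst -EFinB addrK|bm].
apply: (@le_trans _ _ (\int[p]_z (((ln (w z) + 1) * s z)%:E - q z))%E).
  rewrite integralB//; last exact: bmeas_integrable.
  by rewrite -EFin_Ex// leeB.
apply: le_integral_minorant.
- apply: emeasurable_funB => //; apply/measurable_EFinP; exact: bmeas_meas.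
- exact: measurable_ln_fine.
move=> z; rewrite -/(fr z) /q -EFinB lee_fin /s.
have [fz|fz] := ltP 0 (fr z); last first.
  have -> : fr z = 0 by apply/eqP; rewrite eq_le fz fr0.
  by rewrite invr0 mulr0 mulr0 subr0 ln0.
rewrite mulr1; have := @le_ln1Dx _ (w z / fr z - 1).
rewrite addrCA subrr addr0 ln_div ?posrE// => h.
have := h; rewrite ltrBrDl subrr divr_gt0// => /(_ isT); lra.
Qed.

Lemma density_entropy p (w : U -> R) k : bmeas w -> 0 < k -> (forall z, k <= w z) ->
  (forall A, measurable A -> p A = (\int[m]_(x in A) (w x)%:E)%E) ->
  p `<< m /\ (\int[p]_z (ln (fine (RN p z)))%:E = (Ex p (fun z => ln (w z)))%:E)%E.
Proof.
move=> bw k0 kw pE.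
have bl : bmeas (fun z => ln (w z)) by exact: (bmeas_ln k0).
have w0 z : 0 < w z := lt_le_trans k0 (kw z).
have mw : measurable_fun setT (EFin \o w) by apply/measurable_EFinP; exact: bmeas_meas.
have pm : p `<< m.
  apply/null_content_dominatesP => A mA A0; apply: (etrans (pE A mA)).
  by apply: null_set_integral => //; exact: measurable_funTS.
split=> //; rewrite EFin_Ex//; apply: ae_eq_integral => //.
- by apply: measurable_ln_fine; apply: measurable_int; exact: Radon_Nikodym_integrable.
- by apply/measurable_EFinP; exact: bmeas_meas.
apply: (null_dominates_ae_eq measurableT pm).
have h : ae_eq m setT (RN p) (EFin \o w).
  apply: integral_ae_eq => //.
    by apply: Radon_Nikodym_integrable.
  by move=> E _ mE; rewrite /RN -Radon_Nikodym_integral//; exact: (pE E mE).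
by apply: filterS h => z h Dz; rewrite h.
Qed.

End gibbs_variational.

(** * Reduction to bounded functions by a retraction onto the compact set *)

Section retraction.
Context {R : realType} {d : nat}.
Local Notation T := 'rV[R]_d.
Variables (Omega : set T) (x0 : T).
Hypotheses (cO : compact Omega) (Ox0 : Omega x0).
Implicit Types mu nu : probability T R.

Lemma measurable_closed (A : set T) : closed A -> measurable A.
Proof.
move=> cA; rewrite -[A]setCK; apply: measurableC; apply: sub_sigma_algebra.
exact: closed_openC.
Qed.

Lemma measurable_Omega : measurable Omega.
Proof. by apply: measurable_closed; apply: compact_closed => //; exact: norm_hausdorff. Qed.

Lemma continuous_measurable_rV (h : T -> R) : continuous h -> measurable_fun setT h.
Proof.
move=> /continuousP ch; apply: (measurability _ (RGenOpens.measurableE R)).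
move=> _ [_ [a [b ->] <-]]; rewrite setTI; apply: sub_sigma_algebra.
by apply: ch; exact: interval_open.
Qed.

Lemma continuous_bounded (h : T -> R) : continuous h ->
  exists2 B : R, 0 <= B & forall x, Omega x -> `|h x| <= B.
Proof.
move=> ch; have : compact (h @` Omega).
  by apply: continuous_compact => //; exact: continuous_subspaceT.
move=> /compact_bounded [M [_ hM]].
exists (`|M| + 1); first by rewrite addr_ge0.
move=> x Ox; apply: hM; last by exists x.
by rewrite ltr_pwDr// ler_norm.
Qed.

(* Composing with the retraction turns functions on [Omega] into globally
   bounded measurable functions. *)
Definition retr (x : T) : T := if pselect (Omega x) then x else x0.

Lemma retrE x : Omega x -> retr x = x.
Proof. by rewrite /retr; case: pselect. Qed.

Lemma retr_in x : Omega (retr x).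
Proof. by rewrite /retr; case: pselect. Qed.

Lemma retrK x : retr (retr x) = retr x.
Proof. exact/retrE/retr_in. Qed.

Lemma measurable_retr : measurable_fun setT retr.
Proof.
move=> _ A mA; rewrite setTI.
have mO := measurable_Omega.
rewrite (_ : _ @^-1` A = (Omega `&` A) `|` (~` Omega `&` [set _ | A x0])); last first.
  apply/seteqP; split => x /=; rewrite /retr; case: pselect => Ox.
  - by left.
  - by right.
  - by case=> [[]|[]].
  - by case=> [[]|[]].
apply: measurableU; first exact: measurableI.
apply: measurableI; first exact: measurableC.
have [Ax|Ax] := pselect (A x0).
  by rewrite (_ : [set _ | _] = setT) //; apply/seteqP; split.
by rewrite (_ : [set _ | _] = set0) //; apply/seteqP; split.
Qed.

Definition coord (i : 'I_d) (x : T) : R := retr x ord0 i.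

Lemma measurable_coordinate i : measurable_fun setT (fun x : T => x ord0 i).
Proof. by apply: continuous_measurable_rV; exact: coord_continuous. Qed.

Lemma coord_bound : exists2 B : R, 0 <= B & forall i x, `|coord i x| <= B.
Proof.
have /choice[B hB] : forall i : 'I_d, exists B : R, 0 <= B /\ forall x, Omega x -> `|x ord0 i| <= B.
  move=> i; have [B B0 hB] := continuous_bounded (@coord_continuous R 1 d ord0 i).
  by exists B.
exists (\sum_i B i); first by apply: sumr_ge0 => i _; case: (hB i).
move=> i x; apply: (le_trans ((hB i).2 _ (retr_in x))).
by rewrite (bigD1 i)//= lerDl; apply: sumr_ge0 => j _; case: (hB j).
Qed.

Lemma bmeas_coord i : bmeas (coord i).
Proof.
have [B B0 hB] := coord_bound; split; last by exists B.
by apply: (measurableT_comp (measurable_coordinate i)); exact: measurable_retr.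
Qed.

Definition cost (x y : T) : R := half_sqdist (retr x) (retr y).

Lemma costE x y : cost x y = 2^-1 * \sum_(i < d) (coord i x - coord i y) ^+ 2.
Proof. by []. Qed.

Lemma bmeas2_cost : bmeas2 cost.
Proof.
have bc := bmeas_coord; rewrite /bmeas2 (_ : (fun _ => _) =
  (fun z => 2^-1 * \sum_(i < d) (coord i z.1 - coord i z.2) ^+ 2)) //.
by apply: bmeasM; [exact: bmeas_cst|apply: bmeas_sum => i _; bm].
Qed.

Lemma costC x y : cost x y = cost y x.
Proof. by rewrite !costE; congr (_ * _); apply: eq_bigr => i _; rewrite -sqrrN opprB. Qed.

Lemma cost_bound : exists L, forall x y, 0 <= cost x y <= L.
Proof.
have [L L0 hL] := bmeas2_bound bmeas2_cost; exists L => x y; apply/andP; split.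
  by rewrite costE mulr_ge0 ?invr_ge0//; apply: sumr_ge0 => i _; exact: sqr_ge0.
by rewrite (le_trans (ler_norm _)).
Qed.

Lemma OmegaC0 mu : mu Omega = 1%E -> mu (~` Omega) = 0%E.
Proof.
move=> mu1; rewrite probability_setC; last exact: measurable_Omega.
by rewrite mu1 subee.
Qed.

Lemma integral_retr mu (h : T -> \bar R) : mu Omega = 1%E -> measurable_fun setT h ->
  (\int[mu]_x h x = \int[mu]_x h (retr x))%E.
Proof.
move=> mu1 mh; apply: ae_eq_integral => //.
  by apply: measurableT_comp => //; exact: measurable_retr.
exists (~` Omega); split; [by apply: measurableC; exact: measurable_Omega|exact: OmegaC0|].
by move=> x /= hx Ox; apply: hx => _; rewrite retrE.
Qed.

Lemma Ex_retr mu (h : T -> R) : mu Omega = 1%E -> measurable_fun setT h ->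
  \int[mu]_x h x = Ex mu (fun x => h (retr x)).
Proof.
move=> mu1 mh; rewrite ExE; congr fine.
by apply: (integral_retr (h := EFin \o h)) => //; exact/measurable_EFinP.
Qed.

Lemma Ex_Omega mu (h k : T -> R) : mu Omega = 1%E -> bmeas h ->
  (forall x, Omega x -> k x = h x) -> \int[mu]_(x in Omega) k x = Ex mu h.
Proof.
move=> mu1 bh kh; rewrite ExE; congr fine.
have mO := measurable_Omega.
rewrite (@eq_integral _ _ _ _ _ (EFin \o h)); last first.
  by move=> x; rewrite inE => Ox /=; rewrite kh.
have mh : measurable_fun setT (EFin \o h) by apply/measurable_EFinP; exact: bmeas_meas.
rewrite integral_mkcond; apply: ae_eq_integral => //.
  by apply/(measurable_restrictT _ mO); exact: measurable_funTS.
exists (~` Omega); split; [exact: measurableC|exact: OmegaC0|].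
by move=> x /= hx Ox; apply: hx => _; rewrite patchE mem_set.
Qed.

End retraction.

(** * Strong duality between couplings and potentials *)

Section couplings.
Context {R : realType} {d : nat}.
Local Notation T := 'rV[R]_d.
Variables (Omega : set T) (x0 : T) (eps L : R).
Hypotheses (cO : compact Omega) (Ox0 : Omega x0) (eps0 : 0 < eps).
Implicit Types (mu nu : probability T R) (f g : T -> R).
Local Notation cost := (cost Omega x0).
Hypothesis cL : forall x y, 0 <= cost x y <= L.
Local Notation schroedinger := (schroedinger eps cost).

Let bc : bmeas2 cost. Proof. exact: bmeas2_cost. Qed.
Let cC : forall x y, cost x y = cost y x. Proof. exact: costC. Qed.

Lemma coupling_fst mu nu (pi : probability (T * T)%type R) h : coupling mu nu pi ->
  bmeas h -> Ex pi (fun z => h z.1) = Ex mu h.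
Proof.
move=> cpl; apply: Ex_pushforward => [|A mA]; first exact: measurable_fst.
apply: (etrans _ (proj1 (cpl A mA))); apply: (congr1 pi).
by apply/seteqP; split => z /=; [|case].
Qed.

Lemma coupling_snd mu nu (pi : probability (T * T)%type R) h : coupling mu nu pi ->
  bmeas h -> Ex pi (fun z => h z.2) = Ex nu h.
Proof.
move=> cpl; apply: Ex_pushforward => [|A mA]; first exact: measurable_snd.
apply: (etrans _ (proj2 (cpl A mA))); apply: (congr1 pi).
by apply/seteqP; split => z /=; [|case].
Qed.

Lemma measurable_half_sqdist :
  measurable_fun setT (fun z : T * T => half_sqdist z.1 z.2).
Proof.
rewrite /half_sqdist; apply: measurable_funM => //.
apply: measurable_sum => i; apply: measurable_funX; apply: measurable_funB.
  exact: (measurableT_comp (measurable_coordinate i) measurable_fst).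
exact: (measurableT_comp (measurable_coordinate i) measurable_snd).
Qed.

Lemma coupling_cost mu nu (pi : probability (T * T)%type R) :
  mu Omega = 1%E -> nu Omega = 1%E -> coupling mu nu pi ->
  (\int[pi]_z (half_sqdist z.1 z.2)%:E = (Ex pi (fun z => cost z.1 z.2))%:E)%E.
Proof.
move=> mu1 nu1 cpl; rewrite EFin_Ex//; apply: ae_eq_integral => //.
- by apply/measurable_EFinP; exact: measurable_half_sqdist.
- by apply/measurable_EFinP; exact: bmeas_meas.
have mOC : measurable (~` Omega) by apply: measurableC; exact: measurable_Omega.
exists ((~` Omega `*` setT) `|` (setT `*` ~` Omega)); split.
- by apply: measurableU; exact: measurableX.
- apply/eqP; rewrite eq_le measure_ge0 andbT.
  apply: (le_trans (measureU2 _ _ _)); [exact: measurableX|exact: measurableX|].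
  have [h1 _] := cpl _ mOC; have [_ h2] := cpl _ mOC.
  apply: (@le_trans _ _ (mu (~` Omega) + nu (~` Omega))%E); first by rewrite -h1 -h2.
  by rewrite !OmegaC0// adde0.
- move=> z /= hz; have [za|za] := pselect (Omega z.1); last by left.
  have [zb|zb] := pselect (Omega z.2); last by right.
  by exfalso; apply: hz => _; rewrite /cost !retrE.
Qed.

(** With [w] the Gibbs density, [cost + eps ln w] equals [f z.1 + g z.2], whose integral is the same
    for all couplings. The variational principle then bounds every coupling from below, and the
    coupling of density [w] attains the bound; its marginals are right by the Schroedinger
    system. *)
Lemma S_eps_dual mu nu f g : mu Omega = 1%E -> nu Omega = 1%E ->
  schroedinger mu nu f g -> S_eps eps mu nu = Ex mu f + Ex nu g.
Proof.
move=> mu1 nu1 sfg; have [bf bg _ _] := sfg.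
have bK : bmeas2 (gibbs eps cost f g) := bmeas2_gibbs eps bc bf bg.
pose w (z : T * T) := gibbs eps cost f g z.1 z.2.
have bw : bmeas w by exact: bK.
have [M1 M10 hM1] := bmeas_bound bf; have [M2 M20 hM2] := bmeas_bound bg.
pose k := expR ((- M1 - M2 - L) / eps).
have k0 : 0 < k := expR_gt0 _.
have hk z : k <= w z.
  rewrite /w gibbsE ler_expR ler_pM2r ?invr_gt0//.
  have := hM1 z.1; have := hM2 z.2; have := cL z.1 z.2; rewrite !ler_norml.
  by move=> /andP[_ ?] /andP[? _] /andP[? _]; lra.
have w0 z : 0 <= w z by apply: le_trans (hk z); exact: ltW.
have w1 : Ex (mu \x nu)%E w = 1.
  rewrite (Ex_prod1 mu nu bK) -[RHS](Ex_cst mu 1); apply: eq_Ex => x.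
  exact: (schroedinger_gibbs1 eps0 bc cL x sfg).
have lnw z : ln (w z) = (f z.1 + g z.2 - cost z.1 z.2) / eps.
  by rewrite /w gibbsE expRK.
have bcz : bmeas (fun z : T * T => cost z.1 z.2) by exact: bc.
have val (pi : probability (T * T)%type R) : coupling mu nu pi ->
    Ex pi (fun z => cost z.1 z.2) + eps * Ex pi (fun z => ln (w z)) = Ex mu f + Ex nu g.
  move=> cpl; rewrite -(coupling_fst cpl bf) -(coupling_snd cpl bg).
  have bl : bmeas (fun z => ln (w z)) by exact: (bmeas_ln k0).
  rewrite -ExZl// -!ExD; [|by bm..].
  by apply: eq_Ex => z; rewrite lnw; field; exact: lt0r_neq0.
rewrite /S_eps; set I := ereal_inf _.
suff -> : I = (Ex mu f + Ex nu g)%:E by [].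
apply/eqP; rewrite eq_le; apply/andP; split; last first.
  apply: le_ereal_inf_tmp => _ [pi cpl <-].
  rewrite /entropic_cost (coupling_cost mu1 nu1 cpl) /relative_entropy.
  case: asboolP => dom; last by rewrite gt0_muley ?lte_fin// addey// leey.
  rewrite -(val pi cpl) EFinD leeD2l// EFinM lee_pmul2l//.
  by apply: (gibbs_variational dom bw k0 hk); rewrite w1.
have [p pE] := density_probability bw w0 w1.
have [pm ent] := density_entropy bw k0 hk pE.
have cpl : coupling mu nu p.
  move=> A mA.
  have bA : bmeas (\1_A : T -> R).
    split; first exact: measurable_indic.
    by exists 1 => x; rewrite indicE; case: (_ \in _); rewrite ?normr1 ?normr0.
  have wA (B : set (T * T)) (h : T * T -> R) : measurable B -> bmeas h ->
      (forall z, h z = \1_B z) -> p B = (Ex (mu \x nu)%E (fun z => h z * w z))%:E.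
    move=> mB bh hB; rewrite pE// EFin_Ex; last by bm.
    rewrite integral_mkcond; apply: eq_integral => z _; rewrite patchE hB indicE.
    by case: (_ \in _); rewrite ?mul1r ?mul0r.
  have pA (mu' : probability T R) : (Ex mu' (\1_A : T -> R))%:E = mu' A.
    by rewrite EFin_Ex// integral_indic// setIT.
  split.
    rewrite (wA _ (fun z => \1_A z.1)); [|exact: measurableX|by bm|]; last first.
      move=> z; rewrite !indicE; congr (_%:R); congr nat_of_bool.
      by apply/idP/idP; rewrite !inE => //= -[].
    rewrite -pA; congr EFin.
    rewrite (Ex_prod1 mu nu (K := fun x y => \1_A x * gibbs eps cost f g x y)); last first.
      by rewrite /bmeas2; apply: bmeasM; [bm|exact: bK].
    apply: eq_Ex => x; rewrite ExZl; last exact: bmeas_section1.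
    by rewrite (schroedinger_gibbs1 eps0 bc cL x sfg) mulr1.
  rewrite (wA _ (fun z => \1_A z.2)); [|exact: measurableX|by bm|]; last first.
    move=> z; rewrite !indicE; congr (_%:R); congr nat_of_bool.
    by apply/idP/idP; rewrite !inE => //= -[].
  rewrite -pA; congr EFin.
  have bK2 : bmeas2 (fun x y => \1_A y * gibbs eps cost f g x y).
    by rewrite /bmeas2; apply: bmeasM; [bm|exact: bK].
  rewrite (Ex_prod1 mu nu bK2) Ex_fubini//.
  apply: eq_Ex => y; rewrite ExZl; last exact: (bmeas_section2 y bK).
  by rewrite (schroedinger_gibbs2 eps0 bc cC cL y sfg) mulr1.
apply: ge_ereal_inf; exists (entropic_cost eps mu nu p); first by exists p.
rewrite /entropic_cost (coupling_cost mu1 nu1 cpl) /relative_entropy.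
case: asboolP => // _.
by rewrite -(val p cpl) EFinD leeD2l// EFinM ent.
Qed.

End couplings.

(** * The extended potentials on the whole space *)

Section potentials.
Context {R : realType} {d : nat}.
Local Notation T := 'rV[R]_d.
Variables (Omega : set T) (x0 : T) (eps L : R).
Hypotheses (cO : compact Omega) (Ox0 : Omega x0) (eps0 : 0 < eps).
Local Notation retr := (retr Omega x0).
Local Notation cost := (cost Omega x0).
Hypothesis cL : forall x y, 0 <= cost x y <= L.
Local Notation schroedinger := (schroedinger eps cost).
Variables mu nu : probability T R.
Hypotheses (mu1 : mu Omega = 1%E) (nu1 : nu Omega = 1%E).
Implicit Types (f g : T -> R).

Let bc : bmeas2 cost. Proof. exact: bmeas2_cost. Qed.
Let cC : forall x y, cost x y = cost y x. Proof. exact: costC. Qed.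

Lemma cost_retr x y : cost x (retr y) = cost x y.
Proof. by rewrite /cost retrK. Qed.

Lemma sink_retr (nu' : probability T R) g x :
  sink eps cost nu' g (retr x) = sink eps cost nu' g x.
Proof.
rewrite !sinkE !partitionE; congr (_ * ln _); apply: eq_Ex => y.
by rewrite cC cost_retr cC.
Qed.

Lemma coupling_prod : coupling mu nu (mu \x nu)%E.
Proof.
move=> A mA; split.
  apply: (etrans (product_measure1E mu nu mA measurableT)).
  by rewrite -[RHS]mule1; congr (_ * _)%E; exact: probability_setT.
apply: (etrans (product_measure1E mu nu measurableT mA)).
by rewrite -[RHS]mul1e; congr (_ * _)%E; exact: probability_setT.
Qed.

Lemma integral_prod_retr (H : T * T -> \bar R) : measurable_fun setT H ->
  (\int[mu \x nu]_z H z = \int[mu \x nu]_z H (retr z.1, retr z.2))%E.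
Proof.
move=> mH; have mr := measurable_retr x0 cO.
apply: ae_eq_integral => //.
  apply: measurableT_comp => //; apply: measurable_fun_pair.
    exact: (measurableT_comp mr measurable_fst).
  exact: (measurableT_comp mr measurable_snd).
have mOC : measurable (~` Omega) by apply: measurableC; exact: measurable_Omega.
exists ((~` Omega `*` setT) `|` (setT `*` ~` Omega)); split.
- by apply: measurableU; exact: measurableX.
- apply/eqP; rewrite eq_le measure_ge0 andbT.
  apply: (le_trans (measureU2 _ _ _)); [exact: measurableX|exact: measurableX|].
  have [h1 _] := coupling_prod mOC; have [_ h2] := coupling_prod mOC.
  apply: (@le_trans _ _ (mu (~` Omega) + nu (~` Omega))%E).
    by rewrite -[X in (_ <= X + _)%E]h1 -[X in (_ <= _ + X)%E]h2.
  by rewrite !OmegaC0// adde0.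
- move=> -[x y] /= hz; have [za|za] := pselect (Omega x); last by left.
  have [zb|zb] := pselect (Omega y); last by right.
  by exfalso; apply: hz => _; rewrite !retrE.
Qed.

Lemma measurable_sqdist1 (x : T) : measurable_fun setT (half_sqdist x).
Proof.
apply: (measurableT_comp (@measurable_half_sqdist R d) (g := fun y : T => (x, y))).
exact: measurable_fun_pair.
Qed.

Lemma half_sqdistC (x y : T) : half_sqdist x y = half_sqdist y x.
Proof. by congr (_ * _); apply: eq_bigr => i _; rewrite -sqrrN opprB. Qed.

Lemma integrable_retr (k : probability T R) (h : T -> R) : k Omega = 1%E ->
  measurable_fun setT h -> bmeas (fun x => h (retr x)) -> L1 k h.
Proof.
move=> k1 mh bh; have := bmeas_integrable k bh => /integrableP[_ fin].
apply/integrableP; split; first exact/measurable_EFinP.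
rewrite (integral_retr x0 cO k1)//.
by apply/measurable_EFinP; exact: measurableT_comp.
Qed.

(* The right-hand side of the extension formulas of [is_potentials]. *)
Definition extend (k : probability T R) g (x : T) : R :=
  - eps * ln (\int[k]_y expR ((g y - half_sqdist x y) / eps)).

Lemma measurable_exp_cost g : measurable_fun setT g ->
  measurable_fun setT (fun z : T * T => expR ((g z.2 - half_sqdist z.1 z.2) / eps)).
Proof.
move=> mg; apply: measurableT_comp => //; apply: measurable_funM => //.
apply: measurable_funB; last exact: measurable_half_sqdist.
exact: (measurableT_comp mg measurable_snd).
Qed.

Lemma measurable_extend (k : probability T R) g : measurable_fun setT g ->
  measurable_fun setT (extend k g).
Proof.
move=> mg; rewrite /extend; apply: measurable_funM => //.
apply: measurableT_comp; first exact: measurable_ln.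
apply: (measurableT_comp (f := fine)) => //.
have mH : measurable_fun setT (fun z : T * T => (expR ((g z.2 - half_sqdist z.1 z.2) / eps))%:E).
  by apply/measurable_EFinP; exact: measurable_exp_cost.
by apply: (@measurable_fun_fubini_tonelli_F _ _ _ _ _ k _ mH) => z; rewrite lee_fin expR_ge0.
Qed.

Lemma extend_Omega (k : probability T R) g x : k Omega = 1%E ->
  measurable_fun setT g -> bmeas (fun y => g (retr y)) -> Omega x ->
  extend k g x = sink eps cost k (fun y => g (retr y)) x.
Proof.
move=> k1 mg bg Ox; rewrite /extend sinkE partitionE; congr (_ * ln _).
rewrite (Ex_retr x0 cO k1); last first.
  apply: measurableT_comp => //; apply: measurable_funM => //.
  by apply: measurable_funB => //; exact: measurable_sqdist1.
by apply: eq_Ex => y; rewrite /cost (retrE _ Ox).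
Qed.

(** Competitors in the dual problem are merely integrable; Tonelli carries the marginal equation
    over to them. *)
Lemma gibbs_marginal_unbounded f g (h : T -> R) : schroedinger mu nu f g ->
  L1 mu h ->
  (mu \x nu)%E.-integrable setT (fun z => (gibbs eps cost f g z.1 z.2 * h z.1)%:E) /\
  (\int[mu \x nu]_z (gibbs eps cost f g z.1 z.2 * h z.1)%:E = \int[mu]_x (h x)%:E)%E.
Proof.
move=> sfg ih; have [bf bg _ _] := sfg.
have bK : bmeas2 (gibbs eps cost f g) := bmeas2_gibbs eps bc bf bg.
have g0 x y : 0 <= gibbs eps cost f g x y by rewrite gibbsE expR_ge0.
have mh : measurable_fun setT h by apply/measurable_EFinP; exact: measurable_int ih.
have in1 x a : (\int[nu]_y (gibbs eps cost f g x y * a)%:E = a%:E)%E.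
  have bs : bmeas (fun y => gibbs eps cost f g x y * a).
    by apply: bmeasM; [exact: bmeas_section1|exact: bmeas_cst].
  rewrite -(EFin_Ex _ bs) ExZr; last exact: bmeas_section1.
  by rewrite (schroedinger_gibbs1 eps0 bc cL x sfg) mul1r.
have mH : measurable_fun setT (fun z : T * T => (gibbs eps cost f g z.1 z.2 * h z.1)%:E).
  apply/measurable_EFinP; apply: measurable_funM; first exact: (bmeas_meas bK).
  exact: (measurableT_comp mh measurable_fst).
have iH : (mu \x nu)%E.-integrable setT (fun z => (gibbs eps cost f g z.1 z.2 * h z.1)%:E).
  apply/(integrable12ltyP _ _ mH) => /=.
  have /integrableP[_] := ih.
  apply: le_lt_trans; apply: ge0_le_integral => //.
  - by move=> x _; apply: integral_ge0.
  - apply: (@measurable_fun_fubini_tonelli_F _ _ _ _ _ nu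
      (fun z => `|(gibbs eps cost f g z.1 z.2 * h z.1)%:E|%E)) => //.
    exact: measurableT_comp.
  - by apply: measurableT_comp => //; exact: measurable_int ih.
  move=> x _ /=; rewrite -(in1 x `|h x|).
  rewrite (@eq_integral _ _ _ _ _ (fun y => (gibbs eps cost f g x y * `|h x|)%:E))//.
  by move=> y _; rewrite normrM (ger0_norm (g0 _ _)).
split=> //; rewrite -(integral12_prod_meas1 iH); apply: eq_integral => x _.
by rewrite /fubini_F /= in1.
Qed.

Lemma gibbs_marginal_unbounded2 f g (h : T -> R) : schroedinger mu nu f g ->
  L1 nu h ->
  (mu \x nu)%E.-integrable setT (fun z => (gibbs eps cost f g z.1 z.2 * h z.2)%:E) /\
  (\int[mu \x nu]_z (gibbs eps cost f g z.1 z.2 * h z.2)%:E = \int[nu]_y (h y)%:E)%E.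
Proof.
move=> sfg ih; have [bf bg _ _] := sfg.
have bK : bmeas2 (gibbs eps cost f g) := bmeas2_gibbs eps bc bf bg.
have g0 x y : 0 <= gibbs eps cost f g x y by rewrite gibbsE expR_ge0.
have mh : measurable_fun setT h by apply/measurable_EFinP; exact: measurable_int ih.
have in1 y a : (\int[mu]_x (gibbs eps cost f g x y * a)%:E = a%:E)%E.
  have bs : bmeas (fun x => gibbs eps cost f g x y * a).
    by apply: bmeasM; [exact: (bmeas_section2 y bK)|exact: bmeas_cst].
  rewrite -(EFin_Ex _ bs) ExZr; last exact: (bmeas_section2 y bK).
  by rewrite (schroedinger_gibbs2 eps0 bc cC cL y sfg) mul1r.
have mH : measurable_fun setT (fun z : T * T => (gibbs eps cost f g z.1 z.2 * h z.2)%:E).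
  apply/measurable_EFinP; apply: measurable_funM; first exact: (bmeas_meas bK).
  exact: (measurableT_comp mh measurable_snd).
have iH : (mu \x nu)%E.-integrable setT (fun z => (gibbs eps cost f g z.1 z.2 * h z.2)%:E).
  apply/(integrable21ltyP _ _ mH) => /=.
  have /integrableP[_] := ih.
  apply: le_lt_trans; apply: ge0_le_integral => //.
  - by move=> x _; apply: integral_ge0.
  - apply: (@measurable_fun_fubini_tonelli_G _ _ _ _ _ mu
      (fun z => `|(gibbs eps cost f g z.1 z.2 * h z.2)%:E|%E)) => //.
    exact: measurableT_comp.
  - by apply: measurableT_comp => //; exact: measurable_int ih.
  move=> x _ /=; rewrite -(in1 x `|h x|).
  rewrite (@eq_integral _ _ _ _ _ (fun y => (gibbs eps cost f g y x * `|h x|)%:E))//.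
  by move=> y _; rewrite normrM (ger0_norm (g0 _ _)).
split=> //; rewrite -(integral21_prod_meas1 iH); apply: eq_integral => x _.
by rewrite /fubini_G /= in1.
Qed.

Lemma L1_EFin (k : probability T R) h : L1 k h ->
  (\int[k]_x (h x)%:E = (\int[k]_x h x)%:E)%E.
Proof. by move=> ih; rewrite fineK//; exact: integrable_fin_num. Qed.

Lemma L1_retr (k : probability T R) h : k Omega = 1%E -> L1 k h -> L1 k (fun x => h (retr x)).
Proof.
move=> k1 ih; have /integrableP[mh fin] := ih.
have mr := measurable_retr x0 cO.
apply/integrableP; split; first exact: (measurableT_comp mh mr).
apply: le_lt_trans fin; rewrite [leRHS](integral_retr x0 cO k1)//.
exact: measurableT_comp.
Qed.

Lemma L1_affine (k : probability T R) h (u : T -> R) a b : L1 k h -> bmeas u ->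
  L1 k (fun x => (h x - u x) * a + b) /\
  \int[k]_x ((h x - u x) * a + b) = (\int[k]_x h x - Ex k u) * a + b.
Proof.
move=> ih bu; have iu := bmeas_integrable k bu.
have bb : bmeas (fun _ : T => b) by exact: bmeas_cst.
have ib := bmeas_integrable k bb.
have i1 : L1 k (fun x => h x - u x) by exact: (integrableB measurableT ih iu).
have i2 : L1 k (fun x => (h x - u x) * a) by exact: (integrableZr measurableT a i1).
split; first exact: (integrableD measurableT i2 ib).
rewrite RintegralD//; congr (_ + _); last by rewrite -ExE Ex_cst.
by rewrite RintegralZr// RintegralB// ExE.
Qed.

Section candidate.
Variables f g : T -> R.
Hypothesis sfg : schroedinger mu nu f g.

Let bf : bmeas f. Proof. by case: sfg. Qed.
Let bg : bmeas g. Proof. by case: sfg. Qed.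
Let bK : bmeas2 (gibbs eps cost f g). Proof. exact: bmeas2_gibbs. Qed.

Lemma measurable_exp_dual f' g' : measurable_fun setT f' -> measurable_fun setT g' ->
  measurable_fun setT (fun z : T * T =>
    (expR ((f' z.1 + g' z.2 - half_sqdist z.1 z.2) / eps))%:E).
Proof.
move=> mf mg; apply/measurable_EFinP; apply: measurableT_comp => //.
apply: measurable_funM => //; apply: measurable_funB; last exact: measurable_half_sqdist.
apply: measurable_funD; first exact: (measurableT_comp mf measurable_fst).
exact: (measurableT_comp mg measurable_snd).
Qed.

(** Weak duality: the exponential lies above its tangent at the Gibbs exponent, and the marginal
    equations integrate the tangent. If the exponential integral is infinite, the objective is
    [-oo]. *)
Lemma dual_objective_le f' g' : L1 mu f' -> L1 nu g' ->
  (dual_objective eps mu nu f' g' <= (Ex mu f + Ex nu g)%:E)%E.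
Proof.
move=> i1 i2; have /integrableP[/measurable_EFinP m1 _] := i1.
have /integrableP[/measurable_EFinP m2 _] := i2.
rewrite /dual_objective (L1_EFin i1) (L1_EFin i2).
set I := (\int[_]_z _)%E.
have I0 : (0 <= I)%E by apply: integral_ge0 => z _; rewrite lee_fin expR_ge0.
have i1r := L1_retr mu1 i1; have i2r := L1_retr nu1 i2.
have [l1 e1] := L1_affine eps^-1 1 i1r bf.
have [l2 e2] := L1_affine eps^-1 0 i2r bg.
have [j1 k1] := gibbs_marginal_unbounded sfg l1.
have [j2 k2] := gibbs_marginal_unbounded2 sfg l2.
have low : ((1 + (\int[mu]_x f' x + \int[nu]_y g' y - (Ex mu f + Ex nu g)) / eps)%:E <= I)%E.
  have -> : (1 + (\int[mu]_x f' x + \int[nu]_y g' y - (Ex mu f + Ex nu g)) / eps)%:E =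
      (\int[mu \x nu]_z ((gibbs eps cost f g z.1 z.2 * ((f' (retr z.1) - f z.1) / eps + 1))%:E
       + (gibbs eps cost f g z.1 z.2 * ((g' (retr z.2) - g z.2) / eps + 0))%:E))%E.
    rewrite integralD// k1 k2 (L1_EFin l1) (L1_EFin l2) e1 e2 -EFinD.
    have r1 : \int[mu]_x f' (retr x) = \int[mu]_x f' x.
      by congr fine; rewrite [RHS](integral_retr x0 cO mu1)//; exact/measurable_EFinP.
    have r2 : \int[nu]_x g' (retr x) = \int[nu]_x g' x.
      by congr fine; rewrite [RHS](integral_retr x0 cO nu1)//; exact/measurable_EFinP.
    by rewrite r1 r2; congr EFin; ring.
  have mE := measurable_exp_dual m1 m2.
  rewrite /I (integral_prod_retr mE); apply: le_integral_minorant.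
  - exact: (measurable_int (mu \x nu)%E (integrableD measurableT j1 j2)).
  - have mr := measurable_retr x0 cO.
    have mr2 : measurable_fun setT (fun z : T * T => (retr z.1, retr z.2)).
      apply: measurable_fun_pair; first exact: (measurableT_comp mr measurable_fst).
      exact: (measurableT_comp mr measurable_snd).
    exact: (measurableT_comp mE mr2).
  move=> z; rewrite -EFinD lee_fin /= -/(cost z.1 z.2) -mulrDr.
  have -> : expR ((f' (retr z.1) + g' (retr z.2) - cost z.1 z.2) / eps) =
    gibbs eps cost f g z.1 z.2 * expR ((f' (retr z.1) - f z.1) / eps + (g' (retr z.2) - g z.2) / eps).
    by rewrite gibbsE -expRD; congr expR; ring.
  rewrite ler_wpM2l//; first by rewrite gibbsE expR_ge0.
  by apply: le_trans (expR_ge1Dx _); lra.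
move: I I0 low => [i| |//] _; last by rewrite gt0_muley ?lte_fin// addeNy addNye leNye.
rewrite lee_fin => low; rewrite -!EFinM -!EFinD lee_fin.
have := ler_wpM2l (ltW eps0) low.
rewrite mulrDr mulr1 mulrCA divff ?mulr1; last exact: lt0r_neq0.
lra.
Qed.

Lemma dual_objective_eq f' g' : measurable_fun setT f' -> measurable_fun setT g' ->
  (forall x, f' (retr x) = f x) -> (forall x, g' (retr x) = g x) ->
  dual_objective eps mu nu f' g' = (Ex mu f + Ex nu g)%:E.
Proof.
move=> m1 m2 ef eg.
have i1 : L1 mu f' by apply: integrable_retr => //; rewrite (_ : (fun x => _) = f)//; exact/funext.
have i2 : L1 nu g' by apply: integrable_retr => //; rewrite (_ : (fun x => _) = g)//; exact/funext.
rewrite /dual_objective (L1_EFin i1) (L1_EFin i2).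
rewrite (Ex_retr x0 cO mu1 m1) (Ex_retr x0 cO nu1 m2) (eq_Ex mu ef) (eq_Ex nu eg).
rewrite (integral_prod_retr (measurable_exp_dual m1 m2)).
have -> : (\int[mu \x nu]_z
   (expR ((f' (retr z.1) + g' (retr z.2) - half_sqdist (retr z.1) (retr z.2)) / eps))%:E)%E = 1%:E.
  rewrite (eq_integral (fun z => (gibbs eps cost f g z.1 z.2)%:E)); last first.
    by move=> z _; rewrite ef eg gibbsE.
  rewrite -(EFin_Ex _ bK) (Ex_prod1 mu nu bK); congr EFin.
  rewrite -[RHS](Ex_cst mu 1); apply: eq_Ex => x.
  exact: (schroedinger_gibbs1 eps0 bc cL x sfg).
by rewrite -EFinM -!EFinD; congr EFin; ring.
Qed.

End candidate.

(** After a normalising shift, the solution for the retracted cost is right on [Omega] only. One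
    application of [extend] corrects the values elsewhere and keeps those on [Omega], which carries
    both measures; optimality and the integrals in the extension formulas are therefore
    preserved. *)
Lemma is_potentials_exists : exists fg, is_potentials eps mu nu fg.
Proof.
have [f1 [g1 s1]] := schroedinger_exists x0 eps0 bc cC cL mu nu.
have [f [g [sfg g0]]] : exists f g, schroedinger mu nu f g /\ Ex nu g = 0.
  exists (fun x => f1 x - (- Ex nu g1)), (fun x => g1 x + (- Ex nu g1)).
  split; first exact: (schroedingerD eps0 bc cL _ s1).
  by have [_ b1 _ _] := s1; rewrite ExD ?Ex_cst ?subrr//; exact: bmeas_cst.
have [bf bg fE gE] := sfg.
have gr : (fun y => g (retr y)) = g by apply/funext => y; rewrite !gE sink_retr.
have fr : (fun y => f (retr y)) = f by apply/funext => y; rewrite !fE sink_retr.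
have mf := bmeas_meas bf; have mg := bmeas_meas bg.
pose F := extend nu g; pose G := extend mu f.
have FO x : F (retr x) = f x.
  have h := extend_Omega nu1 mg; rewrite gr in h.
  by rewrite /F (h _ bg (retr_in Ox0 x)) -fE -[RHS](congr1 (@^~ x) fr).
have GO x : G (retr x) = g x.
  have h := extend_Omega mu1 mf; rewrite fr in h.
  by rewrite /G (h _ bf (retr_in Ox0 x)) -gE -[RHS](congr1 (@^~ x) gr).
have mF : measurable_fun setT F by exact: measurable_extend.
have mG : measurable_fun setT G by exact: measurable_extend.
have mexp (h : T -> R) (x : T) : measurable_fun setT h ->
    measurable_fun setT (fun y => expR ((h y - half_sqdist x y) / eps)).
  move=> mh; apply: measurableT_comp => //; apply: measurable_funM => //.
  by apply: measurable_funB => //; exact: measurable_sqdist1.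
have FE x : F x = - eps * ln (\int[nu]_y expR ((g y - half_sqdist x y) / eps)) by [].
have GE y : G y = - eps * ln (\int[mu]_x expR ((f x - half_sqdist y x) / eps)) by [].
clearbody F G.
have bF : bmeas (fun x => F (retr x)) by rewrite (funext FO).
have bG : bmeas (fun x => G (retr x)) by rewrite (funext GO).
exists (F, G); split.
- split; [exact: (integrable_retr mu1 mF bF)|exact: (integrable_retr nu1 mG bG)|].
  move=> f' g' l1 l2; rewrite (dual_objective_eq sfg mF mG FO GO).
  exact: dual_objective_le.
- by rewrite /= (Ex_retr x0 cO nu1 mG) (eq_Ex nu GO).
- move=> x; rewrite /= FE (Ex_retr x0 cO nu1 (mexp g x mg)) (Ex_retr x0 cO nu1 (mexp G x mG)).
  apply: (congr1 (fun t : R => - eps * ln t)).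
  by apply: eq_Ex => y; rewrite GO -[g (retr y)]/((fun y => g (retr y)) y) gr.
- move=> y; rewrite /= GE.
  rewrite (_ : (fun x => expR ((F x - half_sqdist x y) / eps)) =
    (fun x => expR ((F x - half_sqdist y x) / eps))); last first.
    by apply/funext => x; rewrite half_sqdistC.
  rewrite (Ex_retr x0 cO mu1 (mexp f y mf)) (Ex_retr x0 cO mu1 (mexp F y mF)).
  apply: (congr1 (fun t : R => - eps * ln t)).
  by apply: eq_Ex => x; rewrite FO -[f (retr x)]/((fun y => f (retr y)) x) fr.
Qed.

(* When the exponential integral is infinite or null, [fine] and [ln] send it
   to 0, so that the extension is bounded in all cases. *)
Lemma bmeas_extend (k : probability T R) (g : T -> R) : k Omega = 1%E ->
  measurable_fun setT g -> bmeas (fun x => extend k g (retr x)).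
Proof.
move=> k1 mg; have mr := measurable_retr x0 cO.
split; first exact: (measurableT_comp (measurable_extend k mg) mr).
pose a (x : T) := (\int[k]_y (expR ((g (retr y) - cost x y) / eps))%:E)%E.
pose Z := (\int[k]_y (expR (g (retr y) / eps))%:E)%E.
have mgr : measurable_fun setT (fun y => g (retr y)) by exact: measurableT_comp.
have mw : measurable_fun setT (fun y => (expR (g (retr y) / eps))%:E).
  by apply/measurable_EFinP; apply: measurableT_comp => //; exact: measurable_funM.
have mc x : measurable_fun setT (fun y => (expR ((g (retr y) - cost x y) / eps))%:E).
  apply/measurable_EFinP; apply: measurableT_comp => //; apply: measurable_funM => //.
  by apply: measurable_funB => //; exact: (bmeas_meas (bmeas_section1 x bc)).
have Z0 : (0 <= Z)%E by apply: integral_ge0 => y _; rewrite lee_fin expR_ge0.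
have ext x : extend k g (retr x) = - eps * ln (fine (a x)).
  rewrite /extend /Rintegral.
  rewrite (integral_retr x0 cO k1 (h := fun y => (expR ((g y - half_sqdist (retr x) y) / eps))%:E))//.
  apply/measurable_EFinP; apply: measurableT_comp => //; apply: measurable_funM => //.
  by apply: measurable_funB => //; exact: measurable_sqdist1.
have au x : (a x <= Z)%E.
  apply: ge0_le_integral => //; [by move=> y _; rewrite lee_fin expR_ge0..|].
  move=> y _; rewrite lee_fin ler_expR ler_pM2r ?invr_gt0//.
  by have /andP[? _] := cL x y; lra.
pose q := expR (- L / eps); have q0 : 0 < q := expR_gt0 _.
have al x : (q%:E * Z <= a x)%E.
  have w0 y : setT y -> (0 <= (expR (g (retr y) / eps))%:E)%E by rewrite lee_fin expR_ge0.
  rewrite -(ge0_integralZl k measurableT mw w0 _ (k := q%:E)); last by rewrite lee_fin ltW.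
  apply: ge0_le_integral => //; [| |].
  - by move=> y _; rewrite lee_fin mulr_ge0 ?expR_ge0.
  - by apply/measurable_EFinP; apply: measurable_funM => //; exact/measurable_EFinP.
  - move=> y _; rewrite lee_fin -expRD ler_expR -mulrDl ler_pM2r ?invr_gt0//.
    by have /andP[_ ?] := cL x y; lra.
move: Z0 au al; case: Z => [z| |//] z0 au al; last first.
  exists 0 => x; rewrite ext.
  suff -> : a x = +oo%E by rewrite /= ln0// mulr0 normr0.
  by have := al x; rewrite gt0_muley ?lte_fin// leye_eq => /eqP.
have {}au x : exists2 r, a x = r%:E & q * z <= r <= z.
  have := au x; have := al x; case: (a x) => [r| |]//.
  by rewrite -EFinM !lee_fin => h1 h2; exists r => //; rewrite h1.
move: z0; rewrite lee_fin le_eqVlt => /orP[/eqP z0|z0].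
  exists 0 => x; rewrite ext; have [r -> ] := au x.
  rewrite -z0 mulr0 => rr; have -> : r = 0 by lra.
  by rewrite ln0// mulr0 normr0.
exists (eps * (`|ln z| + `|ln (q * z)|)) => x; rewrite ext.
have [r -> /andP[r1 r2]] := au x.
rewrite normrM normrN (gtr0_norm eps0) ler_pM2l//=.
have qz : 0 < q * z by exact: mulr_gt0.
have r0 : 0 < r by exact: lt_le_trans r1.
have l1 : ln (q * z) <= ln r by rewrite ler_ln.
have l2 : ln r <= ln z by rewrite ler_ln.
have := ler_norm (ln z); have := ler_norm (- ln (q * z)); rewrite normrN.
have := normr_ge0 (ln z); have := normr_ge0 (ln (q * z)).
by move=> *; rewrite ler_norml; apply/andP; split; lra.
Qed.

(** [potentials] is an arbitrary choice, so every admissible pair has to be brought back to the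
    bounded setting. Its boundedness on [Omega] comes from the extension formulas alone. *)
Lemma potentials_schroedinger fg : is_potentials eps mu nu fg ->
  schroedinger mu nu (fun x => fg.1 (retr x)) (fun y => fg.2 (retr y)) /\
  Ex nu (fun y => fg.2 (retr y)) = 0.
Proof.
case: fg => F G [/= [/= iF iG _] G0 FE GE].
have mF : measurable_fun setT F by apply/measurable_EFinP; exact: measurable_int iF.
have mG : measurable_fun setT G by apply/measurable_EFinP; exact: measurable_int iG.
have {}FE : F = extend nu G by exact/funext.
have {}GE : G = extend mu F.
  apply/funext => y; rewrite GE /extend /Rintegral.
  apply: (congr1 (fun t : \bar R => - eps * ln (fine t))).
  by apply: eq_integral => x _; rewrite half_sqdistC.
have bF : bmeas (fun x => F (retr x)) by rewrite FE; exact: bmeas_extend.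
have bG : bmeas (fun x => G (retr x)) by rewrite GE; exact: bmeas_extend.
split; last by rewrite -(Ex_retr x0 cO nu1 mG).
split=> // x.
  rewrite [in LHS]FE (extend_Omega nu1 mG bG (retr_in Ox0 x)) sink_retr//.
rewrite [in LHS]GE (extend_Omega mu1 mF bF (retr_in Ox0 x)) sink_retr//.
Qed.

Lemma potentials_spec :
  schroedinger mu nu (fun x => f_pot eps mu nu (retr x)) (fun y => g_pot eps mu nu (retr y)) /\
  Ex nu (fun y => g_pot eps mu nu (retr y)) = 0.
Proof.
apply: (@potentials_schroedinger (potentials eps mu nu)).
exact: (xgetPex _ is_potentials_exists).
Qed.

End potentials.

(** * The quadratic form *)

Lemma norm_coord_le {R : realType} {d : nat} (x : 'rV[R]_d) i : `|x ord0 i| <= `|x|.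
Proof. by rewrite [leRHS]/Num.norm /= mx_normrE; apply/bigmax_geP; right => /=; exists (ord0, i). Qed.

(** * Functions of class C^k and Laplace transforms *)

Section smooth_calculus.
Context {R : realType} {d : nat}.
Local Notation T := 'rV[R]_d.
Implicit Types f g : T -> R.

Lemma is_Ck_continuous k f : is_Ck k f -> continuous f.
Proof. by case: k => [|k]//= []. Qed.

Lemma is_CkW k f : is_Ck k.+1 f -> is_Ck k f.
Proof.
elim: k f => [|k IH] f; first exact: is_Ck_continuous.
by case=> cf df pf; split=> // i; apply: IH; exact: pf.
Qed.

Lemma is_CkD k f g : is_Ck k f -> is_Ck k g -> is_Ck k (fun x => f x + g x).
Proof.
elim: k f g => [|k IH] f g; first by move=> cf cg x; exact: (cvgD (cf x) (cg x)).
case=> cf df pf [cg dg pg]; split.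
- by move=> x; exact: (cvgD (cf x) (cg x)).
- by move=> i x; apply: derivableD.
move=> i; rewrite (_ : partial i _ = (fun x => partial i f x + partial i g x)).
  by apply: IH; [exact: pf|exact: pg].
by apply/funext => x; rewrite /partial -deriveD.
Qed.

Lemma is_CkN k f : is_Ck k f -> is_Ck k (fun x => - f x).
Proof.
elim: k f => [|k IH] f; first by move=> cf x; exact: (cvgN (cf x)).
case=> cf df pf; split.
- by move=> x; exact: (cvgN (cf x)).
- by move=> i x; apply: derivableN.
move=> i; rewrite (_ : partial i _ = (fun x => - partial i f x)); first by apply: IH; exact: pf.
by apply/funext => x; rewrite /partial -deriveN.
Qed.

Lemma is_CkM k f g : is_Ck k f -> is_Ck k g -> is_Ck k (fun x => f x * g x).
Proof.
elim: k f g => [|k IH] f g; first by move=> cf cg x; exact: (cvgM (cf x) (cg x)).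
move=> cdf cdg; have cf := is_CkW cdf; have cg := is_CkW cdg.
case: cdf => cf' df pf; case: cdg => cg' dg pg; split.
- by move=> x; exact: (cvgM (cf' x) (cg' x)).
- by move=> i x; apply: derivableM.
move=> i; rewrite (_ : partial i _ =
    (fun x => f x * partial i g x + g x * partial i f x)).
  by apply: is_CkD; apply: IH => //; [exact: pg|exact: pf].
by apply/funext => x; rewrite /partial -[RHS]deriveM.
Qed.

Lemma is_CkV k f : (forall x, f x != 0) -> is_Ck k f -> is_Ck k (fun x => (f x)^-1).
Proof.
move=> f0; elim: k => [|k IH]; first by move=> cf x; exact: (cvgV (f0 x) (cf x)).
move=> cdf; have /IH cV := is_CkW cdf; case: cdf => cf df pf; split.
- by move=> x; exact: (cvgV (f0 x) (cf x)).
- by move=> i x; apply: derivableV.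
move=> i; rewrite (_ : partial i _ =
    (fun x => - ((f x)^-1 * (f x)^-1 * partial i f x))).
  by apply: is_CkN; apply: is_CkM; [exact: is_CkM|exact: pf].
by apply/funext => x; rewrite /partial deriveV// -exprVn expr2 scaleNr.
Qed.

End smooth_calculus.

Lemma cvg_dnbhs0_linear {R : realType} (q : R -> R) (l C r : R) : 0 < r ->
  (forall h, h != 0 -> `|h| <= r -> `|q h - l| <= C * `|h|) -> q h @[h --> 0^'] --> l.
Proof.
move=> r0 hq; have C0 : 0 < `|C| + 1 by rewrite ltr_wpDl.
apply/cvgrPdist_le => e e0; near=> h.
rewrite distrC; apply: (@le_trans _ _ ((`|C| + 1) * `|h|)).
  apply: (@le_trans _ _ (C * `|h|)).
    apply: hq; first by near: h; exact: nbhs_dnbhs_neq.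
    by near: h; apply: dnbhs0_le.
  by rewrite ler_wpM2r// (le_trans (ler_norm _))// lerDl.
rewrite mulrC -ler_pdivlMr//; near: h; apply: dnbhs0_le.
by rewrite divr_gt0.
Unshelve. all: by end_near. Qed.

Lemma continuous_of_bound {R : realType} {V : normedModType R} (h : V -> R) y (q C : R) :
  0 < q -> 0 <= C -> (forall z, `|z - y| * q <= 1 -> `|h z - h y| <= C * `|z - y|) ->
  {for y, continuous h}.
Proof.
move=> q0 C0 hh; apply/cvgrPdist_le => e e0; near=> z.
rewrite distrC; apply: (le_trans (hh z _)); rewrite distrC.
  rewrite -ler_pdivlMr// mul1r; near: z; apply: cvgr_dist_le => //.
  by rewrite invr_gt0.
apply: (@le_trans _ _ ((C + 1) * `|y - z|)); first by rewrite ler_wpM2r// lerDl.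
rewrite mulrC -ler_pdivlMr ?ltr_wpDl//; near: z; apply: cvgr_dist_le => //.
by rewrite divr_gt0// ltr_wpDl.
Unshelve. all: by end_near. Qed.

Section laplace.
Context {R : realType} {d : nat}.
Local Notation T := 'rV[R]_d.
Variables (mu : probability T R) (X : 'I_d -> T -> R) (B eps : R).
Hypotheses (bX : forall i, bmeas (X i)) (XB : forall i x, `|X i x| <= B).
Hypotheses (B0 : 0 <= B) (eps0 : 0 < eps).

(** In contrast to [expi], the second argument is not retracted: the function is smooth in [y] on
    the whole space and agrees with the kernel for [y] in [Omega]. *)
Definition linear_exp (x y : T) : R := expR ((\sum_(i < d) X i x * y ord0 i) / eps).

Definition laplace (u : T -> R) (y : T) : R := Ex mu (fun x => u x * linear_exp x y).

Lemma bmeas_linear_exp (y : T) : bmeas (fun x => linear_exp x y).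
Proof.
have bS : bmeas (fun x => \sum_(i < d) X i x * y ord0 i) by apply: bmeas_sum => i _; bm.
by rewrite /linear_exp; bm.
Qed.

(** One second-order estimate for two purposes: continuity, with [z] arbitrary, and difference
    quotients, with [z] on a coordinate line through [y]. *)
Lemma laplace_increment (u v : T -> R) (y z : T) (M b : R) : bmeas u -> bmeas v ->
  (forall x, `|u x * linear_exp x y| <= M) ->
  (forall x, (\sum_(i < d) X i x * (z ord0 i - y ord0 i)) / eps = v x) ->
  (forall x, `|v x| <= b) -> b <= 1 ->
  `|laplace u z - laplace u y - laplace (fun x => u x * v x) y| <= M * ((expR 1 + 1) * b ^+ 2).
Proof.
move=> bu bv hM hv hb b1; have be := bmeas_linear_exp.
rewrite /laplace -!ExB; [|by bm..].
have bz := be z; have by' := be y.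
apply: Ex_norm_le => [|x]; first by bm.
have -> : u x * linear_exp x z - u x * linear_exp x y - u x * v x * linear_exp x y =
    u x * linear_exp x y * (expR (v x) - (1 + v x)).
  have -> : linear_exp x z = linear_exp x y * expR (v x).
    have hS : \sum_(i < d) X i x * z ord0 i = \sum_(i < d) X i x * y ord0 i +
        \sum_(i < d) X i x * (z ord0 i - y ord0 i).
      by rewrite -big_split; apply: eq_bigr => i _ /=; rewrite -mulrDr addrC subrK.
    by rewrite /linear_exp hS mulrDl expRD hv.
  by ring.
rewrite normrM; apply: ler_pM => //; apply: (le_trans (expR_taylor2 (le_trans (hb x) b1))).
by rewrite ler_wpM2l ?addr_ge0 ?expR_ge0// lerXn2r ?nnegrE//; exact: le_trans (hb x).
Qed.

Lemma laplace_bound (u : T -> R) (y : T) : bmeas u -> exists2 M : R, 0 <= M & forall x, `|u x * linear_exp x y| <= M.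
Proof. by move=> bu; have be := bmeas_linear_exp y; apply: bmeas_bound; bm. Qed.

Lemma continuous_laplace (u : T -> R) : bmeas u -> continuous (laplace u).
Proof.
move=> bu y; have [M M0 hM] := laplace_bound y bu.
have [Mu Mu0 hMu] := bmeas_bound bu.
pose q := d%:R * B / eps; have q0 : 0 <= q by rewrite divr_ge0 ?mulr_ge0// ltW.
have key (z : T) : `|z - y| * (q + 1) <= 1 ->
    `|laplace u z - laplace u y| <= (M * (expR 1 + 2)) * (q + 1) * `|z - y|.
  move=> zy; pose v x := (\sum_(i < d) X i x * (z ord0 i - y ord0 i)) / eps.
  have bv : bmeas v.
    have bS : bmeas (fun x => \sum_(i < d) X i x * (z ord0 i - y ord0 i)) by apply: bmeas_sum => i _; bm.
    by rewrite /v; bm.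
  have hv x : `|v x| <= `|z - y| * (q + 1).
    apply: (@le_trans _ _ (`|z - y| * q)); last by rewrite ler_wpM2l// lerDl.
    rewrite /v normrM normfV (gtr0_norm eps0) mulrA ler_pM2r ?invr_gt0//.
    apply: (le_trans (ler_norm_sum _ _ _)).
    apply: (@le_trans _ _ (\sum_(i < d) B * `|z - y|)).
      apply: ler_sum => i _; rewrite normrM ler_pM//.
      have -> : z ord0 i - y ord0 i = (z - y) ord0 i by rewrite !mxE.
      exact: norm_coord_le.
    rewrite sumr_const card_ord -mulr_natl le_eqVlt; apply/orP; left; apply/eqP; ring.
  have h1 := laplace_increment bu bv hM (fun x => erefl) hv zy.
  set b := `|z - y| * (q + 1) in zy hv h1.
  have b0 : 0 <= b by rewrite mulr_ge0// addr_ge0.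
  have be := bmeas_linear_exp y.
  have h2 : `|laplace (fun x => u x * v x) y| <= M * b.
    apply: Ex_norm_le => [|x]; first by bm.
    by rewrite mulrAC normrM ler_pM.
  have -> : laplace u z - laplace u y =
    (laplace u z - laplace u y - laplace (fun x => u x * v x) y) + laplace (fun x => u x * v x) y by ring.
  apply: (le_trans (ler_normD _ _)); apply: (le_trans (lerD h1 h2)).
  have -> : M * (expR 1 + 2) * (q + 1) * `|z - y| = M * ((expR 1 + 1) * b + b) by rewrite /b; ring.
  rewrite -mulrDr ler_wpM2l// lerD2r ler_wpM2l ?addr_ge0 ?expR_ge0//.
  by rewrite expr2 ler_piMr.
have q1 : 0 < q + 1 by rewrite ltr_wpDl.
pose C := M * (expR 1 + 2) * (q + 1).
have C0 : 0 <= C by rewrite !mulr_ge0// ?addr_ge0 ?expR_ge0// ltW.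
by apply: (continuous_of_bound q1 C0) => z zy; exact: key.
Qed.

Lemma laplace_quotient (u : T -> R) (y : T) i : bmeas u ->
  h^-1 *: ((laplace u \o shift y) (h *: delta_mx ord0 i) - laplace u y) @[h --> 0^'] -->
  laplace (fun x => u x * (X i x / eps)) y.
Proof.
move=> bu; have [M M0 hM] := laplace_bound y bu.
pose q := B / eps + 1; have q0 : 0 < q by rewrite ltr_wpDl// divr_ge0// ltW.
apply: (@cvg_dnbhs0_linear _ _ _ (M * ((expR 1 + 1) * q ^+ 2)) q^-1); first by rewrite invr_gt0.
move=> h h0 hr; have be := bmeas_linear_exp y.
have hn : 0 < `|h| by rewrite normr_gt0.
pose v x := h * (X i x / eps).
have bv : bmeas v by have bXi := bX i; rewrite /v; bm.
have hv x : `|v x| <= `|h| * q.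
  rewrite normrM ler_wpM2l// normrM normfV (gtr0_norm eps0).
  by rewrite (@le_trans _ _ (B / eps))// ?lerDl// ler_pM2r ?invr_gt0.
have hq : `|h| * q <= 1 by rewrite -ler_pdivlMr// mul1r.
have vE x : (\sum_(j < d) X j x * ((h *: delta_mx ord0 i + y) ord0 j - y ord0 j)) / eps = v x.
  rewrite (bigD1 i)//= big1 ?addr0; last first.
    by move=> j ji; rewrite !mxE eqxx (negbTE ji) /= mulr0 add0r subrr mulr0.
  by rewrite !mxE !eqxx /= /v; ring.
have := laplace_increment bu bv hM vE hv hq.
have -> : laplace (fun x => u x * v x) y = h * laplace (fun x => u x * (X i x / eps)) y.
  have bXi := bX i; rewrite /laplace -ExZl; last by bm.
  by apply: eq_Ex => x; rewrite /v; ring.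
set l := laplace (fun x => u x * (X i x / eps)) y.
move=> hh; rewrite -(ler_pM2l hn) -normrM /= -[h^-1 *: _]/(h^-1 * _).
have -> : forall D : R, h * (h^-1 * D - l) = D - h * l by move=> D; field.
by apply: (le_trans hh); rewrite le_eqVlt; apply/orP; left; apply/eqP; ring.
Qed.

Lemma derivable_laplace (u : T -> R) (y : T) i : bmeas u ->
  derivable (laplace u) y (delta_mx ord0 i).
Proof. by move=> bu; apply: cvgP; exact: laplace_quotient. Qed.

Lemma partial_laplace (u : T -> R) i : bmeas u ->
  partial i (laplace u) = laplace (fun x => u x * (X i x / eps)).
Proof. by move=> bu; apply/funext => y; apply: cvg_lim => //; exact: laplace_quotient. Qed.

(** A partial derivative of a Laplace transform is the Laplace transform of another bounded
    weight. *)
Lemma is_Ck_laplace k (u : T -> R) : bmeas u -> is_Ck k (laplace u).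
Proof.
elim: k u => [|k IH] u bu; first exact: continuous_laplace.
split; [exact: continuous_laplace|by move=> i y; exact: derivable_laplace|].
by move=> i; rewrite partial_laplace//; apply: IH; have bXi := bX i; bm.
Qed.

End laplace.

(** If the set is empty or unbounded, its supremum is the default value 0. *)
Lemma sup_norm_ge0 {R : realType} {U : Type} (A : set U) (h : U -> R) :
  0 <= sup [set `|h x| | x in A].
Proof.
have [[[r Ar] ub]|/sup_out ->//] := pselect (has_sup [set `|h x| | x in A]).
by apply: le_trans (ub_le_sup ub Ar); case: Ar => x _ <-.
Qed.

Section smooth_on_Omega.
Context {R : realType} {d : nat}.
Local Notation T := 'rV[R]_d.
Variables (Omega : set T) (x0 : T) (s : nat).
Hypotheses (cO : compact Omega) (Ox0 : Omega x0).
Local Notation retr := (retr Omega x0).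
Implicit Types (f g F : T -> R) (mu nu : probability T R).

Lemma Cs_retr f : Cs s Omega f -> bmeas (fun x => f (retr x)).
Proof.
move=> [F [/is_Ck_continuous cF Ff]]; split.
  rewrite (_ : (fun x => f (retr x)) = (fun x => F (retr x))); last first.
    by apply/funext => x; rewrite Ff//; exact: retr_in.
  by apply: measurableT_comp; [exact: continuous_measurable_rV|exact: measurable_retr].
have [B B0 hB] := continuous_bounded cO cF; exists B => x.
by rewrite -Ff ?hB//; exact: retr_in.
Qed.

Lemma Ex_Cs mu f : mu Omega = 1%E -> Cs s Omega f ->
  \int[mu]_(x in Omega) f x = Ex mu (fun x => f (retr x)).
Proof.
move=> mu1 /Cs_retr bf; apply: (Ex_Omega cO mu1 bf) => x Ox.
by rewrite retrE.
Qed.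

Lemma Ck_sup_ge0 F : 0 <= Ck_sup s Omega F.
Proof. by apply: sumr_ge0 => beta _; exact: sup_norm_ge0. Qed.

(** The multi-index 0 contributes the sup norm on [Omega]. *)
Lemma Ck_sup_ge F x : is_Ck s F -> Omega x -> `|F x| <= Ck_sup s Omega F.
Proof.
move=> /is_Ck_continuous cF Ox; rewrite /Ck_sup (bigD1 [ffun=> ord0])/=; last first.
  by rewrite big1// => i _; rewrite ffunE.
apply: ler_wpDr; first by apply: sumr_ge0 => beta _; exact: sup_norm_ge0.
have -> : multi_partial [ffun=> (ord0 : 'I_s.+1)] F = F.
  by rewrite /multi_partial; elim: (enum _) => //= i e ->; rewrite ffunE.
apply: ub_le_sup; last by exists x.
have [B _ hB] := continuous_bounded cO cF.
by exists B => _ [y Oy <-]; exact: hB.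
Qed.

Lemma Cs_norm_ge0 f : Cs s Omega f -> 0 <= Cs_norm s Omega f.
Proof.
move=> [F hF]; apply: lb_le_inf; first by exists (Ck_sup s Omega F), F.
by move=> _ [G _ <-]; exact: Ck_sup_ge0.
Qed.

Lemma Cs_norm_ge f x : Cs s Omega f -> Omega x -> `|f x| <= Cs_norm s Omega f.
Proof.
move=> [F hF] Ox; apply: lb_le_inf; first by exists (Ck_sup s Omega F), F.
by move=> _ [G [sG Gf] <-]; rewrite -Gf//; exact: Ck_sup_ge.
Qed.

Lemma Cs_linear (a : R) f g : Cs s Omega f -> Cs s Omega g ->
  forall mu, mu Omega = 1%E ->
  \int[mu]_(x in Omega) (a * f x + g x) =
  a * (\int[mu]_(x in Omega) f x) + \int[mu]_(x in Omega) g x.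
Proof.
move=> sf sg mu mu1; have bf := Cs_retr sf; have bg := Cs_retr sg.
rewrite (Ex_Cs mu1 sf) (Ex_Cs mu1 sg) -ExZl// -ExD//; last by bm.
apply: (Ex_Omega cO mu1); first by bm.
by move=> x Ox; rewrite retrE.
Qed.

Lemma S_space_meas_diff mu nu : mu Omega = 1%E -> nu Omega = 1%E ->
  S_space s Omega (meas_diff Omega mu nu).
Proof.
move=> mu1 nu1; split; first split.
- move=> a f g sf sg; rewrite /meas_diff !Cs_linear//.
  by rewrite opprD addrACA -mulrBr.
- exists 2 => f sf; have bf := Cs_retr sf.
  rewrite /meas_diff (Ex_Cs mu1 sf) (Ex_Cs nu1 sf).
  have hf x : `|f (retr x)| <= Cs_norm s Omega f by apply: Cs_norm_ge => //; exact: retr_in.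
  apply: (le_trans (ler_normB _ _)); rewrite mulrDl mul1r.
  by apply: lerD; exact: Ex_norm_le.
- move=> e e0; exists (meas_diff Omega mu nu).
    exists mu, nu; split => //; [exact: OmegaC0..|by apply: (etrans mu1)].
  by move=> f sf; rewrite subrr normr0 mulr_ge0 ?Cs_norm_ge0// ltW.
Qed.

End smooth_on_Omega.

Section evaluation.
Context {R : realType} {d : nat}.
Local Notation T := 'rV[R]_d.
Variables (Omega : set T) (x0 : T) (eps L : R).
Hypotheses (cO : compact Omega) (Ox0 : Omega x0) (eps0 : 0 < eps).
Local Notation retr := (retr Omega x0).
Local Notation coord := (coord Omega x0).
Local Notation cost := (cost Omega x0).
Hypothesis cL : forall x y, 0 <= cost x y <= L.
Variable P : probability T R.
Hypothesis P1 : P Omega = 1%E.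
Local Notation f := (fun x => f_pot eps P P (retr x)).
Local Notation g := (fun x => g_pot eps P P (retr x)).
Local Notation gibbs := (gibbs eps cost f g).
Local Notation avg := (avg eps cost P f g).
Local Notation pot := (pot eps cost P f g).
Local Notation resolvent_eq := (resolvent_eq eps cost P f g).
Local Notation s := (smoothness d).
Implicit Types (mu nu : probability T R) (w h : T -> R).

Let sfg : schroedinger eps cost P P f g.
Proof. by have [] := potentials_spec cO Ox0 eps0 cL P1 P1. Qed.
Let bc : bmeas2 cost. Proof. exact: bmeas2_cost. Qed.
Let cC x y : cost x y = cost y x. Proof. exact: costC. Qed.
Let bX : forall i, bmeas (coord i). Proof. exact: bmeas_coord. Qed.
Let bf : bmeas f. Proof. by case: sfg. Qed.
Let bg : bmeas g. Proof. by case: sfg. Qed.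
Let bK : bmeas2 gibbs. Proof. exact: bmeas2_gibbs. Qed.
Let cE := @costE R d Omega x0.

Lemma coord_in i y : Omega y -> coord i y = y ord0 i.
Proof. by move=> Oy; rewrite -[LHS]/(retr y ord0 i) retrE. Qed.

Lemma gibbs_retr2 x y : gibbs x (retr y) = gibbs x y.
Proof. by rewrite !gibbsE (cost_retr Ox0) /= retrK. Qed.

Lemma xi_gibbs x y : Omega x -> Omega y -> xi eps P x y = gibbs x y.
Proof. by move=> Ox Oy; rewrite gibbsE /cost !retrE. Qed.

Lemma avg_retr h y : avg h (retr y) = avg h y.
Proof. by apply: eq_Ex => x; rewrite gibbs_retr2. Qed.

Lemma A_op_avg h w y : bmeas w -> (forall x, Omega x -> h x = w x) -> Omega y ->
  A_op eps Omega P h y = avg w y.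
Proof.
move=> bw hw Oy; apply: (Ex_Omega cO P1).
  by apply: bmeasM => //; exact: (bmeas_section2 y bK).
by move=> x Ox; rewrite xi_gibbs// hw.
Qed.

Lemma i_xi_pot mu nu y : mu Omega = 1%E -> nu Omega = 1%E -> Omega y ->
  i_xi eps P (meas_diff Omega mu nu) y = pot mu y - pot nu y.
Proof.
move=> mu1 nu1 Oy; have b := bmeas_section2 y bK.
rewrite /i_xi /meas_diff (Ex_Omega cO mu1 b); last by move=> x Ox; exact: xi_gibbs.
rewrite (Ex_Omega cO nu1 b); last by move=> x Ox; exact: xi_gibbs.
by rewrite /pot /dif; ring.
Qed.

(** On [Omega], every term of [w = pot mu - pot nu + A (A w)] is a Laplace transform times
    [weight g], and the second marginal equation makes [weight g] the inverse of the transform of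
    [W] under [P]. The extension is the resulting quotient, whose denominator is positive on the
    whole space. *)
Lemma resolvent_Cs mu nu w :
  resolvent_eq (fun y => pot mu y - pot nu y) w -> Cs s Omega w.
Proof.
move=> [bw _ we]; have [B B0 XB] := coord_bound cO Ox0.
pose W := weight coord eps f; have bW : bmeas W by exact: (bmeas_weight eps bX).
pose lap k u := laplace k coord eps u.
have lapE k u y : Omega y -> bmeas u -> Ex k (fun x => gibbs x y * u x) =
    lap k (fun x => W x * u x) y * weight coord eps g y.
  move=> Oy bu; rewrite /lap /laplace -ExZr; last first.
    by have be := bmeas_linear_exp eps bX y; bm.
  apply: eq_Ex => x; rewrite (gibbs_weight eps cE) -/W.
  have -> : expi coord eps x y = linear_exp coord eps x y.
    rewrite /expi.
    suff -> : inner coord x y = \sum_(i < d) coord i x * y ord0 i by [].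
    by apply: eq_bigr => i _; rewrite (coord_in _ Oy).
  by ring.
have lap1 k y : Omega y -> Ex k (fun x => gibbs x y) = lap k W y * weight coord eps g y.
  move=> Oy; have b1 : bmeas (fun _ : T => 1 : R) by bm.
  have := lapE k _ y Oy b1; rewrite (_ : (fun x => W x * 1) = W); last first.
    by apply/funext => x; rewrite mulr1.
  by move=> <-; apply: eq_Ex => x; rewrite mulr1.
have sl k u : bmeas u -> is_Ck s (lap k u) by move=> bu; exact: (is_Ck_laplace _ bX XB B0 eps0).
have bA : bmeas (avg w) by exact: bmeas_avg.
have Z0 y : lap P W y != 0.
  have bZ : bmeas (fun x => W x * linear_exp coord eps x y).
    by have be := bmeas_linear_exp eps bX y; bm.
  have [k k0 hk] : exists2 k : R, 0 < k & forall x, k <= W x * linear_exp coord eps x y.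
    have [M M0 hM] := bmeas_bound bf.
    have bS : bmeas (fun x => (f x - 2^-1 * \sum_(i < d) coord i x ^+ 2) / eps +
        (\sum_(i < d) coord i x * y ord0 i) / eps).
      have b1 : bmeas (fun x => \sum_(i < d) coord i x ^+ 2) by apply: bmeas_sum => i _; bm.
      have b2 : bmeas (fun x => \sum_(i < d) coord i x * y ord0 i) by apply: bmeas_sum => i _; bm.
      by bm.
    have [N N0 hN] := bmeas_bound bS.
    exists (expR (- N)) => [|x]; first exact: expR_gt0.
    rewrite /W weightE /linear_exp -expRD ler_expR.
    by have := hN x; rewrite ler_norml => /andP[].
  by apply: lt0r_neq0; apply: (lt_le_trans k0); rewrite -(Ex_cst P k); apply: le_Ex => //; bm.
pose F y := (lap mu W y + - lap nu W y + lap P (fun x => W x * avg w x) y) * (lap P W y)^-1.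
exists F; split.
  apply: is_CkM; last by apply: is_CkV => //; exact: sl.
  apply: is_CkD; last by apply: sl; bm.
  by apply: is_CkD; [exact: sl|apply: is_CkN; exact: sl].
move=> y Oy; have nrm : lap P W y * weight coord eps g y = 1.
  by rewrite -lap1//; exact: (schroedinger_gibbs2 eps0 bc cC cL y sfg).
have -> : w y = pot mu y - pot nu y + avg (avg w) y by rewrite -we subrK.
have -> : avg (avg w) y = lap P (fun x => W x * avg w x) y * weight coord eps g y.
  exact: lapE.
rewrite /pot /dif !lap1//.
have -> : weight coord eps g y = (lap P W y)^-1.
  by apply: (mulfI (Z0 y)); rewrite nrm divff.
rewrite /F; ring.
Qed.

(** [inv_one_sub_A2] chooses some solution on [Omega], and [resolvent_Cs] shows that there is one.
    Composed with the retraction, the chosen one solves the resolvent equation everywhere, because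
    [avg] and [pot] depend on the retracted point only. *)
Lemma M_form_resolvent mu nu : mu Omega = 1%E -> nu Omega = 1%E ->
  exists2 w, resolvent_eq (fun y => pot mu y - pot nu y) w &
    M_form eps Omega P (meas_diff Omega mu nu) (meas_diff Omega mu nu) = Ex mu w - Ex nu w.
Proof.
move=> mu1 nu1; set D := meas_diff Omega mu nu.
rewrite /M_form; case: asboolP => [_|[]]; last by split; exact: (S_space_meas_diff _ _ Ox0).
pose A := A_op eps Omega P.
pose H := [set h | [/\ Cs s Omega h, \int[P]_(x in Omega) h x = 0 &
  forall x, Omega x -> h x - A (A h) x = i_xi eps P D x]].
have hp y : pot mu (retr y) - pot nu (retr y) = pot mu y - pot nu y.
  by rewrite /pot /dif; congr (_ - _ - (_ - _)); apply: eq_Ex => x; rewrite gibbs_retr2.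
have exH : exists h, H h.
  have bp : bmeas (fun y => pot mu y - pot nu y).
    have b1 := bmeas_pot bX cE sfg mu; have b2 := bmeas_pot bX cE sfg nu; by bm.
  have p0 : Ex P (fun y => pot mu y - pot nu y) = 0.
    rewrite ExB; [|exact: (bmeas_pot bX cE sfg)..].
    by rewrite !(Ex_pot bX eps0 cE cL sfg) subrr.
  have [w rw] := resolvent_exists x0 bX eps0 cE cL sfg bp p0.
  have sw := resolvent_Cs rw; have [bw w0 we] := rw.
  exists w; split=> //; first by rewrite (Ex_Omega cO P1 bw).
  move=> x Ox; rewrite i_xi_pot// -we; congr (_ - _).
  apply: A_op_avg => //; first exact: bmeas_avg.
  by move=> y Oy; exact: A_op_avg.
have [sh h0 he] : H (inv_one_sub_A2 eps Omega P (i_xi eps P D)) := xgetPex _ exH.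
set h := inv_one_sub_A2 _ _ _ _ in sh h0 he *.
have bh := Cs_retr cO Ox0 sh.
exists (fun x => h (retr x)); last by rewrite /D /meas_diff (Ex_Cs cO Ox0 mu1 sh) (Ex_Cs cO Ox0 nu1 sh).
split=> //; first by rewrite -(Ex_Cs cO Ox0 P1 sh).
move=> y; rewrite -hp -[RHS]i_xi_pot//; [|exact: retr_in..].
rewrite -he; last exact: retr_in.
congr (_ - _); rewrite -avg_retr; apply/esym; apply: A_op_avg; [exact: bmeas_avg| |exact: retr_in].
move=> x Ox; apply: A_op_avg => // z Oz; by rewrite retrE.
Qed.

End evaluation.

(** * Expansions of the divergence *)

(** The arithmetic of [divergence_alternative]. The number [t] is the constant between two
    normalisations of a potential; it cancels since both measures integrating it have mass 1. *)
Lemma abs_combination {R : realType} (t n k1 k2 k3 a b c e u v Fm Gn fm gm hn kn FP GQ fp gp hq kq : R) :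
  `|a + b - (Fm + Gn)| <= k1 * n -> `|c + e - (fm + gm)| <= k2 * n ->
  `|u + v - (hn + kn)| <= k3 * n ->
  `|a + b - 2^-1 * (c + e + (u + v)) - (FP + GQ - 2^-1 * (fp + gp + (hq + kq))) -
    (Fm - 2^-1 * (fm + gm) - (FP - 2^-1 * (fp + gp)) +
     (Gn + t - 2^-1 * (hn + kn) - (GQ + t - 2^-1 * (hq + kq))))| <= (k1 + k2 + k3) * n.
Proof.
move=> e1 e2 e3; have := le_trans (normr_ge0 _) e1; have := le_trans (normr_ge0 _) e2.
have := le_trans (normr_ge0 _) e3; rewrite !mulrDl; move: e1 e2 e3.
generalize (k1 * n) (k2 * n) (k3 * n) => K1 K2 K3; rewrite !ler_norml.
by move=> /andP[? ?] /andP[? ?] /andP[? ?] ? ? ?; apply/andP; split; lra.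
Qed.

Section expansions_on_Omega.
Context {R : realType} {d : nat}.
Local Notation T := 'rV[R]_d.
Variables (Omega : set T) (x0 : T) (B theta eps L : R).
Hypotheses (cO : compact Omega) (Ox0 : Omega x0) (eps0 : 0 < eps).
Local Notation retr := (retr Omega x0).
Local Notation coord := (coord Omega x0).
Local Notation cost := (cost Omega x0).
Hypothesis cL : forall x y, 0 <= cost x y <= L.
Hypotheses (XB : forall i x, `|coord i x| <= B) (B0 : 0 <= B) (th0 : 0 < theta).
Hypothesis thdB : theta * (d%:R * B) <= 1 / 2.
Implicit Types (P Q mu nu : probability T R).

Let bX : forall i, bmeas (coord i). Proof. exact: bmeas_coord. Qed.
Let cE := @costE R d Omega x0.

Definition deviation P mu (h : T -> R) : R := Ex mu h - Ex P h.

(** The interface between analysis and probability: an error of order [p] in the moments of finitely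
    many weights, which are fixed before [mu] and [nu]. *)
Definition small_error p P Q (err : probability T R -> probability T R -> R) :=
  exists n (F : 'I_n -> T -> R) m (G : 'I_m -> T -> R) (K r0 : R),
  [/\ forall i, bmeas (F i), forall i, bmeas (G i), 0 <= K, 0 < r0 &
    forall mu nu (N : R), mu Omega = 1%E -> nu Omega = 1%E -> 0 <= N <= r0 ->
      (forall i, moments coord theta (F i) (deviation P mu) N) ->
      (forall i, moments coord theta (G i) (deviation Q nu) N) ->
      `|err mu nu| <= K * N ^+ p].

Lemma S_eps_potentials mu nu : mu Omega = 1%E -> nu Omega = 1%E ->
  S_eps eps mu nu =
  Ex mu (fun x => f_pot eps mu nu (retr x)) + Ex nu (fun x => g_pot eps mu nu (retr x)).
Proof.
move=> mu1 nu1; apply: (S_eps_dual cO Ox0 eps0 cL mu1 nu1).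
by have [] := potentials_spec cO Ox0 eps0 cL mu1 nu1.
Qed.

Lemma divergence_null P : P Omega = 1%E ->
  small_error 3 P P (fun mu nu => D_eps eps mu nu -
    eps / 2 * M_form eps Omega P (meas_diff Omega mu nu) (meas_diff Omega mu nu)).
Proof.
move=> P1; have [sP _] := potentials_spec cO Ox0 eps0 cL P1 P1.
set f := fun x => _ in sP; set g := fun x => _ in sP.
have [bf bg _ _] := sP.
pose phi := weight coord eps (fun x => (f x + g x) / 2).
have bphi : bmeas phi by apply: (bmeas_weight eps bX); bm.
have [K [r0 [K0 r00 h]]] := divergence_expansion x0 bX XB B0 th0 eps0 thdB cE cL sP.
pose F := tnth [tuple phi; (fun x => phi x * phi x)].
have bF i : bmeas (F i).
  by case: i => [[|[|i]] Hi]; [exact: bphi|exact: bmeasM|].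
exists 2, F, 2, F, K, r0; split=> // mu nu N mu1 nu1 N0 hF hG.
have [w rw ->] := M_form_resolvent cO Ox0 eps0 cL P1 mu1 nu1.
have [s1 _] := potentials_spec cO Ox0 eps0 cL mu1 nu1.
have [s2 _] := potentials_spec cO Ox0 eps0 cL mu1 mu1.
have [s3 _] := potentials_spec cO Ox0 eps0 cL nu1 nu1.
rewrite /D_eps !S_eps_potentials//.
apply: (h mu nu _ _ _ _ _ _ N w N0 s1 s2 s3 _ _ rw).
  by split; [exact: (hF (Ordinal (erefl : (0 < 2)%N)))|exact: (hF (Ordinal (erefl : (1 < 2)%N)))].
by split; [exact: (hG (Ordinal (erefl : (0 < 2)%N)))|exact: (hG (Ordinal (erefl : (1 < 2)%N)))].
Qed.

(** [first_order] is applied at [(P, Q)], [(P, P)] and [(Q, Q)]. The first expansion features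
    [g_pot eps P Q] where the statement has [f_pot eps Q P]; by uniqueness they differ by a constant
    [t] on [Omega]. *)
Lemma divergence_alternative P Q : P Omega = 1%E -> Q Omega = 1%E ->
  small_error 2 P Q (fun mu nu => D_eps eps mu nu - D_eps eps P Q -
    (meas_diff Omega mu P (psi eps P Q) + meas_diff Omega nu Q (psi eps Q P))).
Proof.
move=> P1 Q1; have [sPQ _] := potentials_spec cO Ox0 eps0 cL P1 Q1.
have [sPP _] := potentials_spec cO Ox0 eps0 cL P1 P1.
have [sQQ _] := potentials_spec cO Ox0 eps0 cL Q1 Q1.
have [sQP _] := potentials_spec cO Ox0 eps0 cL Q1 P1.
have [K1 [r1 [K10 r10 h1]]] := first_order x0 bX XB B0 th0 eps0 thdB cE cL sPQ.
have [K2 [r2 [K20 r20 h2]]] := first_order x0 bX XB B0 th0 eps0 thdB cE cL sPP.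
have [K3 [r3 [K30 r30 h3]]] := first_order x0 bX XB B0 th0 eps0 thdB cE cL sQQ.
have bc := bmeas2_cost cO Ox0.
have cC := costC Omega x0.
have [t [_ ht]] := schroedinger_unique x0 eps0 bc cL sPQ (schroedinger_sym sQP).
have [bf bg _ _] := sPQ; have [bf1 bg1 _ _] := sPP; have [bf2 bg2 _ _] := sQQ.
have [_ bf3 _ _] := schroedinger_sym sQP.
pose W := weight coord eps.
pose F := tnth [tuple W (fun x => f_pot eps P Q (retr x));
  W (fun x => f_pot eps P P (retr x)); W (fun x => g_pot eps P P (retr x))].
pose G := tnth [tuple W (fun x => g_pot eps P Q (retr x));
  W (fun x => f_pot eps Q Q (retr x)); W (fun x => g_pot eps Q Q (retr x))].
have bF i : bmeas (F i).
  case: i => [[|[|[|i]]] Hi]; [exact: (bmeas_weight eps bX bf)|exact: (bmeas_weight eps bX bf1)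
    |exact: (bmeas_weight eps bX bg1)|by []].
have bG i : bmeas (G i).
  case: i => [[|[|[|i]]] Hi]; [exact: (bmeas_weight eps bX bg)|exact: (bmeas_weight eps bX bf2)
    |exact: (bmeas_weight eps bX bg2)|by []].
exists 3, F, 3, G, (K1 + K2 + K3), (Num.min r1 (Num.min r2 r3)); split=> //.
- by rewrite !addr_ge0.
- by rewrite !lt_min r10 r20.
move=> mu nu N mu1 nu1; rewrite !le_min => /andP[N0 /andP[Nr1 /andP[Nr2 Nr3]]] hF hG.
have F1 := hF (Ordinal (erefl : (0 < 3)%N)); have F2 := hF (Ordinal (erefl : (1 < 3)%N)).
have F3 := hF (Ordinal (erefl : (2 < 3)%N)).
have G1 := hG (Ordinal (erefl : (0 < 3)%N)); have G2 := hG (Ordinal (erefl : (1 < 3)%N)).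
have G3 := hG (Ordinal (erefl : (2 < 3)%N)).
have [s1 _] := potentials_spec cO Ox0 eps0 cL mu1 nu1.
have [s2 _] := potentials_spec cO Ox0 eps0 cL mu1 mu1.
have [s3 _] := potentials_spec cO Ox0 eps0 cL nu1 nu1.
have N1 : 0 <= N <= r1 by rewrite N0.
have N2 : 0 <= N <= r2 by rewrite N0.
have N3 : 0 <= N <= r3 by rewrite N0.
have e1 := h1 mu nu _ _ N N1 s1 F1 G1.
have e2 := h2 mu mu _ _ N N2 s2 F2 F3.
have e3 := h3 nu nu _ _ N N3 s3 G2 G3.
have mPQ (k : probability T R) : k Omega = 1%E -> \int[k]_(x in Omega) psi eps P Q x =
    Ex k (fun x => f_pot eps P Q (retr x)) -
    2^-1 * (Ex k (fun x => f_pot eps P P (retr x)) + Ex k (fun x => g_pot eps P P (retr x))).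
  move=> k1; have bh : bmeas (fun x => f_pot eps P Q (retr x) -
      2^-1 * (f_pot eps P P (retr x) + g_pot eps P P (retr x))) by bm.
  rewrite (Ex_Omega cO k1 bh); last by move=> x Ox; rewrite /psi retrE.
  rewrite ExB; [|exact: bf|by bm]; rewrite ExZl; last by bm.
  by rewrite ExD.
have mQP (k : probability T R) : k Omega = 1%E -> \int[k]_(x in Omega) psi eps Q P x =
    Ex k (fun x => g_pot eps P Q (retr x)) + t -
    2^-1 * (Ex k (fun x => f_pot eps Q Q (retr x)) + Ex k (fun x => g_pot eps Q Q (retr x))).
  move=> k1; have bt : bmeas (fun _ : T => t) by exact: bmeas_cst.
  have bh : bmeas (fun x => (g_pot eps P Q (retr x) + t) -
      2^-1 * (f_pot eps Q Q (retr x) + g_pot eps Q Q (retr x))) by bm.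
  rewrite (Ex_Omega cO k1 bh); last by move=> x Ox; rewrite /psi -ht retrE.
  rewrite ExB; [|by bm|by bm]; rewrite ExZl; last by bm.
  by rewrite !ExD// Ex_cst.
rewrite /meas_diff !mPQ// !mQP// /D_eps !S_eps_potentials//.
exact: (abs_combination t _ _ _ _ _ _ e1 e2 e3).
Qed.

End expansions_on_Omega.

(** * Sampling *)

Section empirical_measures.
Context {R : realType} {d : nat} {dW} {W : measurableType dW}.
Local Notation T := 'rV[R]_d.
Variable Pr : probability W R.
Variables (X : nat -> {RV Pr >-> T}) (P : probability T R).
Implicit Types (h : T -> R) (w : W) (n : nat).

Lemma empirical_setE n w (A : set T) : (0 < n)%N ->
  empirical X n w A = (n%:R^-1%:E * \sum_(i < n) \d_(X i w) A)%E.
Proof.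
move=> n0; have eS : msum (fun i : nat => \d_(X i w)) n [set: T] = n%:R%:E :> \bar R.
  apply: (@etrans _ _ (\sum_(i < n) 1%E)%E); last by rewrite sumEFin sumr_const card_ord.
  by apply: eq_bigr => i _; exact: diracT.
rewrite /empirical /= /mnormalize [X in (X == 0%E) || _]eS [X in X == +oo%E]eS.
by rewrite eqe pnatr_eq0 eqn0Ngt n0 /= [X in fine X]eS muleC.
Qed.

Lemma empirical_full n w (A : set T) : (0 < n)%N -> (forall i, A (X i w)) ->
  empirical X n w A = 1%E.
Proof.
move=> n0 AX; rewrite empirical_setE// (eq_bigr (fun=> 1%E)); last first.
  by move=> i _; rewrite diracE mem_set.
by rewrite sumEFin sumr_const card_ord -EFinM mulVf// pnatr_eq0 -lt0n.
Qed.

Lemma Ex_empirical n w h : (0 < n)%N -> bmeas h ->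
  Ex (empirical X n w) h = n%:R^-1 * \sum_(i < n) h (X i w).
Proof.
move=> n0 bh; have [B B0 hB] := bmeas_bound bh.
have pos k : bmeas k -> (forall x, 0 <= k x) ->
    Ex (empirical X n w) k = n%:R^-1 * \sum_(i < n) k (X i w).
  move=> bk k0; apply: EFin_inj; rewrite EFin_Ex//.
  have n1 : 0 <= n%:R^-1 :> R by rewrite invr_ge0.
  have mk : measurable_fun setT (EFin \o k) by apply/measurable_EFinP; exact: bmeas_meas.
  have k0' x : setT x -> (0 <= (EFin \o k) x)%E by rewrite lee_fin.
  pose S : {measure set T -> \bar R} := msum (fun i : nat => \d_(X i w)) n.
  rewrite (@eq_measure_integral _ _ _ setT (mscale (NngNum n1) S)); last first.
    by move=> A mA _; exact: empirical_setE.
  rewrite (ge0_integral_mscale _ measurableT _ mk k0').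
  rewrite (ge0_integral_measure_sum _ measurableT k0' mk) EFinM; congr (_ * _)%E.
  rewrite -sumEFin; apply: eq_bigr => i _.
  by rewrite integral_dirac// diracT mul1e.
(* The integral against a sum of measures splits for nonnegative functions; adding the bound [B]
   reduces to that case. *)
have bB : bmeas (fun x => h x + B) by have bc := @bmeas_cst _ T R B; bm.
have := pos _ bB; rewrite ExD//; last exact: bmeas_cst.
rewrite Ex_cst big_split /= mulrDr sumr_const card_ord -[B *+ n]mulr_natl mulrA mulVf; last first.
  by rewrite pnatr_eq0 -lt0n.
rewrite mul1r => /(_ _)/addIr; apply => x.
by have := hB x; rewrite ler_norml => /andP[? _]; lra.
Qed.

Hypothesis iX : iid X P.

Let mX i : measurable_fun setT (X i). Proof. exact: measurable_funP. Qed.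

Lemma Ex_sample i h : bmeas h -> Ex Pr (fun w => h (X i w)) = Ex P h.
Proof. by apply: Ex_pushforward => // A; exact: iX.2. Qed.

(** Independence identifies the joint law with the product on rectangles, and a product measure is
    determined there. *)
Lemma Ex_sample_pair i j (K : T -> T -> R) : i != j -> bmeas2 K ->
  Ex Pr (fun w => K (X i w) (X j w)) = Ex P (fun x => Ex P (K x)).
Proof.
move=> ij bK; rewrite -(Ex_prod1 P P bK).
pose Y w := (X i w, X j w).
have mY : measurable_fun setT Y by exact: measurable_fun_pair.
have [PY PYE] : exists M : {measure set (T * T) -> \bar R}, forall A, M A = Pr (Y @^-1` A).
  by unshelve eexists (pushforward Pr Y : {measure set (T * T) -> \bar R}).
apply: (Ex_pushforward mY _ bK) => A mA; rewrite -PYE.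
apply/esym; apply: (product_measure_unique _ mA) => {A mA} A B mA mB; rewrite PYE.
pose C l := if l == i then A else B.
have mC l : measurable (C l) by rewrite /C; case: ifP.
have Ci : C i = A by rewrite /C eqxx.
have Cj : C j = B by rewrite /C eq_sym (negbTE ij).
have := iX.1 [fset i; j]%fset C mC.
rewrite big_fsetU1 /=; last by rewrite inE.
rewrite big_seq_fset1 Ci Cj -(iX.2 i A mA) -(iX.2 j B mB) => <-; apply: (congr1 Pr).
apply/seteqP; split => w /=.
  by move=> [Aw Bw] l /=; rewrite !inE => /orP[/eqP ->|/eqP ->]; rewrite ?Ci ?Cj.
move=> h; split.
  by have := h i; rewrite /= !inE eqxx Ci => /(_ isT).
by have := h j; rewrite /= !inE eqxx orbT Cj => /(_ isT).
Qed.

(** Pairwise independence kills the cross terms, so the second moment of the centred sum is at most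
    [n M ^ 2]. A weighted mean inequality, in place of Cauchy-Schwarz, leads to the first absolute
    moment. *)
Lemma Ex_deviation_empirical n h (M : R) : (0 < n)%N -> bmeas h -> 0 < M ->
  (forall x, `|h x| <= M) ->
  Ex Pr (fun w => `|Ex (empirical X n w) h - Ex P h|) <= M / Num.sqrt n%:R.
Proof.
move=> n0 bh M0 hM; set a := Ex P h.
pose k x := h x - a.
have bk : bmeas k by have bc := @bmeas_cst _ T R a; rewrite /k; bm.
have k0 : Ex P k = 0 by rewrite ExB ?Ex_cst ?subrr//; exact: bmeas_cst.
have bkX i : bmeas (fun w => k (X i w)) by exact: bmeas_comp (mX i) bk.
have nR : 0 < n%:R :> R by rewrite ltr0n.
have devE w : Ex (empirical X n w) h - a = n%:R^-1 * \sum_(i < n) k (X i w).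
  by rewrite Ex_empirical// /k sumrB sumr_const card_ord mulrBr -[a *+ n]mulr_natl mulKf ?lt0r_neq0.
pose S w := \sum_(i < n) k (X i w).
have bS : bmeas S by apply: bmeas_sum => i _.
have k2 : Ex P (fun x => k x ^+ 2) <= M ^+ 2.
  have -> : Ex P (fun x => k x ^+ 2) = Ex P (fun x => h x ^+ 2) - a ^+ 2.
    have bh2 : bmeas (fun x => h x ^+ 2) by bm.
    have bah : bmeas (fun x => 2 * a * h x) by have bc := @bmeas_cst _ T R (2 * a); bm.
    have bc := @bmeas_cst _ T R (a ^+ 2).
    rewrite (eq_Ex P (g := fun x => h x ^+ 2 - 2 * a * h x + a ^+ 2)); last by move=> x; rewrite /k; ring.
    rewrite ExD//; last by bm.
    rewrite ExB// ExZl// Ex_cst -/a; ring.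
  have := sqr_ge0 a; suff : Ex P (fun x => h x ^+ 2) <= M ^+ 2 by lra.
  apply: Ex_le; first by bm.
  by move=> x; rewrite -(real_normK (num_real (h x))) lerXn2r ?nnegrE ?(ltW M0).
have S2 : Ex Pr (fun w => S w ^+ 2) <= n%:R * M ^+ 2.
  have -> : Ex Pr (fun w => S w ^+ 2) = \sum_(i < n) \sum_(j < n) Ex Pr (fun w => k (X i w) * k (X j w)).
    rewrite (eq_Ex Pr (g := fun w => \sum_(i < n) \sum_(j < n) k (X i w) * k (X j w))); last first.
      by move=> w; rewrite expr2 mulr_suml; apply: eq_bigr => i _; rewrite mulr_sumr.
    rewrite Ex_sum; last by move=> i; apply: bmeas_sum => j _; bm.
    by apply: eq_bigr => i _; rewrite Ex_sum// => j; bm.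
  rewrite [leRHS](_ : _ = \sum_(i < n) M ^+ 2); last by rewrite sumr_const card_ord mulr_natl.
  apply: ler_sum => i _; rewrite (bigD1 i)//= big1 ?addr0; last first.
    move=> j ji; have b2 : bmeas2 (fun x y => k x * k y) by rewrite /bmeas2; bm.
    rewrite (Ex_sample_pair (K := fun x y => k x * k y)) 1?eq_sym//.
    rewrite -[RHS](Ex_cst P 0); apply: eq_Ex => x; by rewrite ExZl// k0 mulr0.
  rewrite (Ex_sample i (h := fun x => k x * k x)); last by bm.
  by apply: le_trans k2; rewrite le_eqVlt; apply/orP; left; apply/eqP; apply: eq_Ex => x; rewrite expr2.
(* |z| <= (z^2 / c + c) / 2 with c = M / sqrt n *)
set q := Num.sqrt n%:R; have q0 : 0 < q by rewrite sqrtr_gt0.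
have qn : q ^+ 2 = n%:R by rewrite sqr_sqrtr// ltW.
pose c := M / q; have c0 : 0 < c by rewrite divr_gt0.
have am (x y : R) : 0 < y -> x <= x ^+ 2 / (y * 2) + y / 2.
  move=> y0; have y20 : 0 < y * 2 by rewrite mulr_gt0.
  rewrite -(ler_pM2r y20) mulrDl divfK; last exact: lt0r_neq0.
  have -> : y / 2 * (y * 2) = y ^+ 2 by field.
  by have := sqr_ge0 (x - y); rewrite sqrrB; lra.
have bS2 : bmeas (fun w => S w ^+ 2 * (n%:R ^+ 2 * c * 2)^-1).
  by have bc := @bmeas_cst _ W R (n%:R ^+ 2 * c * 2)^-1; bm.
have bc2 := @bmeas_cst _ W R (c / 2).
apply: (@le_trans _ _ (Ex Pr (fun w => S w ^+ 2 * (n%:R ^+ 2 * c * 2)^-1 + c / 2))).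
  have bcn := @bmeas_cst _ W R n%:R^-1.
  apply: le_Ex; [|by bm|].
    rewrite (_ : (fun w => _) = (fun w => `|n%:R^-1 * S w|)); first by bm.
    by apply/funext => w; rewrite devE.
  move=> w; rewrite devE -/(S w); set z := n%:R^-1 * S w.
  have -> : S w ^+ 2 * (n%:R ^+ 2 * c * 2)^-1 = `|z| ^+ 2 / (c * 2).
    by rewrite real_normK ?num_real// /z; field; rewrite !lt0r_neq0.
  exact: am.
rewrite ExD// Ex_cst ExZr; last by bm.
have h1 : Ex Pr (fun w => S w ^+ 2) * (n%:R ^+ 2 * c * 2)^-1 <= n%:R * M ^+ 2 * (n%:R ^+ 2 * c * 2)^-1.
  rewrite ler_wpM2r// invr_ge0 mulr_ge0//; apply: mulr_ge0; last exact: ltW.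
  by rewrite exprn_ge0.
have h2 : n%:R * M ^+ 2 * (n%:R ^+ 2 * c * 2)^-1 = c / 2.
  by rewrite -qn /c; field; rewrite !lt0r_neq0.
by rewrite /c in h1 h2 *; lra.
Qed.

End empirical_measures.

Section concentration.
Context {R : realType} {d : nat} {dW} {W : measurableType dW}.
Local Notation T := 'rV[R]_d.
Variable Pr : probability W R.
Variables (co : 'I_d -> T -> R) (B theta : R).
Hypotheses (bX : forall i, bmeas (co i)) (XB : forall i x, `|co i x| <= B).
Hypotheses (B0 : 0 < B) (th0 : 0 < theta) (thdB : theta * (d%:R * B) <= 1 / 2).
Implicit Types (P : probability T R) (Ms : nat -> W -> probability T R) (s : nat -> R).

(* An L^1 rate of convergence [s k] for all the monomial moments at once. *)
Definition concentrates P Ms s := forall n (F : 'I_n -> T -> R), (forall i, bmeas (F i)) ->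
  exists (Z : nat -> W -> \bar R) (C : R),
  [/\ 0 <= C, forall k, measurable_fun setT (Z k), forall k w, (0 <= Z k w)%E,
    \forall k \near \oo, (\int[Pr]_w Z k w <= (C * s k)%:E)%E &
    \forall k \near \oo, forall w (r : R), (Z k w <= r%:E)%E ->
      forall i, moments co theta (F i) (deviation P (Ms k w)) r].

Lemma concentrates_cst P : concentrates P (fun _ _ => P) (fun=> 0).
Proof.
move=> n F bF; exists (fun _ _ => 0%E), 0; split=> //.
- by near=> k; rewrite integral0 mulr0.
near=> k => w r; rewrite lee_fin => r0 i J; rewrite big1// => j _.
by rewrite big1 ?mulr0// => t _; rewrite /deviation subrr normr0.
Unshelve. all: by end_near. Qed.

Lemma concentrates_le P Ms s s' : (\forall k \near \oo, s k <= s' k) ->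
  concentrates P Ms s -> concentrates P Ms s'.
Proof.
move=> ss h n F bF; have [Z [C [C0 mZ Z0 h1 h2]]] := h n F bF.
exists Z, C; split=> //; near=> k.
apply: (@le_trans _ _ (C * s k)%:E); first by near: k.
by rewrite lee_fin ler_wpM2l//; near: k.
Unshelve. all: by end_near. Qed.

Lemma concentrates_subseq P Ms s (m : nat -> nat) : m n @[n --> \oo] --> \oo ->
  concentrates P Ms s -> concentrates P (fun k => Ms (m k)) (fun k => s (m k)).
Proof.
move=> moo h n F bF; have [Z [C [C0 mZ Z0 h1 h2]]] := h n F bF.
by exists (fun k => Z (m k)), C; split=> //; [exact: (moo _ h1)|exact: (moo _ h2)].
Qed.

(** In expectation the words of degree [j] contribute at most a constant times
    [(theta d B) ^ j / sqrt k], a geometric series in [j]. Summing over the weights as well lets a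
    single variable serve all of them. *)
Lemma concentrates_empirical P (X : nat -> {RV Pr >-> T}) : iid X P ->
  concentrates P (empirical X) (fun k => (Num.sqrt k%:R)^-1).
Proof.
move=> iX n F bF.
have [M M0 hM] : exists2 M : R, 0 < M & forall i x, `|F i x| <= M.
  have /choice[b hb] : forall i, exists b : R, 0 <= b /\ forall x, `|F i x| <= b.
    by move=> i; have [b b0 hb] := bmeas_bound (bF i); exists b.
  exists (1 + \sum_i b i).
    by rewrite ltr_pwDl// sumr_ge0// => i _; case: (hb i).
  move=> i x; apply: (le_trans ((hb i).2 x)); rewrite (bigD1 i)//= addrCA lerDl addr_ge0//.
  by apply: sumr_ge0 => j _; case: (hb j).
have bm' i j (t : {ffun 'I_j -> 'I_d}) : bmeas (fun x => F i x * monom co t x).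
  by have := bmeas_monom bX t; have := bF i; bm.
(* The explicit mean, instead of the integral against [empirical], makes measurability in [w]
   visible; both agree for [k > 0]. *)
pose dev k w h := k%:R^-1 * (\sum_(l < k) h (X l w)) - Ex P h : R.
have mdev k h : bmeas h -> bmeas (fun w => `|dev k w h|).
  move=> bh; have bs : bmeas (fun w => \sum_(l < k) h (X l w)).
    by apply: bmeas_sum => l _; apply: bmeas_comp bh; exact: measurable_funP.
  by have b1 := @bmeas_cst _ W R k%:R^-1; have b2 := @bmeas_cst _ W R (Ex P h); rewrite /dev; bm.
pose u j k w := theta ^+ j *
  (\sum_(i < n) \sum_(t : {ffun 'I_j -> 'I_d}) `|dev k w (fun x => F i x * monom co t x)|).
have bu j k : bmeas (u j k).
  apply: bmeasM; first exact: bmeas_cst.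
  by apply: bmeas_sum => i _; apply: bmeas_sum => t _; exact: mdev.
have u0 j k w : 0 <= u j k w.
  rewrite mulr_ge0 ?exprn_ge0 ?(ltW th0)//.
  by apply: sumr_ge0 => i _; apply: sumr_ge0.
pose Z k w := (\sum_(j <oo) (u j k w)%:E)%E.
have mu_ j k : measurable_fun setT (fun w => (u j k w)%:E).
  by apply/measurable_EFinP; exact: bmeas_meas.
exists Z, (2 * (n%:R * M)); split.
- by rewrite !mulr_ge0// ltW.
- move=> k; rewrite /Z.
  rewrite (_ : (fun w => _) = (fun w => \sum_(j <oo | j \in xpredT) (u j k w)%:E)%E)//.
  by apply: ge0_emeasurable_sum => // j w _ _; rewrite lee_fin.
- by move=> k w; apply: nneseries_ge0 => j _ _; rewrite lee_fin.
- exists 1%N => // k /= k0.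
  rewrite (integral_nneseries _ measurableT (fun j => mu_ j k)); last first.
    by move=> j w _; rewrite lee_fin.
  set q := (Num.sqrt k%:R)^-1; have q0 : 0 <= q by rewrite invr_ge0 sqrtr_ge0.
  have uE j : Ex Pr (u j k) <= n%:R * M * q * (1 / 2) ^+ j.
    rewrite ExZl; last by apply: bmeas_sum => i _; apply: bmeas_sum => t _; exact: mdev.
    rewrite Ex_sum; last by move=> i; apply: bmeas_sum => t _; exact: mdev.
    apply: (@le_trans _ _ (theta ^+ j * (\sum_(i < n) \sum_(t : {ffun 'I_j -> 'I_d}) M * B ^+ j * q))).
      rewrite ler_wpM2l ?exprn_ge0 ?(ltW th0)//; apply: ler_sum => i _.
      rewrite Ex_sum; last by move=> t; exact: mdev.
      apply: ler_sum => t _.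
      have := Ex_deviation_empirical iX k0 (bm' i j t) (mulr_gt0 M0 (exprn_gt0 j B0)).
      rewrite (eq_Ex Pr (g := fun w => `|dev k w (fun x => F i x * monom co t x)|)).
        apply; move=> x; rewrite normrM ler_pM//.
        exact: monom_bound.
      by move=> w; rewrite Ex_empirical.
    rewrite sumr_const card_ord sumr_const card_ffun !card_ord.
    rewrite -[_ *+ (_ ^ _)]mulr_natr natrX -[_ *+ n]mulr_natr.
    have -> : theta ^+ j * (M * B ^+ j * q * d%:R ^+ j * n%:R) =
      n%:R * M * q * (theta * (d%:R * B)) ^+ j by rewrite !exprMn; ring.
    rewrite ler_wpM2l ?mulr_ge0 ?(ltW M0)// lerXn2r ?nnegrE ?mulr_ge0 ?divr_ge0 ?ler0n ?(ltW th0) ?(ltW B0)//.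
  apply: lime_le.
    by apply: is_cvg_nneseries => j _ _; apply: integral_ge0 => w _; rewrite lee_fin.
  near=> J; rewrite big_mkord (eq_bigr (fun j : 'I_J => (Ex Pr (u j k))%:E)); last first.
    by move=> j _; rewrite EFin_Ex.
  rewrite sumEFin lee_fin; apply: (le_trans (ler_sum _ (fun (j : 'I_J) _ => uE j))).
  rewrite -mulr_sumr (_ : 2 * (n%:R * M) * q = n%:R * M * q * 2); last by ring.
  rewrite ler_wpM2l ?mulr_ge0 ?(ltW M0)//.
  exact: sum_half_le.
- exists 1%N => // k /= k0 w r Zr i J.
  rewrite -lee_fin; apply: le_trans Zr.
  apply: (@le_trans _ _ (\sum_(0 <= j < J) (u j k w)%:E)%E); last first.
    by apply: nneseries_lim_ge => j _ _; rewrite lee_fin.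
  rewrite big_mkord sumEFin lee_fin; apply: ler_sum => j _.
  rewrite ler_wpM2l ?exprn_ge0 ?(ltW th0)// (bigD1 i)//=.
  apply: (@le_trans _ _ (\sum_(t : {ffun 'I_j -> 'I_d}) `|dev k w (fun x => F i x * monom co t x)|)).
    by apply: ler_sum => t _; rewrite /deviation Ex_empirical.
  by rewrite lerDl; apply: sumr_ge0 => l _; apply: sumr_ge0.
Unshelve. all: by end_near. Qed.

End concentration.

Lemma markov_ge {dW} {W : measurableType dW} {R : realType} (Pr : probability W R)
    (Z : W -> \bar R) (t : R) : measurable_fun setT Z -> (forall w, 0 <= Z w)%E -> 0 < t ->
  (t%:E * Pr [set w | t%:E <= Z w] <= \int[Pr]_w Z w)%E.
Proof.
move=> mZ Z0 t0.
have := @le_integral_comp_abse _ _ _ Pr setT measurableT Z t id (@measurable_id _ _ setT).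
rewrite setTI => h; have {}h := h (fun r r0 => r0) (fun x y _ _ xy => xy) mZ t0.
have zE w : `|Z w|%E = Z w by rewrite gee0_abs.
move: h; under eq_integral do rewrite zE; apply: le_trans.
rewrite lee_pmul2l ?lte_fin//; apply/le_measure; rewrite ?inE.
- by rewrite -[X in measurable X]setTI; exact: emeasurable_fun_c_infty.
- rewrite (_ : [set w | _] = [set w | (t%:E <= Z w)%E]); last first.
    by apply/seteqP; split => w /=; rewrite zE.
  by rewrite -[X in measurable X]setTI; exact: emeasurable_fun_c_infty.
- by move=> w /=; rewrite zE.
Qed.

Section stochastic_order.
Context {R : realType} {d : nat} {dW} {W : measurableType dW}.
Local Notation T := 'rV[R]_d.
Variables (Pr : probability W R) (Omega : set T) (x0 : T) (theta : R).
Implicit Types (P Q : probability T R) (Ms Ns : nat -> W -> probability T R).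

(** At the threshold [t = S / eta] Markov's inequality leaves a probability of at most [C eta <= e].
    Off that event the error is at most [K t ^ (p + 1)], and its quotient by [S ^ p] is
    [K S / eta ^ (p + 1)], which tends to 0. *)
Lemma small_error_o_in_prob p P Q err Ms Ns (S a : nat -> R) (N : set W) :
  small_error Omega x0 theta p.+1 P Q err ->
  concentrates Pr (coord Omega x0) theta P Ms S ->
  concentrates Pr (coord Omega x0) theta Q Ns S ->
  measurable N -> Pr N = 0%E ->
  (\forall k \near \oo, forall w, ~ N w -> Ms k w Omega = 1%E /\ Ns k w Omega = 1%E) ->
  (\forall k \near \oo, 0 < S k) -> S k @[k --> \oo] --> (0 : R) ->
  (\forall k \near \oo, a k = S k ^+ p) ->
  o_in_prob Pr (fun k w => err (Ms k w) (Ns k w)) a.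
Proof.
move=> [n [F [m [G [K [r0 [bF bG K0 r00 herr]]]]]]] cM cN mN N0 sup S0 Slim aS.
have [Z1 [C1 [C10 mZ1 Z10 I1 H1]]] := cM n F bF.
have [Z2 [C2 [C20 mZ2 Z20 I2 H2]]] := cN m G bG.
move=> delta delta0.
suff small : forall e : R, 0 < e -> \forall k \near \oo,
    (mu_ext Pr [set w | (delta < `|err (Ms k w) (Ns k w) / a k|)%R] <= e%:E)%E.
  have fin : \forall k \near \oo,
      mu_ext Pr [set w | delta < `|err (Ms k w) (Ns k w) / a k|] \is a fin_num.
    near=> k; rewrite ge0_fin_numE ?mu_ext_ge0//; apply: le_lt_trans (ltry 1).
    by near: k; exact: small.
  apply/fine_cvgP; split=> //; apply/cvgrPdist_le => e e0; near=> k.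
  rewrite sub0r normrN ger0_norm ?fine_ge0 ?mu_ext_ge0//= -lee_fin fineK.
    by near: k; exact: small.
  by near: k.
move=> e e0; pose C := C1 + C2.
have C0 : 0 <= C by rewrite addr_ge0.
pose eta := e / (C + 1).
have eta0 : 0 < eta by rewrite divr_gt0// ltr_wpDl.
have Sr : \forall k \near \oo, S k <= r0 * eta.
  by apply: cvgr_le Slim _ _; rewrite mulr_gt0.
have Sd : \forall k \near \oo, K * S k <= delta * eta ^+ p.+1.
  have : K * S k @[k --> \oo] --> K * 0 by exact: cvgMr.
  by rewrite mulr0 => c; apply: cvgr_le c _ _; rewrite mulr_gt0// exprn_gt0.
near=> k.
have Sk : 0 < S k by near: k.
have ak : a k = S k ^+ p by near: k.
have Srk : S k <= r0 * eta by near: k.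
have Sdk : K * S k <= delta * eta ^+ p.+1 by near: k.
have supk : forall w, ~ N w -> Ms k w Omega = 1%E /\ Ns k w Omega = 1%E by near: k.
have h1 : forall w (r : R), (Z1 k w <= r%:E)%E -> forall i,
   moments (coord Omega x0) theta (F i) (deviation P (Ms k w)) r by near: k.
have h2 : forall w (r : R), (Z2 k w <= r%:E)%E -> forall i,
   moments (coord Omega x0) theta (G i) (deviation Q (Ns k w)) r by near: k.
have i1 : (\int[Pr]_w Z1 k w <= (C1 * S k)%:E)%E by near: k.
have i2 : (\int[Pr]_w Z2 k w <= (C2 * S k)%:E)%E by near: k.
pose t := S k / eta; have t0 : 0 < t by rewrite divr_gt0.
pose Z w := (Z1 k w + Z2 k w)%E.
have mZ : measurable_fun setT Z by exact: emeasurable_funD.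
have Z0 w : (0 <= Z w)%E by rewrite adde_ge0.
pose A := [set w | (t%:E <= Z w)%E].
have mA : measurable A by rewrite -[A]setTI; exact: emeasurable_fun_c_infty.
(* The deviation event need not be measurable; it is covered by the event of a large [Z] and the
   null set off which the measures are carried by [Omega]. *)
apply: (@le_trans _ _ (mu_ext Pr (A `|` N))).
  apply: le_mu_ext => w /= hw; have [Nw|Nw] := pselect (N w); [by right|left].
  rewrite /A /= leNgt; apply/negP => Zt.
  have [M1 N1] := supk w Nw.
  have z1 : (Z1 k w <= t%:E)%E by apply: le_trans (ltW Zt); rewrite leeDl.
  have z2 : (Z2 k w <= t%:E)%E by apply: le_trans (ltW Zt); rewrite leeDr.
  have tr : 0 <= t <= r0 by rewrite (ltW t0) ler_pdivrMr.
  have := herr _ _ t M1 N1 tr (h1 w t z1) (h2 w t z2).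
  move: hw; rewrite ak normrM normfV normrX (gtr0_norm Sk) => hw hb.
  have := lt_le_trans hw (ler_wpM2r _ hb).
  rewrite invr_ge0 exprn_ge0 ?(ltW Sk)// => /(_ isT).
  apply/negP; rewrite -leNgt /t expr_div_n exprS.
  rewrite (_ : K * _ / _ = K * S k / eta ^+ p.+1); last first.
    by field; rewrite !lt0r_neq0 ?exprn_gt0.
  by rewrite ler_pdivrMr ?exprn_gt0.
rewrite measurable_mu_extE; last exact: measurableU.
rewrite measureU0//.
have := markov_ge Pr mZ Z0 t0; rewrite -/A ge0_integralD// => mk.
have {}mk : (t%:E * Pr A <= (C * S k)%:E)%E.
  by apply: (le_trans mk); rewrite /C mulrDl EFinD leeD.
have pfin : Pr A \is a fin_num by exact: fin_num_measure.
suff pe : (Pr A <= e%:E)%E by exact: pe.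
move: pfin mk; case: (Pr A) => // r _; rewrite -EFinM !lee_fin => hr.
have rC : r <= C * eta.
  rewrite -(ler_pM2l t0); have -> // : t * (C * eta) = C * S k.
  by rewrite /t; field; exact: lt0r_neq0.
apply: (le_trans rC); rewrite /eta mulrCA ler_piMr ?(ltW e0)//.
by rewrite ler_pdivrMr ?ltr_wpDl// mul1r lerDl.
Unshelve. all: by end_near. Qed.

End stochastic_order.

Lemma iid_almost_surely {R : realType} {dW dT} {W : measurableType dW} {T : measurableType dT}
    (Pr : probability W R) (X : nat -> {RV Pr >-> T}) (P : probability T R) (A : set T) :
  iid X P -> measurable A -> P A = 1%E ->
  exists N, [/\ measurable N, Pr N = 0%E & forall w, ~ N w -> forall i, A (X i w)].
Proof.
move=> iX mA PA.
have mX i : measurable (X i @^-1` ~` A).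
  by rewrite -[X in measurable X]setTI; apply: measurable_funP => //; exact: measurableC.
have : Pr.-negligible (\bigcup_i (X i @^-1` ~` A)).
  apply: negligible_bigcup => i; exists (X i @^-1` ~` A); split=> //.
  have := iX.2 i _ (measurableC mA); rewrite [RHS]probability_setC// => h.
  by apply: (etrans h); rewrite PA subee.
move=> [N [mN N0 sub]]; exists N; split=> // w Nw i.
by apply: contrapT => Aw; exact: (Nw (sub w (ex_intro2 _ _ i I Aw))).
Qed.

Lemma cvg_inv_nat {R : realType} (m : nat -> nat) : m n @[n --> \oo] --> \oo ->
  (m n)%:R^-1 @[n --> \oo] --> (0 : R).
Proof.
move=> moo; apply/gtr0_cvgV0; last exact/cvgrnyP.
have : \forall k \near \oo, (0 < m k)%N by exact: (moo _ (nbhs_infty_gt 0)).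
by apply: filterS => k; rewrite ltr0n.
Qed.

Lemma cvg_sqrt0 {R : realType} (a : nat -> R) : a n @[n --> \oo] --> 0 ->
  Num.sqrt (a n) @[n --> \oo] --> (0 : R).
Proof.
move=> a0; rewrite -[X in _ --> X](sqrtr0 R).
by apply: continuous_cvg a0; exact: sqrt_continuous.
Qed.

Lemma sample_size_ratio {R : realType} (n m : nat) : (0 < n)%N -> (0 < m)%N ->
  (n + m)%:R / (n * m)%:R = n%:R^-1 + m%:R^-1 :> R.
Proof. by move=> n0 m0; rewrite natrD natrM; field; rewrite !pnatr_eq0 -!lt0n n0 m0. Qed.

Theorem theorem4p1 (R : realType) (d : nat) (Omega : set 'rV[R]_d)
    (eps lambda : R) (P Q : probability 'rV[R]_d R)
    (dW : measure_display) (W : measurableType dW) (Pr : probability W R)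
    (X Y : nat -> {RV Pr >-> 'rV[R]_d}) (m : nat -> nat) :
  0 < eps ->
  compact Omega ->
  P Omega = 1%E -> Q Omega = 1%E ->
  iid X P -> iid Y Q ->
  m n @[n --> \oo] --> \oo ->
  (m n)%:R / (n + m n)%:R @[n --> \oo] --> lambda ->
  0 < lambda < 1 ->
  ((forall A, measurable A -> P A = Q A) ->
     o_in_prob Pr
       (fun n w => D_eps eps (empirical X n w) (empirical Y (m n) w) -
          eps / 2 * M_form eps Omega P
            (meas_diff Omega (empirical X n w) (empirical Y (m n) w))
            (meas_diff Omega (empirical X n w) (empirical Y (m n) w)))
       (fun n => (n + m n)%:R / (n * m n)%:R) /\
     o_in_prob Pr
       (fun n w => D_eps eps (empirical X n w) P -
          eps / 2 * M_form eps Omega P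
            (meas_diff Omega (empirical X n w) P)
            (meas_diff Omega (empirical X n w) P))
       (fun n => n%:R^-1))
  /\
  (~ (forall A, measurable A -> P A = Q A) ->
     o_in_prob Pr
       (fun n w => D_eps eps (empirical X n w) (empirical Y (m n) w) - D_eps eps P Q -
          (meas_diff Omega (empirical X n w) P (psi eps P Q) +
           meas_diff Omega (empirical Y (m n) w) Q (psi eps Q P)))
       (fun n => Num.sqrt ((n + m n)%:R / (n * m n)%:R)) /\
     o_in_prob Pr
       (fun n w => D_eps eps (empirical X n w) Q - D_eps eps P Q -
          meas_diff Omega (empirical X n w) P (psi eps P Q))
       (fun n => (Num.sqrt n%:R)^-1)).
Proof.
move=> eps0 cO P1 Q1 iX iY moo _ _.
have [x0 Ox0] : Omega !=set0.
  apply/set0P/negP => /eqP Om; move: P1; rewrite Om measure0 => /eqP.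
  by rewrite eq_sym onee_eq0.
have mO := measurable_Omega cO.
have [L cL] := cost_bound cO Ox0.
have [B' B'0 XB'] := coord_bound cO Ox0.
pose B := B' + 1; have B0 : 0 < B by rewrite ltr_wpDl.
have XB i x : `|coord Omega x0 i x| <= B by rewrite (le_trans (XB' i x))// lerDl.
(* The summand 1 keeps the denominator positive when [d = 0]. *)
pose theta := (2 * (d%:R * B) + 1)^-1.
have dB0 : 0 <= d%:R * B by rewrite mulr_ge0// ltW.
have th0 : 0 < theta by rewrite invr_gt0 ltr_wpDl// mulr_ge0.
have thdB : theta * (d%:R * B) <= 1 / 2.
  by rewrite mulrC ler_pdivrMr ?ltr_wpDl ?mulr_ge0//; lra.
have bX := bmeas_coord cO Ox0.
have [NX [mNX NX0 XO]] := iid_almost_surely iX mO P1.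
have [NY [mNY NY0 YO]] := iid_almost_surely iY mO Q1.
have mpos : \forall k \near \oo, (0 < m k)%N by exact: (moo _ (nbhs_infty_gt 0)).
have kpos : \forall k \near \oo, (0 < k)%N by exact: nbhs_infty_gt.
(* The rates for one and for two samples. The square of [S2] is [1 / k + 1 / m k], hence [S2]
   dominates the rate of either sample. *)
pose S1 (k : nat) : R := (Num.sqrt k%:R)^-1.
pose S2 (k : nat) : R := Num.sqrt ((k + m k)%:R / (k * m k)%:R).
have S1E k : S1 k = Num.sqrt k%:R^-1 by rewrite /S1 sqrtrV.
have S1pos : \forall k \near \oo, 0 < S1 k.
  by apply: filterS kpos => k k0; rewrite invr_gt0 sqrtr_gt0 ltr0n.
have S10 : S1 k @[k --> \oo] --> (0 : R).
  by under eq_fun do rewrite S1E; apply: cvg_sqrt0; apply: cvg_inv_nat.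
have S2E : \forall k \near \oo, S2 k = Num.sqrt (k%:R^-1 + (m k)%:R^-1).
  by near=> k; rewrite /S2 sample_size_ratio//; near: k.
have S2pos : \forall k \near \oo, 0 < S2 k.
  near=> k; have -> : S2 k = Num.sqrt (k%:R^-1 + (m k)%:R^-1) by near: k.
  by rewrite sqrtr_gt0 addr_gt0// invr_gt0 ltr0n; near: k.
have S20 : S2 k @[k --> \oo] --> (0 : R).
  have h : Num.sqrt (k%:R^-1 + (m k)%:R^-1) @[k --> \oo] --> (0 : R).
    apply: cvg_sqrt0; rewrite -[X in _ --> X]addr0.
    by apply: cvgD; apply: cvg_inv_nat.
  apply: cvg_trans h; apply: near_eq_cvg; near=> k; apply/esym; near: k; exact: S2E.
have S12 : \forall k \near \oo, S1 k <= S2 k.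
  near=> k; have -> : S2 k = Num.sqrt (k%:R^-1 + (m k)%:R^-1) by near: k.
  by rewrite S1E ler_wsqrtr// lerDl invr_ge0.
have S1m2 : \forall k \near \oo, S1 (m k) <= S2 k.
  near=> k; have -> : S2 k = Num.sqrt (k%:R^-1 + (m k)%:R^-1) by near: k.
  by rewrite S1E ler_wsqrtr// lerDr invr_ge0.
have cX : concentrates Pr (coord Omega x0) theta P (empirical X) S1.
  exact: (concentrates_empirical bX XB B0 th0 thdB iX).
have cX2 : concentrates Pr (coord Omega x0) theta P (empirical X) S2.
  exact: concentrates_le S12 cX.
have cY2 : concentrates Pr (coord Omega x0) theta Q (fun k => empirical Y (m k)) S2.
  apply: concentrates_le S1m2 _; apply: (concentrates_subseq moo).
  exact: (concentrates_empirical bX XB B0 th0 thdB iY).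
have ccst (k : probability 'rV[R]_d R) :
    concentrates Pr (coord Omega x0) theta k (fun _ _ => k) S1.
  apply: (concentrates_le _ (concentrates_cst Pr (coord Omega x0) theta k)).
  by apply: filterS S1pos => l /ltW.
pose N := NX `|` NY; have mN : measurable N by exact: measurableU.
have N0 : Pr N = 0%E by rewrite /N measureU0.
have sup2 : \forall k \near \oo, forall w, ~ N w ->
    empirical X k w Omega = 1%E /\ empirical Y (m k) w Omega = 1%E.
  near=> k => w Nw; split; apply: empirical_full.
  - by near: k.
  - by apply: XO => h; apply: Nw; left.
  - by near: k.
  - by apply: YO => h; apply: Nw; right.
have sup1 (k' : probability 'rV[R]_d R) : k' Omega = 1%E ->
    \forall k \near \oo, forall w, ~ N w -> empirical X k w Omega = 1%E /\ k' Omega = 1%E.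
  by move=> h; apply: filterS sup2 => k hk w /hk[].
have S22 : \forall k \near \oo, (k + m k)%:R / (k * m k)%:R = S2 k ^+ 2.
  by apply: nearW => k; rewrite sqr_sqrtr// divr_ge0.
have S11 : \forall k \near \oo, k%:R^-1 = S1 k ^+ 2.
  by apply: nearW => k; rewrite S1E sqr_sqrtr// invr_ge0.
split=> [PQ|_].
- have iYP : iid Y P.
    by split; [exact: iY.1|move=> i A mA; rewrite (iY.2 i A mA) PQ].
  have cY2P : concentrates Pr (coord Omega x0) theta P (fun k => empirical Y (m k)) S2.
    apply: concentrates_le S1m2 _; apply: (concentrates_subseq moo).
    exact: (concentrates_empirical bX XB B0 th0 thdB iYP).
  have se := divergence_null cO Ox0 eps0 cL XB (ltW B0) th0 thdB P1.
  split.
    exact: (small_error_o_in_prob se cX2 cY2P mN N0 sup2 S2pos S20 S22).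
  exact: (small_error_o_in_prob se cX (ccst P) mN N0 (sup1 P P1) S1pos S10 S11).
- have se := divergence_alternative cO Ox0 eps0 cL XB (ltW B0) th0 thdB P1 Q1.
  split.
    apply: (small_error_o_in_prob (p := 1) se cX2 cY2 mN N0 sup2 S2pos S20).
    by apply: nearW => k; rewrite expr1.
  have e1 : \forall k \near \oo, S1 k = S1 k ^+ 1 by apply: nearW => k; rewrite expr1.
  (* The one-sample statement is the two-sample one with the constant sequence [Q], for which the
     second linear term is 0. *)
  have h := small_error_o_in_prob (p := 1) se cX (ccst Q) mN N0 (sup1 Q Q1) S1pos S10 e1.
  move: h; rewrite (_ : (fun k w => _) = (fun n w => D_eps eps (empirical X n w) Q - D_eps eps P Q -
     meas_diff Omega (empirical X n w) P (psi eps P Q)))//.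
  by apply/funext => k; apply/funext => w; rewrite /meas_diff [X in _ - (_ + X)]subrr addr0.
Unshelve. all: by end_near. Qed.
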